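(* On the $2$-step nilpotent Lie algebras $\mathfrak{h}_3^{\mathbb{C}}\oplus\mathbb{R}$ and $\mathfrak{n}_{5,2}\oplus\mathbb{R}^2$ there exist purely coclosed $\mathrm{G}_2$-structures inducing a nilsoliton metric, while the Lie algebras $\mathfrak{h}_3\oplus\mathfrak{h}_3\oplus\mathbb{R}$ and $\mathfrak{n}_{6,2}\oplus\mathbb{R}$ do not admit any purely coclosed $\mathrm{G}_2$-structure inducing a nilsoliton metric.
   Context: Real Lie algebras are described by the tuple $(\mathrm{d}f^1,\dots,\mathrm{d}f^7)$ for a basis $\{f^i\}$ of the dual, with $f^{ij}=f^i\wedge f^j$: $\mathfrak{h}_3^{\mathbb{C}}\oplus\mathbb{R}=(0,0,0,0,f^{13}-f^{24},f^{14}+f^{23},0)$, $\mathfrak{n}_{5,2}\oplus\mathbb{R}^2=(0,0,0,0,f^{12},f^{13},0)$, $\mathfrak{h}_3\oplus\mathfrak{h}_3\oplus\mathbb{R}=(0,0,0,0,f^{12},f^{34},0)$, $\mathfrak{n}_{6,2}\oplus\mathbb{R}=(0,0,0,0,f^{12},f^{14}+f^{23},0)$. $\mathrm{d}$ is the Chevalley-Eilenberg differential ($\mathrm{d}\alpha(x,y)=-\alpha([x,y])$ for $\alpha\in\mathfrak{n}^*$, extended as a graded derivation of $\Lambda^\bullet\mathfrak{n}^*$). A nilsoliton metric on a nilpotent Lie algebra $\mathfrak{n}$ is an inner product $g$ whose Ricci endomorphism (that of the corresponding left-invariant Riemannian metric on the simply connected Lie group with Lie algebra $\mathfrak{n}$)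 is of the form $\mathrm{Rc}(g)=\lambda\,\mathrm{Id}+D$ for some $\lambda\in\mathbb{R}$ and some derivation $D$ of $\mathfrak{n}$; it is known to be unique up to automorphism and scaling when it exists. A $\mathrm{G}_2$-structure on a $7$-dimensional real vector space $V$ is a $3$-form $\varphi\in\Lambda^3V^*$ such that $(v\lrcorner\varphi)\wedge(v\lrcorner\varphi)\wedge\varphi\neq0$ for all $v\in V\smallsetminus\{0\}$. It determines a unique inner product $g_\varphi$ and orientation, with volume form $\mathrm{vol}_\varphi$, such that $g_\varphi(v,w)\mathrm{vol}_\varphi=\frac16\,(v\lrcorner\varphi)\wedge(w\lrcorner\varphi)\wedge\varphi$; $*_\varphi$ is the corresponding Hodge operator. $\varphi$ induces $g$ if $g_\varphi=g$. A $\mathrm{G}_2$-structure $\varphi$ on $\mathfrak{n}$ is purely coclosed if $\mathrm{d}*_\varphi\varphi=0$ and $\mathrm{d}\varphi\wedge\varphi=0$. *)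

(* Defs.v *)
From HB Require Import structures.
From mathcomp Require Import all_boot all_order all_algebra.
From mathcomp Require Import reals.
From mathcomp Require Import ring.
Set Implicit Arguments.
Unset Strict Implicit.
Unset Printing Implicit Defensive.
Import Order.TTheory GRing.Theory Num.Theory.
Local Open Scope ring_scope.

(* V = R^n is 'rV[R]_n with its standard basis e_i, and f^i is the dual basis.
   An element of the exterior algebra of V^* is given by its coefficients in
   the basis f^I = f^i1 /\ ... /\ f^ik, I = {i1 < ... < ik} (see ext_basisE).
   Inner products on V are given by their Gram matrix in the basis e_i, and the
   dual basis vector for g of the covector f^i is row i (invmx G). *)
Section Exterior.
Variables (R : realType) (n : nat).

Definition ext := {ffun {set 'I_n} -> R}.

HB.instance Definition _ := 
  GRing.Lmodule.copy ext {ffun {set 'I_n} -> R^o}.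

Definition is_form (k : nat) (a : ext) := forall I : {set 'I_n}, #|I| != k -> a I = 0.

(* f^I /\ f^J = wsign I J f^(I u J) for disjoint I, J. *)
Definition wsign (I J : {set 'I_n}) : R :=
  (-1) ^+ #|[set p in setX I J | (p.2 < p.1)%N]|.

Definition wedge (a b : ext) : ext :=
  [ffun K : {set 'I_n} =>
     \sum_(I : {set 'I_n} | I \subset K) wsign I (K :\: I) * a I * b (K :\: I)].

Definition basis_form (I : {set 'I_n}) : ext := [ffun J => (J == I)%:R].

Definition cov (i : 'I_n) : ext := basis_form [set i].

Definition wedge_list (s : seq 'I_n) : ext :=
  foldr (fun i a => wedge (cov i) a) (basis_form set0) s.

Definition contract (v : 'rV[R]_n) (a : ext) : ext :=
  [ffun J : {set 'I_n} =>
     \sum_(i | i \notin J) wsign [set i] J * v 0 i * a (i |: J)].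

(* The value a(v1, ..., vk) for s = [:: v1; ...; vk] and a of degree k. *)
Definition ext_eval (a : ext) (s : seq 'rV[R]_n) : R :=
  foldl (fun b v => contract v b) a s set0.

Definition inner_product (G : 'M[R]_n) :=
  G^T = G /\ forall x : 'rV[R]_n, x != 0 -> 0 < (x *m G *m x^T) 0 0.

Definition inner (G : 'M[R]_n) (x y : 'rV[R]_n) : R := (x *m G *m y^T) 0 0.

Definition sharps (G : 'M[R]_n) (I : {set 'I_n}) : seq 'rV[R]_n :=
  [seq row i (invmx G) | i <- enum I].

(* The inner product induced by G on forms of the same degree: full
   contraction of a with b after raising the indices of b. *)
Definition ext_inner (G : 'M[R]_n) (a b : ext) : R :=
  \sum_(I : {set 'I_n}) a I * ext_eval b (sharps G I).

Definition is_volume (G : 'M[R]_n) (vol : ext) :=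
  is_form n vol /\ ext_inner G vol vol = 1.

(* The Hodge operator, characterized by hodgeP: a /\ *b = <a, b> vol. The
   coefficient of f^J in *b is read off from the pairing with f^(~: J). *)
Definition hodge (G : 'M[R]_n) (vol b : ext) : ext :=
  [ffun J : {set 'I_n} =>
     wsign (~: J) J * ext_eval b (sharps G (~: J)) * vol setT].

End Exterior.

Section ExteriorTheory.
Variables (R : realType) (n : nat).
Implicit Types (a b : ext R n) (v x y : 'rV[R]_n) (I J K : {set 'I_n}) (i j k : 'I_n).

Lemma wsign_sqr I J : wsign R I J * wsign R I J = 1.
Proof. by rewrite /wsign -exprD addnn -mul2n exprM sqrrN !expr1n. Qed.

Lemma wsign1 i J : wsign R [set i] J = \prod_(j in J) (-1) ^+ (j < i)%N.
Proof.
have -> : wsign R [set i] J = (-1) ^+ #|[set j in J | (j < i)%N]|.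
  congr (_ ^+ _); rewrite -[RHS](@card_imset _ _ (pair i)); last by move=> ? ? [].
  apply: eq_card => -[k j]; rewrite !inE /=; apply/andP/imsetP => /=.
    by move=> [/andP[/eqP-> jJ] ji]; exists j; rewrite ?inE ?jJ.
  by move=> [j']; rewrite inE => /andP[? ?] [-> ->]; rewrite eqxx.
rewrite -prodr_const (eq_bigl (fun j => (j \in J) && (j < i)%N)); last first.
  by move=> j; rewrite inE.
by rewrite big_mkcondr; apply: eq_bigr => j _; case: ifP.
Qed.

Lemma wsign1_0 i : wsign R [set i] set0 = 1.
Proof. by rewrite wsign1 big_set0. Qed.

Lemma wsign1U1 i (k : 'I_n) J : k \notin J ->
  wsign R [set i] (k |: J) = (-1) ^+ (k < i)%N * wsign R [set i] J.
Proof. by move=> kJ; rewrite !wsign1 big_setU1. Qed.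

Lemma wedge_covE i b K :
  wedge (cov R i) b K =
    if i \in K then wsign R [set i] (K :\ i) * b (K :\ i) else 0.
Proof.
rewrite ffunE; case: ifPn => iK.
  rewrite (bigD1 [set i]) ?sub1set //= big1 ?addr0 => [|I /andP[_ /negPf ne]].
    by rewrite ffunE eqxx mulr1.
  by rewrite ffunE ne mulr0 mul0r.
rewrite big1 // => I IK; rewrite ffunE; case: eqP => [E|]; last by rewrite mulr0 mul0r.
by move: iK; rewrite -sub1set -E IK.
Qed.

Lemma form_wedge_cov (k : nat) i b : is_form k b -> is_form k.+1 (wedge (cov R i) b).
Proof.
move=> hb K cK; rewrite wedge_covE; case: ifPn => // iK.
rewrite hb ?mulr0 //; apply: contra cK => /eqP <-.
by rewrite (cardsD1 i K) iK.
Qed.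

Lemma contract_wedge_cov v i b :
  contract v (wedge (cov R i) b) =
    (v 0 i : R) *: b - wedge (cov R i) (contract v b).
Proof.
apply/ffunP=> J; rewrite [RHS]ffunE [X in _ + X]ffunE wedge_covE !ffunE /=.
case: ifPn => iJ; last first.
  rewrite subr0 (bigD1 i) //= big1 ?addr0 => [|k /andP[kJ ki]].
    rewrite wedge_covE setU11 setU1K //.
    transitivity (wsign R [set i] J * wsign R [set i] J * (v 0 i * b J)).
      by ring.
    by rewrite wsign_sqr mul1r.
  by rewrite wedge_covE !inE eq_sym (negPf ki) (negPf iJ) /= mulr0.
rewrite [X in _ = _ - _ * X](bigD1 i) /= ?setD11 // setD1K //.
rewrite mulrDr opprD.
have -> : wsign R [set i] (J :\ i) * (wsign R [set i] (J :\ i) * v 0 i * b J)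
   = (v 0 i * b J : R).
  by rewrite !mulrA wsign_sqr mul1r.
rewrite addrA subrr add0r mulr_sumr -sumrN.
apply: eq_big => [k|k kJ]; first by rewrite !inE; case: eqVneq => [->|] //=; rewrite ?iJ ?andbT.
have ki : k != i by apply: contraNneq kJ => ->.
have E : (k |: J) :\ i = k |: (J :\ i).
  by apply/setP=> j; rewrite !inE; case: (eqVneq j k) => [->|] //=; rewrite ki.
have kJi : k \notin J :\ i by rewrite !inE negb_and kJ orbT.
rewrite wedge_covE !inE iJ orbT E wsign1U1 //.
rewrite -{1}(setD1K iJ) wsign1U1 ?setD11 //.
have -> : ((-1) ^+ (i < k)%N : R) = - (-1) ^+ (k < i)%N.
  by move: ki; rewrite -val_eqE /=; case: ltngtP => //= _ _; rewrite ?opprK ?expr0 ?expr1.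
have : ((-1) ^+ (k < i)%N * (-1) ^+ (k < i)%N : R) = 1.
  by rewrite -exprD addnn -mul2n exprM sqrrN !expr1n.
move: (_ ^+ _) (wsign _ _ _) (wsign _ _ _) => s w1 w2 ss.
transitivity (- (s * s) * (w1 * v 0 k * w2 * b (k |: J :\ i))); first by ring.
by rewrite ss; ring.
Qed.

Lemma wedge_list_basis (s : seq 'I_n) :
  sorted ltn (map val s) -> wedge_list R s = basis_form R [set j in s].
Proof.
elim: s => [_|i s IH] /=.
  by congr basis_form; apply/setP=> j; rewrite !inE.
move=> ps; rewrite IH; last exact: path_sorted ps.
have lt_s j : j \in s -> (i < j)%N.
  by move=> js; apply: (allP (order_path_min ltn_trans ps)); apply: map_f.
apply/ffunP=> K; rewrite wedge_covE !ffunE.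
have is_ : i \notin [set j in s].
  by rewrite inE; apply/negP => /lt_s; rewrite ltnn.
case: ifPn => iK.
  rewrite (_ : (K == [set j in i :: s]) = (K :\ i == [set j in s])).
    case: eqP => [E|]; last by rewrite mulr0.
    rewrite E wsign1 big1 ?mulr1 // => j; rewrite inE => /lt_s ij.
    by rewrite ltnNge (ltnW ij) expr0.
  by rewrite set_cons; apply/eqP/eqP => [->|<-]; rewrite ?setU1K ?setD1K.
case: eqP => // E; by move: iK; rewrite E !inE eqxx.
Qed.

Lemma ext_basisE I : basis_form R I = wedge_list R (enum I).
Proof.
rewrite wedge_list_basis; first by congr basis_form; apply/setP=> j; rewrite inE mem_enum.
have -> : enum I = filter (mem I) (enum 'I_n) by rewrite !enumT.
apply: (@homo_sorted _ _ val (fun i j : 'I_n => (i < j)%N)) => //.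
apply: sorted_filter; first by move=> ? ? ?; apply: ltn_trans.
by rewrite -(@sorted_map _ _ val ltn) val_enum_ord iota_ltn_sorted.
Qed.

Lemma contract_form (k : nat) v a : is_form k.+1 a -> is_form k (contract v a).
Proof.
move=> ha J hJ; rewrite ffunE big1 // => i hi.
by rewrite ha ?mulr0 // cardsU1 hi add1n eqSS.
Qed.

Lemma contract_form0 v a : is_form 0 a -> contract v a = 0.
Proof.
move=> ha; apply/ffunP=> J; rewrite !ffunE big1 // => i hi.
by rewrite ha ?mulr0 // cardsU1 hi.
Qed.

Lemma contract0 v : contract v 0 = 0 :> ext R n.
Proof.
by apply/ffunP=> J; rewrite !ffunE big1 // => i _; rewrite ffunE mulr0.
Qed.

Lemma ext_eval0 s : ext_eval (0 : ext R n) s = 0.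
Proof.
by rewrite /ext_eval; elim: s => [|v s IH] /=; rewrite ?ffunE ?contract0.
Qed.

Lemma ext_eval_degree (k : nat) a s : is_form k a -> size s != k -> ext_eval a s = 0.
Proof.
rewrite /ext_eval; elim: s k a => [|v s IH] [|k] a ha //= hs.
- by rewrite ha // cards0.
- by rewrite contract_form0 //; apply: ext_eval0.
- by apply: (IH k) => //; apply: contract_form.
Qed.

Lemma contract_lin c v x a :
  contract (c *: v + x) a = c *: contract v a + contract x a.
Proof.
apply/ffunP=> J; rewrite !ffunE /GRing.scale /= mulr_sumr -big_split /=.
by apply: eq_bigr => i _; rewrite !mxE; ring.
Qed.

Lemma contract_linr c v a b :
  contract v (c *: a + b) = c *: contract v a + contract v b.
Proof.
apply/ffunP=> J; rewrite !ffunE /GRing.scale /= mulr_sumr -big_split /=.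
by apply: eq_bigr => i _; rewrite !ffunE /GRing.scale /=; ring.
Qed.

Lemma contract_contract v a : contract v (contract v a) = 0.
Proof.
apply/ffunP=> J; rewrite !ffunE.
pose F i k : R := wsign R [set i] J * v 0 i *
   (wsign R [set k] (i |: J) * v 0 k * a (k |: (i |: J))).
rewrite (eq_bigr (fun i => \sum_(k | (k \notin J) && (k != i)) F i k)); last first.
  move=> i iJ; rewrite ffunE mulr_sumr; apply: eq_bigl => k.
  by rewrite !inE negb_or andbC.
set S := \sum_(i | _) _.
suff SN : S = - S.
  move: (congr1 (+%R S) SN); rewrite subrr -mulr2n => /eqP.
  by rewrite mulrn_eq0 /= => /eqP.
rewrite {1}/S (exchange_big_dep (fun k => k \notin J)) /=; last by move=> i k _ /andP[].
rewrite /S -sumrN; apply: eq_bigr => k kJ; rewrite -sumrN.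
apply: eq_big => [i|i /and3P[iJ _ ki]]; first by rewrite kJ eq_sym.
rewrite /F setUCA !wsign1U1 //.
have -> : ((-1) ^+ (i < k)%N : R) = - (-1) ^+ (k < i)%N.
  by move: ki; rewrite -val_eqE /=; case: ltngtP => //= _ _; rewrite ?opprK ?expr0 ?expr1.
by ring.
Qed.

Lemma contract_cov v k : contract v (cov R k) = v 0 k *: basis_form R set0.
Proof.
apply/ffunP=> J; rewrite !ffunE /GRing.scale /=.
have [->|J0] := eqVneq J set0.
  rewrite (bigD1 k) ?inE //= big1 ?addr0 => [|l /andP[_ lk]].
    by rewrite wsign1_0 setU0 ffunE eqxx mul1r.
  by rewrite setU0 ffunE (inj_eq set1_inj) (negPf lk) mulr0.
rewrite big1 ?mulr0 // => l lJ; rewrite ffunE; case: eqP => [E|]; last by rewrite mulr0.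
case/set0Pn: J0 => m mJ; move: (setU11 l J) (setU1r l mJ); rewrite E !inE.
by move=> /eqP lk /eqP mk; move: lJ; rewrite lk -mk mJ.
Qed.

Lemma wedge_cov_set0 i (c : R) :
  wedge (cov R i) (c *: basis_form R set0) = c *: cov R i.
Proof.
apply/ffunP=> K; rewrite wedge_covE !ffunE /GRing.scale /=.
case: ifPn => iK; last first.
  by case: eqP => [E|]; rewrite ?mulr0 //; move: iK; rewrite E inE eqxx.
have -> : (K == [set i]) = (K :\ i == set0).
  by apply/eqP/eqP => [->|E]; rewrite ?setDv // -(setD1K iK) E setU0.
by case: eqP => [->|_]; rewrite ?wsign1_0 ?mul1r ?mulr0.
Qed.

Lemma form_0 (k : nat) : is_form k (0 : ext R n).
Proof. by move=> I _; rewrite ffunE. Qed.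

Lemma form_N (k : nat) a : is_form k a -> is_form k (- a).
Proof. by move=> ha I hI; rewrite ffunE ha // oppr0. Qed.

Lemma form_D (k : nat) a b : is_form k a -> is_form k b -> is_form k (a + b).
Proof. by move=> ha hb I hI; rewrite ffunE ha // hb // addr0. Qed.

Lemma wedge_set0 a : wedge a (basis_form R set0) = a.
Proof.
apply/ffunP=> K; rewrite ffunE (bigD1 K) //= setDv !ffunE eqxx mulr1.
rewrite /wsign big1 ?addr0 => [|I /andP[IK ne]].
  by rewrite (_ : [set _ in _ | _] = set0) ?cards0 ?mul1r //; apply/setP=> p; rewrite !inE andbF.
rewrite ffunE setD_eq0; case: (boolP (K \subset I)) => KI; last by rewrite mulr0.
by move: ne; rewrite eqEsubset IK KI.
Qed.

Lemma contractZ v (c : R) a : contract v (c *: a) = c *: contract v a.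
Proof.
by have := contract_linr c v a 0; rewrite contract0 !addr0.
Qed.

Lemma ext_eval2_lin (c : R) a b x y :
  ext_eval (c *: a + b) [:: x; y] = c * ext_eval a [:: x; y] + ext_eval b [:: x; y].
Proof. by rewrite /ext_eval /= !contract_linr !ffunE. Qed.

Lemma ext_eval2Z (c : R) a x y :
  ext_eval (c *: a) [:: x; y] = c * ext_eval a [:: x; y].
Proof. by have := ext_eval2_lin c a 0 x y; rewrite !addr0 ext_eval0 addr0. Qed.

Lemma ext_eval2D a b x y :
  ext_eval (a + b) [:: x; y] = ext_eval a [:: x; y] + ext_eval b [:: x; y].
Proof. by have := ext_eval2_lin 1 a b x y; rewrite scale1r mul1r. Qed.

Lemma ext_eval2N a x y : ext_eval (- a) [:: x; y] = - ext_eval a [:: x; y].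
Proof. by rewrite -scaleN1r ext_eval2Z mulN1r. Qed.

Lemma ext_eval2_sum (I : Type) (r : seq I) (P : pred I) (F : I -> ext R n) x y :
  ext_eval (\sum_(i <- r | P i) F i) [:: x; y]
    = \sum_(i <- r | P i) ext_eval (F i) [:: x; y].
Proof.
apply: (big_morph (fun a => ext_eval a [:: x; y])); last exact: ext_eval0.
by move=> a b; apply: ext_eval2D.
Qed.

Lemma ext_eval2_linl (c : R) a x y z :
  ext_eval a [:: c *: x + y; z] = c * ext_eval a [:: x; z] + ext_eval a [:: y; z].
Proof. by rewrite /ext_eval /= contract_lin contract_linr !ffunE. Qed.

Lemma ext_eval2_linr (c : R) a x y z :
  ext_eval a [:: z; c *: x + y] = c * ext_eval a [:: z; x] + ext_eval a [:: z; y].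
Proof. by rewrite /ext_eval /= contract_lin !ffunE. Qed.

Lemma ext_eval2_alt a x : ext_eval a [:: x; x] = 0.
Proof. by rewrite /ext_eval /= contract_contract ffunE. Qed.

Lemma ext_eval_wedge_cov2 i j x y :
  ext_eval (wedge (cov R i) (cov R j)) [:: x; y] = x 0 i * y 0 j - x 0 j * y 0 i.
Proof.
rewrite /ext_eval /= contract_wedge_cov contract_cov wedge_cov_set0.
rewrite -scaleNr contract_linr contractZ !contract_cov.
by rewrite !ffunE eqxx /GRing.scale /= !mulr1 mulNr.
Qed.

Lemma wedge_cov2 i j : (i < j)%N -> wedge (cov R i) (cov R j) = basis_form R [set i; j].
Proof.
move=> ij; rewrite -[X in wedge _ X]wedge_set0.
have -> : wedge (cov R i) (wedge (cov R j) (basis_form R set0)) = wedge_list R [:: i; j] by [].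
rewrite wedge_list_basis; last by rewrite /= andbT.
by congr basis_form; apply/setP=> l; rewrite !inE.
Qed.

Lemma contract_delta i a J : i \notin J ->
  contract (delta_mx 0 i) a J = wsign R [set i] J * a (i |: J).
Proof.
move=> iJ; rewrite ffunE (bigD1 i) //= big1 ?addr0 => [|l /andP[_ li]].
  by rewrite mxE !eqxx mulr1.
by rewrite mxE (negPf li) andbF mulr0 mul0r.
Qed.

Lemma form2E a : is_form 2 a ->
  a = \sum_(i < n) \sum_(j < n | (i < j)%N)
        ext_eval a [:: delta_mx 0 i; delta_mx 0 j] *: wedge (cov R i) (cov R j).
Proof.
move=> ha.
transitivity (\sum_(i < n) \sum_(j < n | (i < j)%N) a [set i; j] *: basis_form R [set i; j]); last first.
  apply: eq_bigr => i _; apply: eq_bigr => j ij; rewrite wedge_cov2 //; congr (_ *: _).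
  have ji : (j < i)%N = false by rewrite ltnNge ltnW.
  have nij : i \notin [set j] by rewrite inE -val_eqE /= neq_ltn ij.
  rewrite /ext_eval /= contract_delta ?inE // wsign1_0 mul1r setU0 contract_delta //.
  by rewrite -[[set j]]setU0 wsign1U1 ?inE // wsign1_0 ji mulr1 mul1r setU0.
apply/ffunP=> K; rewrite sum_ffunE.
have [cK|cK] := eqVneq #|K| 2%N; last first.
  rewrite ha // big1 // => i _; rewrite sum_ffunE big1 // => j ij.
  rewrite !ffunE /GRing.scale /=; case: eqP => [E|]; last by rewrite mulr0.
  have ne : i != j by rewrite -val_eqE /= neq_ltn ij.
  by move: cK; rewrite E cards2 ne.
have [k [l [kl ->]]] : exists k l : 'I_n, (k < l)%N /\ K = [set k; l].
  have /cards2P[k [l [kl ->]]] : #|K| == 2%N by apply/eqP.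
  move: kl; rewrite -val_eqE /= neq_ltn => /orP[kl|lk]; first by exists k, l.
  by exists l, k; rewrite setUC.
have sub (i j : 'I_n) : (i < j)%N -> [set k; l] = [set i; j] -> (i = k) * (j = l).
  move=> ij E; have := set21 k l; have := set22 k l; rewrite E !inE.
  move=> /orP[]/eqP e1 /orP[]/eqP e2; move: kl; rewrite ?e1 ?e2 ?ltnn //.
  by rewrite ltnNge ltnW.
rewrite (bigD1 k) //= sum_ffunE (bigD1 l) //= !ffunE eqxx /GRing.scale /= mulr1.
rewrite !big1 ?addr0 // => i.
  move=> ik; rewrite sum_ffunE big1 // => j ij; rewrite !ffunE /GRing.scale /=.
  by case: eqP => [/(sub _ _ ij)[e _]|]; rewrite ?mulr0 //; rewrite e eqxx in ik.
move=> /andP[ij il]; rewrite !ffunE /GRing.scale /=.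
by case: eqP => [/(sub _ _ ij)[_ e]|]; rewrite ?mulr0 //; rewrite e eqxx in il.
Qed.

Lemma wedge_eval_setT a b :
  wedge a b setT = \sum_(I : {set 'I_n}) wsign R I (~: I) * a I * b (~: I).
Proof.
rewrite ffunE; apply: eq_big => [I|I _]; first by rewrite subsetT.
by rewrite setTD.
Qed.

Lemma hodgeP G (vol a b : ext R n) (k : nat) :
    is_form n vol -> is_form k a -> is_form k b ->
  wedge a (hodge G vol b) = (ext_inner G a b : R) *: vol.
Proof.
move=> hvol ha hb; apply/ffunP=> K.
have [->|KT] := eqVneq K setT.
  rewrite wedge_eval_setT !ffunE /ext_inner [LHS]/= /GRing.scale /= mulr_suml.
  apply: eq_bigr => I _; rewrite ffunE setCK.
  transitivity (wsign R I (~: I) * wsign R I (~: I) *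
     (a I * ext_eval b (sharps G I) * vol setT)); last by rewrite wsign_sqr mul1r.
  by ring.
have cK : #|K| != n.
  by apply: contra KT => /eqP h; rewrite eqEcard subsetT /= cardsT card_ord h.
rewrite !ffunE (hvol K) // scaler0 big1 // => I IK.
have [cI|cI] := eqVneq #|I| k; last by rewrite ha // mulr0 mul0r.
rewrite ffunE (@ext_eval_degree k) ?mulr0 ?mul0r ?mulr0 //.
rewrite size_map -cardE; apply: contra cK => /eqP h.
have := cardsC (K :\: I); rewrite h cardsD (setIidPr IK) cI card_ord => E.
by apply/eqP; rewrite -[RHS]E subnK // -cI subset_leq_card.
Qed.

End ExteriorTheory.

Section LieAlgebra.
Variables (R : realType) (n : nat).
Local Notation V := 'rV[R]_n.

Record lieAlgebra := LieAlgebra {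
  bracket :> V -> V -> V;
  bracket_linl : forall (c : R) x y z,
    bracket (c *: x + y) z = c *: bracket x z + bracket y z;
  bracket_linr : forall (c : R) x y z,
    bracket z (c *: x + y) = c *: bracket z x + bracket z y;
  bracket_alt : forall x, bracket x x = 0;
  bracket_jacobi : forall x y z,
    bracket x (bracket y z) + bracket y (bracket z x)
      + bracket z (bracket x y) = 0 }.

Variable L : lieAlgebra.

Definition is_derivation (D : V -> V) :=
  forall x y, D (L x y) = L (D x) y + L x (D y).

Definition two_step_nilpotent :=
  (exists x y, L x y != 0) /\ forall x y z, L (L x y) z = 0.

(* d f^k = - \sum_(i < j) f^k([e_i, e_j]) f^ij, see dcov_eval. *)
Definition dcov (k : 'I_n) : ext R n :=
  \sum_(i < n) \sum_(j < n | (i < j)%N)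
    (- (L (delta_mx 0 i) (delta_mx 0 j)) 0 k) *: wedge (cov R i) (cov R j).

(* d (f^i1 /\ ... /\ f^ik), by the graded Leibniz rule. *)
Fixpoint dwedge_list (s : seq 'I_n) : ext R n :=
  if s is i :: s' then
    wedge (dcov i) (wedge_list R s') - wedge (cov R i) (dwedge_list s')
  else 0.

(* The Chevalley-Eilenberg differential, see ce_diff1 and ce_diff_basis. *)
Definition ce_diff (a : ext R n) : ext R n :=
  \sum_(I : {set 'I_n}) a I *: dwedge_list (enum I).

(* The Levi-Civita connection, curvature and Ricci curvature of the
   left-invariant metric given by G, on left-invariant vector fields.
   The vector u such that inner G u (e_k) = c_k for all k is
   (\row_k c_k) *m invmx G. *)
Variable G : 'M[R]_n.

Definition koszul (x y z : V) : R :=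
  (inner G (L x y) z - inner G (L y z) x + inner G (L z x) y) / 2.

Definition nabla (x y : V) : V :=
  (\row_k koszul x y (delta_mx 0 k)) *m invmx G.

Definition curvature (x y z : V) : V :=
  nabla x (nabla y z) - nabla y (nabla x z) - nabla (L x y) z.

Definition ricci (y z : V) : R :=
  \sum_(i < n) curvature (delta_mx 0 i) y z 0 i.

Definition ricci_endo (y : V) : V :=
  (\row_k ricci y (delta_mx 0 k)) *m invmx G.

Definition is_nilsoliton :=
  inner_product G /\
  exists (lambda : R) (D : {linear V -> V}),
    is_derivation D /\ forall x, ricci_endo x = lambda *: x + D x.

End LieAlgebra.

Section LieAlgebraTheory.
Variables (R : realType) (n : nat) (L : lieAlgebra R n).
Implicit Types (a b : ext R n) (x y z : 'rV[R]_n) (i j k : 'I_n).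

Lemma bracketDl x y z : L (x + y) z = L x z + L y z.
Proof. by have := bracket_linl L 1 x y z; rewrite !scale1r. Qed.

Lemma bracketDr x y z : L z (x + y) = L z x + L z y.
Proof. by have := bracket_linr L 1 x y z; rewrite !scale1r. Qed.

Lemma bracket0l x : L 0 x = 0.
Proof. by apply: (@addrI _ (L 0 x)); rewrite -bracketDl !addr0. Qed.

Lemma bracket0r x : L x 0 = 0.
Proof. by apply: (@addrI _ (L x 0)); rewrite -bracketDr !addr0. Qed.

Lemma bracketZl (c : R) x y : L (c *: x) y = c *: L x y.
Proof. by have := bracket_linl L c x 0 y; rewrite bracket0l !addr0. Qed.

Lemma bracketZr (c : R) x y : L y (c *: x) = c *: L y x.
Proof. by have := bracket_linr L c x 0 y; rewrite bracket0r !addr0. Qed.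

Lemma bracketC x y : L x y = - L y x.
Proof.
apply/eqP; rewrite -subr_eq0 opprK; apply/eqP.
by have := bracket_alt L (x + y);
  rewrite bracketDl !bracketDr !bracket_alt addr0 add0r.
Qed.

Lemma bracketE x y :
  L x y = \sum_(i < n) \sum_(j < n | (i < j)%N)
    (x 0 i * y 0 j - x 0 j * y 0 i) *: L (delta_mx 0 i) (delta_mx 0 j).
Proof.
set e := fun i => delta_mx 0 i : 'rV[R]_n.
transitivity (\sum_(i < n) \sum_(j < n) (x 0 i * y 0 j) *: L (e i) (e j)).
  rewrite {1}(row_sum_delta x).
  rewrite (big_morph (L^~ y) (fun u v => bracketDl u v y) (bracket0l y)).
  apply: eq_bigr => i _; rewrite bracketZl {1}(row_sum_delta y).
  rewrite (big_morph (L (e i)) (fun u v => bracketDr u v (e i)) (bracket0r (e i))).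
  by rewrite scaler_sumr; apply: eq_bigr => j _; rewrite bracketZr scalerA.
pose F i j := (x 0 i * y 0 j) *: L (e i) (e j).
transitivity (\sum_(i < n) (\sum_(j < n | (i < j)%N) F i j
    + \sum_(j < n | (j < i)%N) F i j)).
  apply: eq_bigr => i _; rewrite (bigD1 i) //= bracket_alt scaler0 add0r.
  rewrite (bigID (fun j : 'I_n => (i < j)%N)) /=; congr (_ + _);
    apply: eq_bigl => j; rewrite -val_eqE /=; by case: ltngtP.
rewrite big_split /= [X in _ + X](exchange_big_dep xpredT) //= -big_split /=.
apply: eq_bigr => i _; rewrite -big_split /=; apply: eq_bigr => j _.
by rewrite /F (bracketC (e j)) scalerN -scalerBl.
Qed.

Lemma dcov_eval k x y : ext_eval (dcov L k) [:: x; y] = - (L x y) 0 k.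
Proof.
rewrite /dcov ext_eval2_sum bracketE summxE -sumrN; apply: eq_bigr => i _.
rewrite ext_eval2_sum summxE -sumrN; apply: eq_bigr => j _.
by rewrite ext_eval2Z ext_eval_wedge_cov2 mxE mulNr mulrC.
Qed.

Lemma ce_diff_linear (c : R) a b :
  ce_diff L (c *: a + b) = c *: ce_diff L a + ce_diff L b.
Proof.
rewrite /ce_diff scaler_sumr -big_split /=; apply: eq_bigr => I _.
by rewrite !ffunE scalerDl scalerA.
Qed.

Lemma ce_diff_basis (I : {set 'I_n}) :
  ce_diff L (basis_form R I) = dwedge_list L (enum I).
Proof.
rewrite /ce_diff (bigD1 I) //= ffunE eqxx scale1r big1 ?addr0 // => J JI.
by rewrite ffunE (negPf JI) scale0r.
Qed.

Lemma ce_diff_cov k : ce_diff L (cov R k) = dcov L k.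
Proof.
rewrite /cov ce_diff_basis enum_set1 /= wedge_set0.
have := wedge_cov_set0 k (0 : R); rewrite !scale0r => ->; exact: subr0.
Qed.

Lemma ce_diff1 a x y : is_form 1 a ->
  ext_eval (ce_diff L a) [:: x; y] = - ext_eval a [:: L x y].
Proof.
move=> ha.
have aE : a = \sum_i a [set i] *: cov R i.
  apply/ffunP=> K; rewrite sum_ffunE.
  have [/cards1P[k ->]|cK] := boolP (#|K| == 1%N).
    rewrite (bigD1 k) //= !ffunE eqxx /GRing.scale /= mulr1 big1 ?addr0 // => i ik.
    by rewrite !ffunE (inj_eq set1_inj) eq_sym (negPf ik) /GRing.scale /= mulr0.
  rewrite ha // big1 // => i _; rewrite !ffunE /GRing.scale /=.
  by move: cK; have [->|_] := eqVneq K [set i]; rewrite ?cards1 ?mulr0.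
have d0 : ce_diff L 0 = 0.
  by rewrite /ce_diff big1 // => I _; rewrite ffunE scale0r.
have dE : ce_diff L a = \sum_i a [set i] *: dcov L i.
  rewrite {1}aE (big_morph (ce_diff L) (id1 := 0) (op1 := +%R)) //.
    apply: eq_bigr => i _.
    by have := ce_diff_linear (a [set i]) (cov R i) 0; rewrite d0 !addr0 ce_diff_cov.
  by move=> u v; have := ce_diff_linear 1 u v; rewrite !scale1r.
rewrite dE ext_eval2_sum [X in _ = - X]/ext_eval /= ffunE -sumrN.
apply: eq_big => [i|i _]; first by rewrite inE.
by rewrite ext_eval2Z dcov_eval wsign1_0 setU0 mul1r mulrN mulrC.
Qed.

End LieAlgebraTheory.

Section FromDifferentials.
Variables (R : realType) (n : nat).
Implicit Types (t : seq (ext R n)) (x y z : 'rV[R]_n).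

(* The Lie bracket with f^k([x, y]) = - df^k(x, y), for t = (df^1, ..., df^n);
   see ce_diff_two_step_lie. *)
Definition bracket_of t x y : 'rV[R]_n :=
  \row_k - ext_eval (nth 0 t k) [:: x; y].

Definition two_step_bracket t :=
  forall x y z, bracket_of t (bracket_of t x y) z = 0.

Lemma bracket_of_linl t (c : R) x y z :
  bracket_of t (c *: x + y) z = c *: bracket_of t x z + bracket_of t y z.
Proof. by apply/rowP=> k; rewrite !mxE ext_eval2_linl; ring. Qed.

Lemma bracket_of_linr t (c : R) x y z :
  bracket_of t z (c *: x + y) = c *: bracket_of t z x + bracket_of t z y.
Proof. by apply/rowP=> k; rewrite !mxE ext_eval2_linr; ring. Qed.

Lemma bracket_of_alt t x : bracket_of t x x = 0.
Proof. by apply/rowP=> k; rewrite !mxE ext_eval2_alt oppr0. Qed.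

Lemma bracket_of_jacobi t : two_step_bracket t -> forall x y z,
  bracket_of t x (bracket_of t y z) + bracket_of t y (bracket_of t z x)
    + bracket_of t z (bracket_of t x y) = 0.
Proof.
move=> h; have hr x y z : bracket_of t x (bracket_of t y z) = 0.
  set w := bracket_of t y z.
  have := bracket_of_alt t (1 *: x + w).
  rewrite bracket_of_linl !bracket_of_linr !bracket_of_alt !h.
  by rewrite !scale1r add0r !addr0.
by move=> x y z; rewrite !hr !addr0.
Qed.

Definition two_step_lie t (h : two_step_bracket t) : lieAlgebra R n :=
  LieAlgebra (bracket_of_linl t) (bracket_of_linr t) (bracket_of_alt t)
    (bracket_of_jacobi h).

Lemma ce_diff_two_step_lie t (h : two_step_bracket t) (k : 'I_n) :
  is_form 2 (nth 0 t k) ->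
  ce_diff (two_step_lie h) (cov R k) = nth 0 t k.
Proof.
move=> ht; rewrite ce_diff_cov [RHS]form2E // /dcov.
apply: eq_bigr => i _; apply: eq_bigr => j ij.
by rewrite /= mxE opprK.
Qed.

End FromDifferentials.

Section Algebras.
Variable R : realType.

(* f^i /\ f^j, with indices running from 1 to 7. *)
Definition f2 (i j : nat) : ext R 7 :=
  wedge (cov R (inord i.-1)) (cov R (inord j.-1)).

Definition h3C_R_diff : seq (ext R 7) :=
  [:: 0; 0; 0; 0; f2 1 3 - f2 2 4; f2 1 4 + f2 2 3; 0].

Definition n52_R2_diff : seq (ext R 7) :=
  [:: 0; 0; 0; 0; f2 1 2; f2 1 3; 0].

Definition h3_h3_R_diff : seq (ext R 7) :=
  [:: 0; 0; 0; 0; f2 1 2; f2 3 4; 0].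

Definition n62_R_diff : seq (ext R 7) :=
  [:: 0; 0; 0; 0; f2 1 2; f2 1 4 + f2 2 3; 0].

Lemma f2_eval i j x y : ext_eval (f2 i j) [:: x; y] =
  x 0 (inord i.-1) * y 0 (inord j.-1) - x 0 (inord j.-1) * y 0 (inord i.-1).
Proof. exact: ext_eval_wedge_cov2. Qed.

Lemma bracket_of_low (t : seq (ext R 7)) x y i :
  nth 0 t i = 0 -> (i < 7)%N -> bracket_of t x y 0 (inord i) = 0.
Proof. by move=> ti i7; rewrite mxE inordK // ti ext_eval0 oppr0. Qed.

Ltac two_step :=
  let k := fresh "k" in
  move=> x y z; apply/rowP=> k; rewrite [LHS]mxE [RHS]mxE;
  case: k => [[|[|[|[|[|[|[|k]]]]]]] hk] //=;
  rewrite ?(ext_eval2D, ext_eval2N, f2_eval, ext_eval0) /= ?bracket_of_low //;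
  by rewrite ?(mul0r, mulr0, subr0, addr0, oppr0).

Lemma h3C_R_two_step : two_step_bracket h3C_R_diff.
Proof. two_step. Qed.

Lemma n52_R2_two_step : two_step_bracket n52_R2_diff.
Proof. two_step. Qed.

Lemma h3_h3_R_two_step : two_step_bracket h3_h3_R_diff.
Proof. two_step. Qed.

Lemma n62_R_two_step : two_step_bracket n62_R_diff.
Proof. two_step. Qed.

Definition h3C_R : lieAlgebra R 7 := two_step_lie h3C_R_two_step.
Definition n52_R2 : lieAlgebra R 7 := two_step_lie n52_R2_two_step.
Definition h3_h3_R : lieAlgebra R 7 := two_step_lie h3_h3_R_two_step.
Definition n62_R : lieAlgebra R 7 := two_step_lie n62_R_two_step.

Lemma form_f2 i j : is_form 2 (f2 i j).
Proof.
apply: form_wedge_cov => K; rewrite ffunE.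
by have [->|//] := eqVneq K [set inord j.-1]; rewrite cards1.
Qed.

Ltac diffE :=
  apply: ce_diff_two_step_lie;
  match goal with k : 'I_7 |- _ => case: k => [[|[|[|[|[|[|[|k]]]]]]] hk] //= end;
  by repeat first [exact: form_f2 | exact: form_0 | apply: form_D | apply: form_N].

Lemma h3C_R_diffE (k : 'I_7) : ce_diff h3C_R (cov R k) = nth 0 h3C_R_diff k.
Proof. diffE. Qed.

Lemma n52_R2_diffE (k : 'I_7) : ce_diff n52_R2 (cov R k) = nth 0 n52_R2_diff k.
Proof. diffE. Qed.

Lemma h3_h3_R_diffE (k : 'I_7) :
  ce_diff h3_h3_R (cov R k) = nth 0 h3_h3_R_diff k.
Proof. diffE. Qed.

Lemma n62_R_diffE (k : 'I_7) : ce_diff n62_R (cov R k) = nth 0 n62_R_diff k.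
Proof. diffE. Qed.

Ltac nonabelian i j :=
  exists (delta_mx 0 (inord i)), (delta_mx 0 (inord j));
  apply/eqP => /rowP/(_ (inord 4)); rewrite !mxE inordK //=;
  rewrite ?(ext_eval2D, ext_eval2N, f2_eval) /= !mxE -!val_eqE /= !inordK //=;
  rewrite ?(mul0r, mulr0, mulr1, subr0, addr0, oppr0);
  by move/eqP; rewrite oppr_eq0 oner_eq0.

Lemma h3C_R_nilpotent : two_step_nilpotent h3C_R.
Proof. by split; [nonabelian 0%N 2%N | exact: h3C_R_two_step]. Qed.

Lemma n52_R2_nilpotent : two_step_nilpotent n52_R2.
Proof. by split; [nonabelian 0%N 1%N | exact: n52_R2_two_step]. Qed.

Lemma h3_h3_R_nilpotent : two_step_nilpotent h3_h3_R.
Proof. by split; [nonabelian 0%N 1%N | exact: h3_h3_R_two_step]. Qed.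

Lemma n62_R_nilpotent : two_step_nilpotent n62_R.
Proof. by split; [nonabelian 0%N 1%N | exact: n62_R_two_step]. Qed.

End Algebras.

Section G2.
Variable R : realType.
Implicit Types phi vol : ext R 7.

Definition is_G2 phi :=
  is_form 3 phi /\
  forall v : 'rV[R]_7, v != 0 ->
    wedge (wedge (contract v phi) (contract v phi)) phi != 0.

(* G and vol are the inner product and volume form determined by phi; they
   are unique by G2_metric_volume_unique. *)
Definition G2_metric_volume phi (G : 'M[R]_7) vol :=
  [/\ inner_product G, is_volume G vol &
      forall v w : 'rV[R]_7,
        inner G v w *: vol =
        6^-1 *: wedge (wedge (contract v phi) (contract w phi)) phi].

Lemma ext_evalZ n (c : R) (a : ext R n) s :
  ext_eval (c *: a) s = c * ext_eval a s.
Proof.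
rewrite /ext_eval; elim: s a => [|v s IH] a /=; first by rewrite ffunE.
by rewrite contractZ IH.
Qed.

Lemma ext_eval_map_scale n (c : R) (a : ext R n) (s : seq 'rV[R]_n) :
  ext_eval a [seq c *: v | v <- s] = c ^+ size s * ext_eval a s.
Proof.
elim: s a => [|v s IH] a /=; first by rewrite expr0 mul1r.
have cons b u : ext_eval a (b :: u) = ext_eval (contract b a) u by [].
have cZ : contract (c *: v) a = c *: contract v a.
  have := contract_lin c v 0 a; rewrite addr0 => ->.
  rewrite [contract 0 a](_ : _ = 0) ?addr0 //; apply/ffunP=> J.
  by rewrite !ffunE big1 // => k _; rewrite mxE mulr0 mul0r.
by rewrite !cons cZ ext_evalZ IH exprS mulrA.
Qed.

Lemma inner_product_unit n (G : 'M[R]_n) : inner_product G -> G \in unitmx.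
Proof.
move=> [_ pos]; rewrite -row_free_unit -kermx_eq0; apply/eqP/row_matrixP => i.
rewrite row0; have [//|/pos] := eqVneq (row i (kermx G)) 0.
by rewrite -row_mul mulmx_ker row0 mul0mx mxE ltxx.
Qed.

Lemma G2_metric_volume_unique phi (G G' : 'M[R]_7) vol vol' :
  G2_metric_volume phi G vol -> G2_metric_volume phi G' vol' ->
  G = G' /\ vol = vol'.
Proof.
move=> [ipG [fv nv] h] [ipG' [fv' nv'] h'].
have innerE (H : 'M[R]_7) w : is_form 7 w ->
    ext_inner H w w = w setT * ext_eval w (sharps H setT).
  move=> {}fv; rewrite /ext_inner (bigD1 setT) //= big1 ?addr0 // => I IT.
  rewrite fv ?mul0r //; apply: contra IT => /eqP cI.
  by rewrite eqEcard subsetT /= cardsT card_ord cI.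
have vT0 : vol setT != 0.
  by apply/eqP => v0; move: nv; rewrite innerE // v0 mul0r => /esym/eqP; rewrite oner_eq0.
pose c := vol' setT / vol setT.
have v'E : vol' = c *: vol.
  apply/ffunP=> K; rewrite ffunE /GRing.scale /=.
  have [->|KT] := eqVneq K setT; first by rewrite /c divfK.
  have cK : #|K| != 7.
    by apply: contra KT => /eqP cK; rewrite eqEcard subsetT /= cardsT card_ord cK.
  by rewrite fv // fv' // mulr0.
have inn (H : 'M[R]_7) i j : inner H (delta_mx 0 i) (delta_mx 0 j) = H i j :> R.
  by rewrite /inner -rowE trmx_delta -colE !mxE.
have GE : G = c *: G'.
  apply/matrixP=> i j; rewrite mxE -!inn.
  have := h (delta_mx 0 i) (delta_mx 0 j); rewrite -h' v'E scalerA => /ffunP/(_ setT).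
  by rewrite !ffunE /GRing.scale /= => /(mulIf vT0) ->; rewrite mulrC.
have c0 : c != 0.
  apply/eqP => c0; move: nv'; rewrite v'E c0 scale0r /ext_inner big1.
    by move/esym/eqP; rewrite oner_eq0.
  by move=> I _; rewrite ffunE mul0r.
have c9 : c ^+ 9 = 1.
  have shE : sharps G' setT = [seq c *: v | v <- sharps G setT].
    rewrite /sharps -map_comp; apply: eq_map => i /=.
    have uG := inner_product_unit ipG.
    by rewrite -linearZ /= GE invmxZ ?scalerA ?divff ?scale1r // -GE.
  rewrite -nv' innerE // shE v'E ext_evalZ ext_eval_map_scale size_map.
  rewrite -cardE cardsT card_ord !ffunE /GRing.scale /=.
  transitivity (c ^+ 9 * (vol setT * ext_eval vol (sharps G setT))).
    by rewrite -innerE // nv mulr1.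
  by ring.
have pos (H : 'M[R]_7) : inner_product H -> 0 < H ord0 ord0.
  move=> [_ /(_ (delta_mx 0 ord0))]; rewrite -/(inner _ _ _) inn; apply.
  by apply/eqP => /rowP/(_ ord0)/eqP; rewrite !mxE !eqxx oner_eq0.
have c1 : c = 1.
  apply/eqP; rewrite -(@pexpr_eq1 _ c 9) ?c9 //.
  move: (pos _ ipG); rewrite GE mxE => p.
  by rewrite -(pmulr_lge0 _ (pos _ ipG')) ltW.
by rewrite GE v'E c1 !scale1r.
Qed.

Definition G2_induces phi (G : 'M[R]_7) :=
  exists vol, G2_metric_volume phi G vol.

Definition purely_coclosed (L : lieAlgebra R 7) phi :=
  [/\ is_G2 phi,
      exists G vol, G2_metric_volume phi G vol /\
        ce_diff L (hodge G vol phi) = 0 &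
      wedge (ce_diff L phi) phi = 0].

End G2.

(* Main.v *)
(** All four algebras have the form [x, y] = A(x, y) e_4 + C(x, y) e_5 with e_4 and e_5
    central, in 0-based indices. Given a G2-structure, choose an orthonormal frame b with
    b_4, b_5 spanning the plane <e_4, e_5> and b_5 parallel to e_5, b_6 = b_4 x b_5, b_0 any
    unit vector orthogonal to them, and b_1, b_2, b_3 equal to b_4, b_5, b_6 times b_0 up to
    sign. As |x x y| = 1 for orthonormal x and y, the values of phi on b are +1, -1 and 0 in
    a fixed pattern. Then phi is purely coclosed iff b_6 is central and the 2-forms A and C
    (now taken with respect to b_4, b_5) on the span of b_0, ..., b_3 have components (p, q, 0)
    and (-q, p, 0) in one of the two spaces of (anti-)self-dual forms; in particular the scalar
    product of A and C equals their polarized Pfaffian Pf(A, C).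

    The standard form satisfies these equations on h_3^C + R and n_{5,2} + R^2 with the
    Euclidean metric, which is a nilsoliton. On h_3 + h_3 + R derivations preserve the line of
    e_5, so the soliton equation gives <A, C> = 0, whereas Pf(A, C) is not 0. On n_{6,2} + R one
    has Pf(A, A) = Pf(A, C) = 0 and Pf(C, C) is not 0, and then the soliton equation forces
    A = 0. *)

Require Import Defs.
From mathcomp Require Import all_boot all_order all_algebra.
From mathcomp Require Import reals.
From mathcomp Require Import ring lra.

Set Implicit Arguments.
Unset Strict Implicit.
Unset Printing Implicit Defensive.

Import Order.TTheory GRing.Theory Num.Theory.
Local Open Scope ring_scope.

(** * Exterior algebra *)

(** The only link between [phi] and its metric is the cubic identity [(v _| phi) /\ (w _| phi) /\
    phi = 6 g(v, w) vol]. On an orthonormal frame it is a system of polynomial equations in the 35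
    values of [phi], and [|x x y| = 1] has to be extracted from it: with [phi = b^0 /\ omega + rho],
    the equations force [omega /\ rho = 0]; then [omega] times Hitchin's endomorphism of [rho] is
    scalar, so [omega ^ 2 = - nu], and the Pfaffian of [omega] gives [nu ^ 3 = 1].

    To make such identities computable, forms are evaluated on lists of frame vectors labelled by
    natural numbers. Wedge product and differential become signed sums over the splittings of a
    list, and each identity becomes one between polynomials in finitely many values.

    Taking [b_5] parallel to [e_5] keeps the [b_4]-component of the bracket a multiple of [df^4]
    alone. In the two obstructed algebras [df^4 = f^01] is decomposable, so its Pfaffian
    vanishes. *)

Section Engine.
Variable R : comNzRingType.

(* The signed sum of [h p q] over the ways of splitting [s] into a subsequence [p] of length
   [k] and its complement [q]; the length test only prunes branches whose sum is 0. *)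
Fixpoint splits (T : Type) (k : nat) (h : seq T -> seq T -> R) (s : seq T) : R :=
  match k, s with
  | 0, _ => h [::] s
  | _.+1, [::] => 0
  | k'.+1, x :: s' =>
      if Nat.leb (length s) k' then 0 else
      splits k' (fun p => h (x :: p)) s'
      + (-1) ^+ k * splits k (fun p q => h p (x :: q)) s'
  end.

Definition shuffle (T : Type) (k : nat) (f g : seq T -> R) : seq T -> R :=
  splits k (fun p q => f p * g q).

Fixpoint insert_eval (f : seq nat -> R) (x : nat) (s : seq nat) : R :=
  match s with
  | [::] => f [:: x]
  | y :: s' =>
      match Nat.compare x y with
      | Lt => f (x :: s)
      | Eq => 0
      | Gt => - insert_eval (fun t => f (y :: t)) x s'
      end
  end.

(* For an alternating [f] this is [f s], rewritten in terms of values of [f] at increasing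
   sequences, so that equal values become syntactically equal up to sign. *)
Fixpoint sort_eval (f : seq nat -> R) (s : seq nat) : R :=
  if s is x :: s' then sort_eval (insert_eval f x) s' else f [::].

End Engine.

Fixpoint omit (b : nat) (s : seq nat) : seq nat :=
  if s is x :: s' then if Nat.eqb x b then omit b s' else x :: omit b s' else [::].

(** Unfolds the combinatorics of lists and indices but no ring operation, so that a polynomial in
    the values of the function is left for [ring] or [lra]. *)
Ltac calc := cbv [shuffle splits insert_eval sort_eval iota omit Nat.compare Nat.leb Nat.eqb
  length bump nat_of_bool leq subn Nat.sub addn Nat.add].

Section Exterior.
Variables (R : realType) (n : nat).
Implicit Types (a b c : ext R n) (u v x y : 'rV[R]_n) (I J K : {set 'I_n}) (i j : 'I_n).

Lemma wsignE I J : wsign R I J = \prod_(i in I) wsign R [set i] J.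
Proof.
rewrite /wsign [LHS](_ : _ = \prod_(p in setX I J) (-1) ^+ (p.2 < p.1)%N).
  transitivity (\prod_(i in I) \prod_(j in J) (-1) ^+ (j < i)%N : R).
    by rewrite pair_big; apply: eq_bigl => -[i j]; rewrite !inE.
  by apply: eq_bigr => i _; rewrite -wsign1.
rewrite -prodr_const (eq_bigl (fun p => (p \in setX I J) && (p.2 < p.1)%N)).
  by rewrite big_mkcondr; apply: eq_bigr => p _; case: ifP.
by move=> p; rewrite inE.
Qed.

Lemma wsignU1l i I J : i \notin I -> wsign R (i |: I) J = wsign R [set i] J * wsign R I J.
Proof. by move=> iI; rewrite wsignE big_setU1 //= -wsignE. Qed.

Lemma wsign1U i I J : [disjoint I & J] ->
  wsign R [set i] (I :|: J) = wsign R [set i] I * wsign R [set i] J.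
Proof.
move=> dIJ; rewrite !wsign1 -bigU //; apply: eq_bigl => j.
by rewrite !inE.
Qed.

Lemma wedgeDl a b c : wedge (a + b) c = wedge a c + wedge b c.
Proof.
apply/ffunP=> K; rewrite !ffunE -big_split; apply: eq_bigr => I _ /=.
by rewrite ffunE; ring.
Qed.

Lemma wedgeDr a b c : wedge c (a + b) = wedge c a + wedge c b.
Proof.
apply/ffunP=> K; rewrite !ffunE -big_split; apply: eq_bigr => I _ /=.
by rewrite ffunE; ring.
Qed.

Lemma wedgeZl (k : R) a c : wedge (k *: a) c = k *: wedge a c.
Proof.
apply/ffunP=> K; rewrite !ffunE /GRing.scale /= mulr_sumr; apply: eq_bigr => I _ /=.
by rewrite ffunE /GRing.scale /=; ring.
Qed.

Lemma wedgeZr (k : R) a c : wedge c (k *: a) = k *: wedge c a.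
Proof.
apply/ffunP=> K; rewrite !ffunE /GRing.scale /= mulr_sumr; apply: eq_bigr => I _ /=.
by rewrite ffunE /GRing.scale /=; ring.
Qed.

Lemma wedge0l c : wedge 0 c = 0.
Proof. by have := wedgeZl 0 0 c; rewrite !scale0r. Qed.

Lemma wedge0r c : wedge c 0 = 0.
Proof. by have := wedgeZr 0 0 c; rewrite !scale0r. Qed.

Lemma wedge_suml (T : Type) (r : seq T) (P : pred T) (F : T -> ext R n) c :
  wedge (\sum_(t <- r | P t) F t) c = \sum_(t <- r | P t) wedge (F t) c.
Proof. exact: (big_morph (fun a => wedge a c) (fun a b => wedgeDl a b c) (wedge0l c)). Qed.

Lemma wedge_sumr (T : Type) (r : seq T) (P : pred T) (F : T -> ext R n) c :
  wedge c (\sum_(t <- r | P t) F t) = \sum_(t <- r | P t) wedge c (F t).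
Proof. exact: (big_morph (wedge c) (fun a b => wedgeDr a b c) (wedge0r c)). Qed.

(** The subsets of [K] that contain [i] are reindexed by removing [i]; what remains is
    multiplicativity of the signs. Associativity in general follows by induction on monomials. *)
Lemma wedge_covA i a b : wedge (wedge (cov R i) a) b = wedge (cov R i) (wedge a b).
Proof.
apply/ffunP=> K; rewrite wedge_covE ffunE.
rewrite (eq_bigr (fun I => if i \in I then wsign R I (K :\: I) *
   (wsign R [set i] (I :\ i) * a (I :\ i)) * b (K :\: I) else 0)); last first.
  by move=> I _; rewrite wedge_covE; case: ifP => // _; rewrite mulr0 mul0r.
rewrite -big_mkcondr /=.
case: ifPn => iK; last first.
  rewrite big_pred0 // => I; apply/negP => /andP[/subsetP IK /IK iK'].
  by rewrite iK' in iK.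
rewrite ffunE mulr_sumr.
rewrite (reindex_onto (fun I => i |: I) (fun I => I :\ i)) /=; last first.
  by move=> I /andP[_ iI]; rewrite setD1K.
apply: eq_big => [I|I /andP[/andP[IK _] /eqP Ii]].
  rewrite setU11 andbT subUset sub1set iK /= subsetD1; congr (_ && _).
  by apply/eqP/idP => [<-|iI]; rewrite ?setD11 ?setU1K.
have iI : i \notin I by rewrite -Ii setD11.
rewrite setU1K // wsignU1l //.
have -> : K :\: (i |: I) = K :\ i :\: I by rewrite setDDl.
set X := K :\ i :\: I.
have -> : K :\ i = I :|: X.
  apply/setP => j; rewrite !inE; case jI : (j \in I); rewrite ?andbT //=.
  apply/andP; split; first by apply: contraNneq iI => <-.
  by move/subsetP: IK; apply; rewrite inE jI orbT.
rewrite wsign1U; last first.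
  by rewrite -setI_eq0; apply/eqP/setP => j; rewrite !inE; case: (j \in I).
by ring.
Qed.

Lemma ext_basis_sum a : a = \sum_I a I *: wedge_list R (enum I).
Proof.
apply/ffunP=> K; rewrite sum_ffunE (bigD1 K) //= -ext_basisE big1 => [|J JK].
  by rewrite addr0 !ffunE eqxx /GRing.scale /= mulr1.
by rewrite -ext_basisE !ffunE eq_sym (negPf JK) /GRing.scale /= mulr0.
Qed.

Lemma ext_lin_ind (P : ext R n -> Prop) :
  P 0 -> (forall a b, P a -> P b -> P (a + b)) -> (forall (k : R) a, P a -> P (k *: a)) ->
  (forall s, P (wedge_list R s)) -> forall a, P a.
Proof.
move=> P0 PD PZ Pw a; rewrite (ext_basis_sum a).
by apply: big_ind => // I _; apply: PZ.
Qed.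

Lemma wedge_one a : wedge (basis_form R set0) a = a.
Proof.
apply/ffunP=> K; rewrite ffunE (bigD1 set0) ?sub0set //= setD0 !ffunE eqxx mulr1.
rewrite wsignE big_set0 mul1r big1 ?addr0 => // I /andP[_ I0].
by rewrite ffunE (negPf I0) mulr0 mul0r.
Qed.

Lemma wedgeA a b c : wedge (wedge a b) c = wedge a (wedge b c).
Proof.
apply: (@ext_lin_ind (fun a => wedge (wedge a b) c = wedge a (wedge b c)));
  rewrite ?wedge0l //.
- by move=> ? ? h1 h2; rewrite !wedgeDl h1 h2.
- by move=> ? ? h; rewrite !wedgeZl h.
elim=> [|i s IH] /=; first by rewrite !wedge_one.
by rewrite !wedge_covA IH.
Qed.

Lemma contractD v a b : contract v (a + b) = contract v a + contract v b.
Proof. by have := contract_linr 1 v a b; rewrite !scale1r. Qed.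

Lemma contractDl u v a : contract (u + v) a = contract u a + contract v a.
Proof. by have := contract_lin 1 u v a; rewrite !scale1r. Qed.

Lemma contract0l a : contract 0 a = 0.
Proof. by apply/ffunP=> J; rewrite !ffunE big1 // => i _; rewrite mxE mulr0 mul0r. Qed.

Lemma contractZl (k : R) v a : contract (k *: v) a = k *: contract v a.
Proof. by have := contract_lin k v 0 a; rewrite contract0l !addr0. Qed.

Lemma contract_sum (T : Type) (r : seq T) (P : pred T) (F : T -> ext R n) v :
  contract v (\sum_(t <- r | P t) F t) = \sum_(t <- r | P t) contract v (F t).
Proof. exact: (big_morph (contract v) (contractD v) (contract0 v)). Qed.

Lemma contract_suml (T : Type) (r : seq T) (P : pred T) (F : T -> 'rV[R]_n) a :
  contract (\sum_(t <- r | P t) F t) a = \sum_(t <- r | P t) contract (F t) a.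
Proof.
exact: (big_morph (fun u => contract u a) (fun x y => contractDl x y a) (contract0l a)).
Qed.

Lemma contractC u v a : contract u (contract v a) = - contract v (contract u a).
Proof.
have := contract_contract (u + v) a.
rewrite !contractDl !contractD !contract_contract add0r addr0 => /eqP.
by rewrite addr_eq0 => /eqP.
Qed.

(** The grading automorphism. It lets the antiderivation rule [contract_wedge] be stated for
    inhomogeneous forms, hence proved by linearity from monomials. *)
Definition parity a : ext R n := [ffun I : {set 'I_n} => (-1) ^+ #|I| * a I].

Lemma parityD a b : parity (a + b) = parity a + parity b.
Proof. by apply/ffunP=> I; rewrite !ffunE mulrDr. Qed.

Lemma parityZ (k : R) a : parity (k *: a) = k *: parity a.
Proof. by apply/ffunP=> I; rewrite !ffunE /GRing.scale /=; ring. Qed.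

Lemma parity_form (k : nat) a : is_form k a -> parity a = (-1) ^+ k *: a.
Proof.
move=> ha; apply/ffunP=> I; rewrite !ffunE /GRing.scale /=.
by have [->//|/ha ->] := eqVneq #|I| k; rewrite !mulr0.
Qed.

Lemma parity_wedge_cov i a : parity (wedge (cov R i) a) = - wedge (cov R i) (parity a).
Proof.
apply/ffunP=> K; rewrite [LHS]ffunE [RHS]ffunE !wedge_covE ffunE.
case: ifP => iK; last by rewrite mulr0 oppr0.
by rewrite (cardsD1 i K) iK exprS; ring.
Qed.

Lemma contract_wedge v a b :
  contract v (wedge a b) = wedge (contract v a) b + wedge (parity a) (contract v b).
Proof.
apply: (@ext_lin_ind (fun a =>
  contract v (wedge a b) = wedge (contract v a) b + wedge (parity a) (contract v b))).
- rewrite (_ : parity 0 = 0) ?(wedge0l, contract0, addr0) //.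
  by apply/ffunP=> I; rewrite !ffunE mulr0.
- by move=> x y hx hy; rewrite wedgeDl !contractD parityD !wedgeDl hx hy addrACA.
- by move=> k x hx; rewrite wedgeZl !contractZ parityZ !wedgeZl hx scalerDr.
elim=> [|i s IH] /=.
  have f0 : is_form 0 (basis_form R (set0 : {set 'I_n})).
    by move=> I; rewrite cards_eq0 ffunE => /negPf ->.
  by rewrite (contract_form0 v f0) wedge0l add0r (parity_form f0) expr0 scale1r !wedge_one.
rewrite wedge_covA !contract_wedge_cov IH parity_wedge_cov wedgeDr !wedgeDl wedgeZl.
rewrite !(wedgeDl, =^~ scaleN1r, wedgeZl, wedge_covA) scalerDr.
by rewrite addrA.
Qed.

End Exterior.

(** * Signed sums over the splittings of a list *)

Section Splits.
Variable R : comNzRingType.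
Variable T : Type.
Implicit Types (h : seq T -> seq T -> R) (s : seq T).

Lemma splits_cons k h x s : splits k.+1 h (x :: s) =
  if (size s < k)%N then 0
  else splits k (fun p => h (x :: p)) s
    + (-1) ^+ k.+1 * splits k.+1 (fun p q => h p (x :: q)) s.
Proof.
rewrite [LHS]/= -/(Nat.leb (size s).+1 k); case: ifP; case: ifP => //.
  by move=> sk /PeanoNat.Nat.leb_le/ssrnat.leP; rewrite sk.
by move=> /ssrnat.leP/PeanoNat.Nat.leb_le ->.
Qed.

Lemma eq_splits k h h' s : (forall p q, size p = k -> h p q = h' p q) ->
  splits k h s = splits k h' s.
Proof.
elim: s k h h' => [|x s IH] [|k] h h' E; rewrite ?splits_cons /= ?E //.
case: ifP => // _; congr (_ + _ * _); apply: IH => p q sp; apply: E => //=.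
by rewrite sp.
Qed.

Lemma splits_sum (I : Type) (r : seq I) (H : I -> seq T -> seq T -> R) k s :
  splits k (fun p q => \sum_(i <- r) H i p q) s = \sum_(i <- r) splits k (H i) s.
Proof.
elim: s k H => [|x s IH] [|k] H; rewrite ?splits_cons //.
  by rewrite /= big1.
under [RHS]eq_bigr do rewrite splits_cons.
case: ifP => _; first by rewrite big1.
by rewrite !IH mulr_sumr -big_split.
Qed.

Lemma eq_shuffle k (f f' g g' : seq T -> R) s : f =1 f' -> g =1 g' ->
  shuffle k f g s = shuffle k f' g' s.
Proof. by move=> ef eg; apply: eq_splits => p q _; rewrite ef eg. Qed.

End Splits.

Section Alternating.
Variable R : comNzRingType.

(** The vanishing clause is separate because over a general commutative ring, for instance in
    characteristic 2, the sign rule does not imply it. *)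
Definition alternating (f : seq nat -> R) := forall p x y s,
  f (p ++ [:: x, y & s]) = - f (p ++ [:: y, x & s]) /\ f (p ++ [:: x, x & s]) = 0.

Lemma alternating_cons f x : alternating f -> alternating (fun s => f (x :: s)).
Proof. by move=> hf p; exact: (hf (x :: p)). Qed.

Lemma insert_evalE f x s : alternating f -> insert_eval f x s = f (x :: s).
Proof.
elim: s f => [//|y s IH] f hf /=.
case: (PeanoNat.Nat.compare_spec x y) => [->||_] //.
  by have [_ ->] := hf [::] y y s.
by rewrite IH; [have [->] := hf [::] x y s | exact: alternating_cons].
Qed.

Lemma sort_evalE f s : alternating f -> sort_eval f s = f s.
Proof.
elim: s f => [//|x s IH] f hf /=.
rewrite IH ?insert_evalE // => p y z t; rewrite !insert_evalE //.
exact: (hf (x :: p)).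
Qed.

End Alternating.

Section SplitsMorphism.
Variables (R S : comNzRingType) (f : {rmorphism S -> R}).

(** Together with [rmorph_sort_eval] this transports a computation along the map from the integers,
    so that [G2_cubic_phi_std] can be decided by evaluation. *)
Lemma rmorph_splits (T : Type) k (h : seq T -> seq T -> S) s :
  f (splits k h s) = splits k (fun p q => f (h p q)) s.
Proof.
elim: s k h => [|x s IH] [|k] h; rewrite ?splits_cons ?rmorph0 //.
by case: ifP => _; rewrite ?rmorph0 // rmorphD rmorphM rmorph_sign !IH.
Qed.

Lemma rmorph_insert_eval (F : seq nat -> S) x s :
  f (insert_eval F x s) = insert_eval (fun t => f (F t)) x s.
Proof.
elim: s F => [//|y s IH] F /=.
by case: (Nat.compare x y); rewrite ?rmorph0 ?rmorphN ?IH.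
Qed.

Lemma eq_insert_eval (F F' : seq nat -> R) x s :
  F =1 F' -> insert_eval F x s = insert_eval F' x s.
Proof.
elim: s F F' => [|y s IH] F F' E /=; first exact: E.
by rewrite E (IH _ (fun t => F' (y :: t))).
Qed.

Lemma eq_sort_eval (F F' : seq nat -> R) s : F =1 F' -> sort_eval F s = sort_eval F' s.
Proof.
by elim: s F F' => [|x s IH] F F' E /=; rewrite ?E //; apply: IH => t; apply: eq_insert_eval.
Qed.

Lemma rmorph_sort_eval (F : seq nat -> S) s :
  f (sort_eval F s) = sort_eval (fun t => f (F t)) s.
Proof.
elim: s F => [//|x s IH] F /=; rewrite IH; apply: eq_sort_eval => t.
exact: rmorph_insert_eval.
Qed.

End SplitsMorphism.

Lemma eq_splits_in (R : comNzRingType) (T : eqType) k (h h' : seq T -> seq T -> R) s :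
  (forall p q, size p = k -> perm_eq (p ++ q) s -> h p q = h' p q) ->
  splits k h s = splits k h' s.
Proof.
elim: s k h h' => [|x s IH] [|k] h h' E //; try exact: E.
rewrite !splits_cons; case: ifP => // _; congr (_ + _ * _); apply: IH => p q sp pq;
  apply: E => //=; rewrite ?sp //.
  by rewrite perm_cons.
by rewrite -cat1s perm_catCA /= perm_cons.
Qed.

Lemma sort_eval_triple (R : comNzRingType) (F F' : seq nat -> R) n (x y z : nat) :
    (forall i j k : nat, (i < j)%N -> (j < k)%N -> (k < n)%N ->
      F [:: i; j; k] = F' [:: i; j; k]) ->
    (x < n)%N -> (y < n)%N -> (z < n)%N ->
  sort_eval F [:: x; y; z] = sort_eval F' [:: x; y; z].
Proof.
move=> E xn yn zn; rewrite /=.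
by do !(case: PeanoNat.Nat.compare_spec => //= /ssrnat.ltP ?); rewrite E.
Qed.

(** * Values of forms on lists of vectors *)

Section Evaluation.
Variables (R : realType) (n : nat).
Implicit Types (a b c : ext R n) (u v x y : 'rV[R]_n) (I J K : {set 'I_n}) (i j : 'I_n).

Lemma ext_evalD a b s : ext_eval (a + b) s = ext_eval a s + ext_eval b s.
Proof.
rewrite /ext_eval; elim: s a b => [|v s IH] a b /=; first by rewrite ffunE.
by rewrite contractD IH.
Qed.

Lemma ext_eval_sum (T : Type) (r : seq T) (P : pred T) (F : T -> ext R n) s :
  ext_eval (\sum_(t <- r | P t) F t) s = \sum_(t <- r | P t) ext_eval (F t) s.
Proof.
exact: (big_morph (fun a => ext_eval a s) (fun a b => ext_evalD a b s) (ext_eval0 s)).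
Qed.

Lemma ext_evalN a s : ext_eval (- a) s = - ext_eval a s.
Proof. by rewrite -scaleN1r ext_evalZ mulN1r. Qed.

Lemma contract_wedge_form (k : nat) v a b : is_form k a ->
  contract v (wedge a b) = wedge (contract v a) b + (-1) ^+ k *: wedge a (contract v b).
Proof. by move=> ha; rewrite contract_wedge (parity_form ha) wedgeZl. Qed.

Lemma form0E a : is_form 0 a -> a = a set0 *: basis_form R set0.
Proof.
move=> ha; apply/ffunP=> I; rewrite !ffunE /GRing.scale /=.
have [->|I0] := eqVneq I set0; first by rewrite mulr1.
by rewrite mulr0 ha // cards_eq0.
Qed.

Lemma ext_eval_wedge_low (k : nat) a b (s : seq 'rV[R]_n) :
  is_form k a -> (size s < k)%N -> ext_eval (wedge a b) s = 0.
Proof.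
elim: s k a b => [|v s IH] [//|k] a b ha hs.
  rewrite /ext_eval /= ffunE big1 // => I; rewrite subset0 => /eqP ->.
  by rewrite ha ?cards0 // mulr0 mul0r.
have -> : ext_eval (wedge a b) (v :: s) = ext_eval (contract v (wedge a b)) s by [].
rewrite (contract_wedge_form _ _ ha) ext_evalD ext_evalZ.
rewrite (IH k); [|exact: contract_form|by []].
by rewrite (IH k.+1) ?mulr0 ?addr0 // ltnW.
Qed.

(** Contraction with the first vector, by the antiderivation rule, either goes into [a] or passes
    the [k] slots of [a] and goes into [b]: these are the two branches of [splits]. *)
Lemma ext_eval_wedge (T : Type) (h : T -> 'rV[R]_n) (k : nat) a b (s : seq T) :
  is_form k a ->
  ext_eval (wedge a b) (map h s) =
    shuffle k (fun p => ext_eval a (map h p)) (fun q => ext_eval b (map h q)) s.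
Proof.
rewrite /shuffle; elim: s k a b => [|x s IH] [|k] a b ha.
- rewrite (form0E ha) wedgeZl ext_evalZ wedge_one /= /ext_eval /= !ffunE eqxx.
  by rewrite /GRing.scale /= mulr1.
- by rewrite (ext_eval_wedge_low _ ha).
- rewrite (form0E ha) wedgeZl ext_evalZ wedge_one /= /ext_eval /= !ffunE eqxx.
  by rewrite /GRing.scale /= mulr1.
rewrite splits_cons; case: ifP => hs.
  by apply: (ext_eval_wedge_low _ ha); rewrite size_map.
have -> : ext_eval (wedge a b) (map h (x :: s)) =
  ext_eval (contract (h x) (wedge a b)) (map h s) by [].
rewrite (contract_wedge_form _ _ ha) ext_evalD ext_evalZ (IH _ _ _ ha).
by rewrite (IH k) //; apply: contract_form.
Qed.

Lemma ext_eval_alternating (h : nat -> 'rV[R]_n) a :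
  alternating (fun s => ext_eval a (map h s)).
Proof.
move=> p x y s; split; rewrite !map_cat /=; elim: (map h p) a => [|z q IH] a.
- by rewrite /ext_eval /= contractC -/(ext_eval _ _) ext_evalN.
- exact: IH.
- by rewrite /ext_eval /= contract_contract -/(ext_eval _ _) ext_eval0.
exact: IH.
Qed.

Lemma ext_eval_sort (h : nat -> 'rV[R]_n) a s :
  ext_eval a (map h s) = sort_eval (fun s => ext_eval a (map h s)) s.
Proof. by rewrite sort_evalE //; exact: ext_eval_alternating. Qed.

Lemma ext_contract_inj a b : a set0 = b set0 ->
  (forall v, contract v a = contract v b) -> a = b.
Proof.
move=> h0 h; apply/ffunP=> I; have [->//|/set0Pn[i iI]] := eqVneq I set0.
have := congr1 (fun c : ext R n => c (I :\ i)) (h (delta_mx 0 i)).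
rewrite /= !contract_delta ?setD11 // setD1K //.
apply: mulfI; apply/eqP => w0; have := wsign_sqr R [set i] (I :\ i).
by rewrite w0 mul0r => /esym/eqP; rewrite oner_eq0.
Qed.

Lemma wedge_covC i j : wedge (cov R i) (cov R j) = - wedge (cov R j) (cov R i).
Proof.
apply: ext_contract_inj => [|v]; first by rewrite [RHS]ffunE !wedge_covE !inE oppr0.
rewrite -scaleN1r contractZ !contract_wedge_cov !contract_cov !wedge_cov_set0.
by rewrite scalerBr !scaleN1r opprK addrC.
Qed.

Lemma wedge_cov2C i j k : wedge (wedge (cov R i) (cov R j)) (cov R k) =
  wedge (cov R k) (wedge (cov R i) (cov R j)).
Proof.
rewrite wedgeA (wedge_covC j) -!scaleN1r wedgeZr -wedgeA (wedge_covC i k).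
by rewrite -scaleN1r wedgeZl scalerA mulN1r opprK scale1r wedgeA.
Qed.

Section Differential.
Variable L : lieAlgebra R n.

Lemma dcov_covC k i : wedge (dcov L k) (cov R i) = wedge (cov R i) (dcov L k).
Proof.
rewrite /dcov wedge_suml wedge_sumr; apply: eq_bigr => j _.
rewrite wedge_suml wedge_sumr; apply: eq_bigr => l _.
by rewrite wedgeZl wedgeZr wedge_cov2C.
Qed.

(** Both sides obey the same Leibniz recursion, because the 2-forms [df^k] commute with covectors.
    The right side no longer depends on an ordering of the indices, so it extends to all forms by
    linearity. *)
Lemma dwedge_listE s : dwedge_list L s =
  \sum_k wedge (dcov L k) (contract (delta_mx 0 k) (wedge_list R s)).
Proof.
elim: s => [|i s IH] /=.
  rewrite big1 // => k _; rewrite contract_form0 ?wedge0r // => I.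
  by rewrite cards_eq0 ffunE => /negPf ->.
rewrite IH wedge_sumr; under [RHS]eq_bigr do rewrite contract_wedge_cov.
under [RHS]eq_bigr => k _.
  rewrite wedgeDr -scaleN1r !wedgeZr scaleN1r -wedgeA dcov_covC wedgeA.
  rewrite [X in X *: _](_ : _ = (i == k)%:R); last by rewrite mxE eqxx.
  over.
rewrite big_split /= sumrN; congr (_ - _).
rewrite (bigD1 i) //= eqxx scale1r big1 ?addr0 // => k ki.
by rewrite eq_sym (negPf ki) scale0r.
Qed.

Lemma ce_diffE a :
  ce_diff L a = \sum_k wedge (dcov L k) (contract (delta_mx 0 k) a).
Proof.
rewrite [in RHS](ext_basis_sum a) /ce_diff.
under [RHS]eq_bigr do rewrite contract_sum wedge_sumr.
rewrite exchange_big /=; apply: eq_bigr => I _.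
rewrite dwedge_listE scaler_sumr; apply: eq_bigr => k _.
by rewrite contractZ wedgeZr.
Qed.

Lemma form_dcov k : is_form 2 (dcov L k).
Proof.
rewrite /dcov; apply: big_ind => [||i _]; [exact: form_0|exact: form_D|].
apply: big_ind => [||j _]; [exact: form_0|exact: form_D|].
move=> I hI; rewrite ffunE (form_wedge_cov _ _ hI) ?scaler0 // => K hK.
by rewrite ffunE; have [E|//] := eqVneq K [set j]; rewrite E cards1 in hK.
Qed.

(** As [df^k(x, y) = - f^k([x, y])], summing over [k] reassembles [[x, y]] from its coordinates in
    the first slot of [a]. *)
Lemma ext_eval_ce_diff (T : Type) (h : T -> 'rV[R]_n) a (s : seq T) :
  ext_eval (ce_diff L a) (map h s) =
    splits 2 (fun p q => if p is [:: x; y]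
      then - ext_eval a (L (h x) (h y) :: map h q) else 0) s.
Proof.
rewrite ce_diffE ext_eval_sum.
under eq_bigr do rewrite (ext_eval_wedge _ _ _ (form_dcov _)).
rewrite -splits_sum; apply: eq_splits => -[//|x [//|y [|//]]] q _ /=.
under eq_bigr do rewrite dcov_eval mulNr -ext_evalZ.
rewrite sumrN; congr (- _).
have -> : ext_eval a (L (h x) (h y) :: map h q) =
  ext_eval (contract (L (h x) (h y)) a) (map h q) by [].
rewrite [X in _ = ext_eval (contract X _) _]row_sum_delta contract_suml ext_eval_sum.
by apply: eq_bigr => k _; rewrite contractZl.
Qed.

End Differential.

End Evaluation.

(** * Forms of top degree and determinants *)

Section TopForms.
Variables (R : realType) (n : nat).

Lemma contract_wedge_codom (v : 'rV[R]_n) (k : nat) (g : 'I_k.+1 -> 'I_n) :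
  contract v (wedge_list R [seq g j | j <- enum 'I_k.+1]) =
  \sum_(j < k.+1) ((-1) ^+ j * v 0 (g j)) *: wedge_list R [seq g (lift j i) | i <- enum 'I_k].
Proof.
elim: k g => [|k IH] g.
  rewrite big_ord1 enum_ordSl (_ : enum 'I_0 = [::]) /=; last exact/size0nil/size_enum_ord.
  rewrite contract_wedge_cov contract_form0 => [|I]; last first.
    by rewrite cards_eq0 ffunE => /negPf ->.
  by rewrite -scaleN1r [wedge _ 0](_ : _ = 0) ?scaler0 ?addr0 ?mul1r ?wedge0r.
rewrite [in LHS]enum_ordSl /= contract_wedge_cov big_ord_recl expr0 mul1r -map_comp.
congr (_ + _); rewrite (IH (fun j => g (lift ord0 j))) wedge_sumr -sumrN.
apply: eq_bigr => j _; rewrite wedgeZr -scaleNr; congr (_ *: _).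
  by rewrite /= /bump /= add1n exprS !mulNr mul1r.
rewrite [in RHS]enum_ordSl /= -map_comp; congr (wedge (cov R (g _)) (wedge_list R _)).
  exact: val_inj.
apply: eq_map => i /=; congr g; apply: val_inj => /=.
by rewrite /bump /= !add1n ltnS addnS.
Qed.

(** Contraction with the first vector is expansion along the first row. The index map [g] is
    arbitrary so that the induction applies to [g] with one index omitted. *)
Lemma ext_eval_codom (k : nat) (g : 'I_k -> 'I_n) (x : 'I_k -> 'rV[R]_n) :
  ext_eval (wedge_list R [seq g j | j <- enum 'I_k]) [seq x i | i <- enum 'I_k]
    = \det (\matrix_(i, j) x i 0 (g j)).
Proof.
elim: k g x => [|k IH] g x.
  rewrite (_ : enum 'I_0 = [::]); last exact/size0nil/size_enum_ord.
  by rewrite det_mx00 /ext_eval /= ffunE eqxx.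
rewrite (expand_det_row _ ord0) [in X in ext_eval _ X]enum_ordSl /=.
set a := wedge_list _ _.
have -> (s : seq 'rV[R]_n) : ext_eval a (x ord0 :: s) = ext_eval (contract (x ord0) a) s by [].
rewrite contract_wedge_codom ext_eval_sum; apply: eq_bigr => j _.
rewrite ext_evalZ -map_comp (IH (fun i => g (lift j i)) (fun i => x (lift ord0 i))).
rewrite /cofactor !mxE add0n mulrA [X in X * _]mulrC; congr (_ * \det _).
by apply/matrixP => i l; rewrite !mxE.
Qed.

Lemma top_form_eval (vol : ext R n) (h : nat -> 'rV[R]_n) : is_form n vol ->
  ext_eval vol (map h (iota 0 n)) = vol setT * \det (\matrix_(i < n, j < n) h i 0 j).
Proof.
move=> hv.
have -> : vol = vol setT *: wedge_list R [seq id j | j <- enum 'I_n].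
  rewrite map_id enumT -enum_setT -ext_basisE.
  apply/ffunP=> K; rewrite !ffunE /GRing.scale /=.
  have [->|KT] := eqVneq K setT; first by rewrite !mulr1.
  rewrite mulr0 hv //; apply: contra KT => /eqP cK.
  by rewrite eqEcard subsetT /= cardsT card_ord cK.
rewrite ext_evalZ -val_enum_ord -map_comp ext_eval_codom; congr (_ * _).
rewrite map_id enumT -enum_setT -ext_basisE !ffunE eqxx /GRing.scale /= mulr1.
by [].
Qed.

End TopForms.

(** * The Hodge operator on orthonormal vectors *)

Section Hodge.
Variables (R : realType) (n : nat).
Implicit Types (a b c : ext R n) (u v x y : 'rV[R]_n) (I J K : {set 'I_n}) (i j : 'I_n).

Lemma enum_filter J : enum J = [seq j <- enum 'I_n | j \in J].
Proof. by rewrite !enumT. Qed.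

Lemma enumU1 i J : i \notin J -> [seq j <- enum (i |: J) | j != i] = enum J.
Proof.
move=> iJ; rewrite (enum_filter (i |: J)) (enum_filter J) -filter_predI.
apply: eq_filter => j; rewrite /= in_setU1.
by have [->|] := eqVneq j i; rewrite ?(negPf iJ).
Qed.

Lemma pairwise_enum J : pairwise (fun i j : 'I_n => (i < j)%N) (enum J).
Proof.
rewrite enum_filter.
apply/pairwise_filter; rewrite -sorted_pairwise; last by move=> ? ? ?; apply: ltn_trans.
by rewrite -(@sorted_map _ _ val ltn) val_enum_ord iota_ltn_sorted.
Qed.

Lemma ext_eval_move a x s1 s2 :
  ext_eval a (x :: s1 ++ s2) = (-1) ^+ size s1 * ext_eval a (s1 ++ x :: s2).
Proof.
elim: s1 a => [|y s1 IH] a /=; first by rewrite mul1r.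
have -> : ext_eval a [:: x, y & s1 ++ s2] = - ext_eval (contract y a) (x :: s1 ++ s2).
  by rewrite /ext_eval /= contractC -/(ext_eval _ _) ext_evalN.
by rewrite IH exprS mulN1r mulNr.
Qed.

(** Sorting [i] into [J] takes one transposition for each element of [J] below [i], which is the
    exponent in [wsign]. *)
Lemma ext_eval_insert a (h : 'I_n -> 'rV[R]_n) i J :
  ext_eval a (h i :: [seq h j | j <- enum J]) =
  if i \in J then 0
  else wsign R [set i] J * ext_eval a [seq h j | j <- enum (i |: J)].
Proof.
case: ifPn => iJ.
  have : i \in enum J by rewrite mem_enum.
  case/splitPr => s1 s2; rewrite map_cat ext_eval_move /=.
  set X := ext_eval _ _; suff -> : X = 0 by rewrite mulr0.
  rewrite /X {X}; elim: (map h s1) a => [|y s IH] a; last exact: IH.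
  by rewrite /ext_eval /= contract_contract -/(ext_eval _ _) ext_eval0.
have hi : i \in enum (i |: J) by rewrite mem_enum setU11.
move: (pairwise_enum (i |: J)) (enum_uniq (i |: J)).
rewrite wsign1 -big_enum /= -(enumU1 iJ).
case/splitPr: hi => s1 s2; rewrite pairwise_cat cat_uniq /=.
case/and3P => /allrelP h12 _ /andP[/allP h2 _] /and3P[_ hn /andP[i2 _]].
have i1 : i \notin s1 by case/norP: hn.
have -> : [seq j <- s1 ++ i :: s2 | j != i] = s1 ++ s2.
  rewrite filter_cat /= eqxx /=; congr (_ ++ _); apply/all_filterP/allP => j js.
    by apply: contraNneq i1 => <-.
  by apply: contraNneq i2 => <-.
have s2E : \prod_(j <- s2) (-1) ^+ (j < i)%N = 1 :> R.
  by rewrite big1_seq // => j /andP[_ /h2 /ltnW]; rewrite leqNgt => /negPf ->.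
have s1E : \prod_(j <- s1) (-1) ^+ (j < i)%N = (-1) ^+ size s1 :> R.
  transitivity (\prod_(j <- s1) (-1) : R).
    by apply: eq_big_seq => j js; rewrite h12 ?mem_head // expr1.
  by rewrite big_const_seq count_predT -Monoid.iteropE.
by rewrite !map_cat ext_eval_move /= big_cat /= s1E s2E mulr1 size_map.
Qed.

Lemma ext_inner_wedge_cov (G : 'M[R]_n) i a b :
  ext_inner G (wedge (cov R i) a) b = ext_inner G a (contract (row i (invmx G)) b).
Proof.
rewrite /ext_inner.
under eq_bigr do rewrite wedge_covE.
rewrite (bigID (fun K : {set 'I_n} => i \in K)) /= [X in _ + X]big1 ?addr0; last first.
  by move=> K /negPf ->; rewrite mul0r.
rewrite (reindex_onto (fun J => i |: J) (fun K => K :\ i)) /=; last first.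
  by move=> K iK; rewrite setD1K.
rewrite [RHS](bigID (fun J : {set 'I_n} => i \notin J)) /= [X in _ + X]big1 ?addr0; last first.
  move=> J; rewrite negbK => iJ.
  have := ext_eval_insert b (fun j => row j (invmx G)) i J; rewrite iJ => h.
  by rewrite -[ext_eval _ _]/(ext_eval b (row i (invmx G) :: sharps G J)) h mulr0.
apply: eq_big => [J|J /andP[iJ1 /eqP iJ2]].
  rewrite setU11 /=; apply/eqP/idP => [<-|iJ]; by rewrite ?setD11 ?setU1K.
have iJ : i \notin J by rewrite -iJ2 setD11.
rewrite iJ1 iJ2.
rewrite -[X in _ = _ * X]/(ext_eval b (row i (invmx G) :: sharps G J)).
have := ext_eval_insert b (fun j => row j (invmx G)) i J; rewrite (negPf iJ) => ->.
by rewrite /sharps; ring.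
Qed.

Variable G : 'M[R]_n.
Hypothesis G_inner : inner_product G.

Lemma innerDl x y z : inner G (x + y) z = inner G x z + inner G y z.
Proof. by rewrite /inner !mulmxDl mxE. Qed.

Lemma innerZl (k : R) x z : inner G (k *: x) z = k * inner G x z.
Proof. by rewrite /inner -!scalemxAl mxE. Qed.

Lemma innerC x y : inner G x y = inner G y x.
Proof.
rewrite /inner -[in RHS](trmxK (y *m G *m x^T)) [RHS]mxE !trmx_mul trmxK.
by case: G_inner => -> _; rewrite mulmxA.
Qed.

Lemma innerDr x y z : inner G z (x + y) = inner G z x + inner G z y.
Proof. by rewrite ![inner _ z _]innerC innerDl. Qed.

Lemma innerZr (k : R) x z : inner G z (k *: x) = k * inner G z x.
Proof. by rewrite ![inner _ z _]innerC innerZl. Qed.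

Lemma innerNl x z : inner G (- x) z = - inner G x z.
Proof. by rewrite -scaleN1r innerZl mulN1r. Qed.

Lemma innerNr x z : inner G z (- x) = - inner G z x.
Proof. by rewrite -scaleN1r innerZr mulN1r. Qed.

Lemma inner0l z : inner G 0 z = 0.
Proof. by have := innerZl 0 0 z; rewrite scale0r mul0r. Qed.

Lemma inner0r z : inner G z 0 = 0.
Proof. by rewrite innerC inner0l. Qed.

Lemma inner_suml (T : Type) (r : seq T) (P : pred T) (F : T -> 'rV[R]_n) z :
  inner G (\sum_(t <- r | P t) F t) z = \sum_(t <- r | P t) inner G (F t) z.
Proof. exact: (big_morph (fun x => inner G x z) (fun x y => innerDl x y z) (inner0l z)). Qed.

Lemma inner_sumr (T : Type) (r : seq T) (P : pred T) (F : T -> 'rV[R]_n) z :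
  inner G z (\sum_(t <- r | P t) F t) = \sum_(t <- r | P t) inner G z (F t).
Proof. exact: (big_morph (inner G z) (fun x y => innerDr x y z) (inner0r z)). Qed.

Lemma inner_gt0 x : x != 0 -> 0 < inner G x x.
Proof. by case: G_inner => _; apply. Qed.

Lemma inner_inj x y : (forall z, inner G x z = inner G y z) -> x = y.
Proof.
move=> h; apply/eqP; rewrite -subr_eq0; apply/negPn/negP => /inner_gt0.
by rewrite innerDl innerNl h subrr ltxx.
Qed.

Definition flat x : ext R n := \sum_k inner G x (delta_mx 0 k) *: cov R k.

Lemma flatE x y : \sum_k inner G x (delta_mx 0 k) * y 0 k = inner G x y.
Proof.
rewrite [in RHS](row_sum_delta y) inner_sumr; apply: eq_bigr => k _.
by rewrite innerZr mulrC.
Qed.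

Lemma contract_wedge_flat x y a :
  contract y (wedge (flat x) a) = inner G x y *: a - wedge (flat x) (contract y a).
Proof.
rewrite /flat !wedge_suml contract_sum -flatE scaler_suml -sumrB.
apply: eq_bigr => k _; rewrite !wedgeZl contractZ contract_wedge_cov scalerBr.
by rewrite scalerA.
Qed.

(** Wedging with the dual covector of [x] is adjoint to contraction with [x]. Three applications
    turn the scalar product of a decomposable 3-form with [a] into a value of [a]. *)
Lemma ext_inner_wedge_flat x a b :
  ext_inner G (wedge (flat x) a) b = ext_inner G a (contract x b).
Proof.
have uG := inner_product_unit G_inner.
have xE : x = \sum_k inner G x (delta_mx 0 k) *: row k (invmx G).
  rewrite -[LHS](mulmxK uG) [LHS](mulmx_sum_row); apply: eq_bigr => k _.
  by rewrite /inner trmx_delta -colE [col _ _ _ _]mxE.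
have lin : ext_inner G (wedge (flat x) a) b =
    \sum_k inner G x (delta_mx 0 k) * ext_inner G (wedge (cov R k) a) b.
  rewrite /ext_inner; under [RHS]eq_bigr do rewrite mulr_sumr.
  rewrite exchange_big /=; apply: eq_bigr => I _.
  rewrite /flat wedge_suml sum_ffunE mulr_suml; apply: eq_bigr => k _.
  by rewrite wedgeZl ffunE mulrA.
rewrite lin [in RHS]xE contract_suml /ext_inner.
under [RHS]eq_bigr do rewrite ext_eval_sum mulr_sumr.
rewrite exchange_big /=; apply: eq_bigr => k _.
rewrite -/(ext_inner G _ _) ext_inner_wedge_cov.
rewrite /ext_inner mulr_sumr; apply: eq_bigr => I _.
by rewrite contractZl ext_evalZ; ring.
Qed.

Lemma form_wedge_flat (k : nat) x a : is_form k a -> is_form k.+1 (wedge (flat x) a).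
Proof.
move=> ha; rewrite /flat wedge_suml; apply: big_ind => [||i _]; [exact: form_0|exact: form_D|].
by move=> I hI; rewrite wedgeZl ffunE (form_wedge_cov i ha hI) scaler0.
Qed.

Lemma ext_eval_wedge_flat0 x a (s : seq 'rV[R]_n) :
  {in s, forall y, inner G x y = 0} -> ext_eval (wedge (flat x) a) s = 0.
Proof.
elim: s a => [|y s IH] a hs.
  rewrite /ext_eval /= /flat wedge_suml sum_ffunE big1 // => k _.
  by rewrite wedgeZl ffunE wedge_covE inE /GRing.scale /= mulr0.
have -> : ext_eval (wedge (flat x) a) (y :: s) =
  ext_eval (contract y (wedge (flat x) a)) s by [].
rewrite contract_wedge_flat hs ?mem_head // scale0r add0r ext_evalN IH ?oppr0 // => z zs.
by rewrite hs // inE zs orbT.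
Qed.

Lemma ext_eval_wedge_flat x a (s : seq 'rV[R]_n) : inner G x x = 1 ->
  {in s, forall y, inner G x y = 0} -> ext_eval (wedge (flat x) a) (x :: s) = ext_eval a s.
Proof.
move=> x1 hs.
have -> : ext_eval (wedge (flat x) a) (x :: s) =
  ext_eval (contract x (wedge (flat x) a)) s by [].
rewrite contract_wedge_flat x1 scale1r ext_evalD ext_evalN ext_eval_wedge_flat0 //.
by rewrite oppr0 addr0.
Qed.

(** By [hodgeP], the wedge of the dual covectors of [x], [y], [z] with the Hodge dual of [a] is
    [a(x, y, z) vol]. Evaluated on [x, y, z] followed by vectors orthogonal to them, the left side
    is the Hodge dual on [s]. *)
Lemma ext_eval_hodge vol a x y z (s : seq 'rV[R]_n) :
    is_form n vol -> is_form 3 a ->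
    [/\ inner G x x = 1, inner G y y = 1 & inner G z z = 1] ->
    {in [:: y, z & s], forall t, inner G x t = 0} -> {in z :: s, forall t, inner G y t = 0} ->
    {in s, forall t, inner G z t = 0} ->
  ext_eval (hodge G vol a) s = ext_eval a [:: x; y; z] * ext_eval vol [:: x, y, z & s].
Proof.
move=> hvol ha [x1 y1 z1] hx hy hz.
have f0 : is_form 0 (basis_form R (set0 : {set 'I_n})).
  by move=> I; rewrite cards_eq0 ffunE => /negPf ->.
pose c := wedge (flat x) (wedge (flat y) (wedge (flat z) (basis_form R set0))).
have fc : is_form 3 c by do 3!apply: form_wedge_flat.
have := hodgeP G hvol fc ha; rewrite /c !ext_inner_wedge_flat.
rewrite {1}/ext_inner (bigD1 set0) //= big1 => [|I /negPf I0]; last first.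
  by rewrite ffunE I0 mul0r.
rewrite ffunE eqxx mul1r addr0 /sharps enum_set0 /= => h.
rewrite -[ext_eval a _]/(ext_eval (contract z (contract y (contract x a))) [::]) -ext_evalZ -h.
have hxs t : t \in s -> inner G x t = 0 by move=> ts; rewrite hx // !inE ts !orbT.
have hys t : t \in s -> inner G y t = 0 by move=> ts; rewrite hy // inE ts orbT.
rewrite !wedgeA wedge_one !ext_eval_wedge_flat //.
Qed.

End Hodge.

(** * Orthonormal frames and Ricci curvature *)

Section Frames.
Variables (R : realType) (n : nat) (G : 'M[R]_n).
Hypothesis G_inner : inner_product G.
Implicit Types (x y z u : 'rV[R]_n).

Lemma inner_row_invmx (F : 'I_n -> R) z :
  inner G ((\row_k F k) *m invmx G) z = \sum_k F k * z 0 k.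
Proof.
rewrite /inner mulmxKV ?inner_product_unit // mxE.
by apply: eq_bigr => k _; rewrite !mxE.
Qed.

Definition orthonormal_seq (s : seq 'rV[R]_n) := forall i j : nat,
  (i < size s)%N -> (j < size s)%N -> inner G (nth 0 s i) (nth 0 s j) = (i == j)%:R.

Lemma unit_orthogonal (s : seq 'rV[R]_n) : (size s < n)%N ->
  exists x, inner G x x = 1 /\ {in s, forall y, inner G x y = 0}.
Proof.
move=> sn; pose A : 'M_(size s, n) := \matrix_i nth 0 s i.
pose B := G *m A^T.
have : kermx B != 0.
  rewrite -mxrank_eq0 mxrank_ker -lt0n subn_gt0.
  by apply: leq_ltn_trans sn; apply: rank_leq_col.
case/rowV0Pn => x /sub_kermxP xB x0.
have xs : {in s, forall y, inner G x y = 0}.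
  move=> y ys; have hy : (index y s < size s)%N by rewrite index_mem.
  have := congr1 (fun M : 'rV_(size s) => M 0 (Ordinal hy)) xB.
  rewrite mulmxA [RHS]mxE => <-; rewrite /inner mxE [RHS]mxE; apply: eq_bigr => k _.
  by rewrite !mxE /= nth_index.
have q0 := inner_gt0 G_inner x0.
exists ((Num.sqrt (inner G x x))^-1 *: x); split=> [|y ys]; last first.
  by rewrite innerZl (xs y) // mulr0.
rewrite innerZl innerZr // mulrA -invfM -expr2 sqr_sqrtr ?ltW //.
by rewrite mulVf // gt_eqF.
Qed.

Lemma orthonormal_rcons s x : orthonormal_seq s -> inner G x x = 1 ->
  {in s, forall y, inner G x y = 0} -> orthonormal_seq (rcons s x).
Proof.
move=> hs x1 xs i j; rewrite size_rcons !ltnS !nth_rcons => hi hj.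
case: (ltngtP i (size s)) hi => // hi _; case: (ltngtP j (size s)) hj => // hj _.
- exact: hs.
- by rewrite innerC // xs ?mem_nth // hj ltn_eqF.
- by rewrite hi xs ?mem_nth // gtn_eqF.
by rewrite hi hj eqxx x1.
Qed.

Lemma orthonormal_extend s : orthonormal_seq s -> (size s <= n)%N ->
  exists t, size (s ++ t) = n /\ orthonormal_seq (s ++ t).
Proof.
move=> hs sn; move: {2}(n - size s)%N (erefl (n - size s)%N) => d.
elim: d s hs sn => [|d IH] s hs sn hd.
  exists [::]; rewrite cats0; split=> //; apply/eqP.
  by rewrite eqn_leq sn -subn_eq0 hd.
have sn' : (size s < n)%N by rewrite -subn_gt0 hd.
have [x [x1 xs]] := unit_orthogonal sn'.
have hd' : (n - size (rcons s x))%N = d by rewrite size_rcons subnS hd.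
have sn2 : (size (rcons s x) <= n)%N by rewrite size_rcons.
have [t [ht1 ht2]] := IH _ (orthonormal_rcons hs x1 xs) sn2 hd'.
by exists (x :: t); rewrite -cat_rcons.
Qed.

(** Frames are indexed by natural numbers, with conditions on the first [n] only, so that closed
    lists such as [iota 0 7] can be computed with. *)
Variable b : nat -> 'rV[R]_n.
Hypothesis b_frame : forall i j : nat, (i < n)%N -> (j < n)%N ->
  inner G (b i) (b j) = (i == j)%:R.

Let P : 'M[R]_n := \matrix_(i < n) b i.

Lemma frame_mx : P *m G *m P^T = 1%:M.
Proof.
apply/matrixP => i j; rewrite [RHS]mxE -(b_frame (ltn_ord i) (ltn_ord j)) /inner.
have rowE (k : 'I_n) : b k = row k P by rewrite rowK.
rewrite !rowE tr_row -row_mul -mulmxA -row_mul mulmxA !mxE.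
by apply: eq_bigr => k _; rewrite !mxE.
Qed.

Lemma frame_sum x : x = \sum_(a < n) inner G x (b a) *: b a.
Proof.
have h : G *m P^T *m P = 1%:M by apply: mulmx1C; rewrite mulmxA frame_mx.
rewrite -[LHS]mulmx1 -h mulmxA [LHS]mulmx_sum_row; apply: eq_bigr => a _.
rewrite rowK /inner mulmxA; congr (_ *: _).
by rewrite [LHS]mxE [RHS]mxE; apply: eq_bigr => k _; rewrite !mxE.
Qed.

Lemma frame_parseval x y :
  inner G x y = \sum_(a < n) inner G x (b a) * inner G y (b a).
Proof.
rewrite {1}(frame_sum x) inner_suml; apply: eq_bigr => a _.
by rewrite innerZl (innerC G_inner y).
Qed.

(** The value of [vol] on the frame is [vol setT * \det P]. Normalization of [vol] says
    [vol setT ^+ 2 = \det G], and orthonormality says [\det P ^+ 2 * \det G = 1]. *)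
Lemma frame_volume vol : is_volume G vol ->
  ext_eval vol (map b (iota 0 n)) ^+ 2 = 1.
Proof.
move=> [hv]; rewrite /ext_inner (bigD1 setT) //= big1 => [|I IT]; last first.
  rewrite hv ?mul0r //; apply: contra IT => /eqP cI.
  by rewrite eqEcard subsetT /= cardsT card_ord cI.
pose h (k : nat) : 'rV[R]_n := if insub k is Some i then row i (invmx G) else 0.
have -> : sharps G setT = map h (iota 0 n).
  rewrite /sharps enum_setT -enumT -val_enum_ord -map_comp; apply: eq_map => i.
  by rewrite /= /h valK.
rewrite addr0 !top_form_eval // => e.
have -> : (\matrix_(i < n, j < n) b i 0 j) = P by apply/matrixP => i j; rewrite !mxE.
have := congr1 determinant frame_mx; rewrite !det_mulmx det_tr det1 => p.
have : (\matrix_(i < n, j < n) h i 0 j) = invmx G.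
  by apply/matrixP => i j; rewrite mxE /h valK mxE.
move=> hE; rewrite hE det_inv in e.
have dG : \det G != 0 by rewrite -unitfE -unitmxE inner_product_unit.
transitivity ((vol setT * (vol setT * (\det G)^-1)) * (\det P * \det G * \det P)).
  by field.
by rewrite e p mulr1.
Qed.

End Frames.

(** * Ricci curvature of two-step nilpotent Lie algebras *)

Section Ricci.
Variables (R : realType) (n : nat) (L : lieAlgebra R n) (G : 'M[R]_n).
Hypothesis G_inner : inner_product G.
Implicit Types (x y z u : 'rV[R]_n).
Local Notation kos := (koszul L G).
Local Notation nab := (nabla L G).

Lemma koszul_lin (k : R) x y u v : kos x y (k *: u + v) = k * kos x y u + kos x y v.
Proof.
rewrite /koszul bracket_linl bracket_linr !innerDr // !innerDl !innerZr // !innerZl.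
by field.
Qed.

Lemma inner_nabla x y z : inner G (nab x y) z = kos x y z.
Proof.
rewrite /nabla inner_row_invmx // [in RHS](row_sum_delta z).
have k0 : kos x y 0 = 0.
  by rewrite /koszul bracket0l bracket0r !inner0l inner0r // subr0 addr0 mul0r.
have kD u v : kos x y (u + v) = kos x y u + kos x y v.
  by have := koszul_lin 1 x y u v; rewrite scale1r mul1r.
rewrite (big_morph (kos x y) kD k0); apply: eq_bigr => k _.
by have := koszul_lin (z 0 k) x y (delta_mx 0 k) 0; rewrite k0 !addr0 mulrC => ->.
Qed.

Lemma nabla_linl (k : R) x y z : nab (k *: x + y) z = k *: nab x z + nab y z.
Proof.
apply: (inner_inj G_inner) => w; rewrite innerDl innerZl !inner_nabla /koszul.
by rewrite bracket_linl bracket_linr !innerDl !innerZl innerDr // innerZr //; field.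
Qed.

Lemma nabla_linr (k : R) x y z : nab z (k *: x + y) = k *: nab z x + nab z y.
Proof.
apply: (inner_inj G_inner) => w; rewrite innerDl innerZl !inner_nabla /koszul.
by rewrite bracket_linl bracket_linr !innerDl !innerZl innerDr // innerZr //; field.
Qed.

Lemma curvature_linl (k : R) x y u v :
  curvature L G (k *: x + y) u v = k *: curvature L G x u v + curvature L G y u v.
Proof.
rewrite /curvature bracket_linl !nabla_linl nabla_linr !scalerBr !opprD.
by rewrite (addrACA (k *: nab x _)) (addrACA (k *: nab x _ - _)).
Qed.

Variable b : nat -> 'rV[R]_n.
Hypothesis b_frame : forall i j : nat, (i < n)%N -> (j < n)%N ->
  inner G (b i) (b j) = (i == j)%:R.

Lemma ricci_frame y z :
  ricci L G y z = \sum_(a < n) inner G (curvature L G (b a) y z) (b a).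
Proof.
pose T x := curvature L G x y z.
have T0 : T 0 = 0.
  have := curvature_linl (-1) 0 0 y z; rewrite !scaleN1r oppr0 addr0 addNr //.
have TD u v : T (u + v) = T u + T v.
  by have := curvature_linl 1 u v y z; rewrite !scale1r.
have TZ (k : R) u : T (k *: u) = k *: T u.
  by have := curvature_linl k u 0 y z; rewrite -/(T 0) T0 !addr0.
rewrite /ricci -/T.
transitivity (\sum_i \sum_(a < n) inner G (delta_mx 0 i) (b a) * T (b a) 0 i).
  apply: eq_bigr => i _; rewrite -/(T _) {1}(frame_sum b_frame (delta_mx 0 i)).
  rewrite (big_morph T TD T0) summxE; apply: eq_bigr => a _.
  by rewrite TZ mxE.
rewrite exchange_big; apply: eq_bigr => a _ /=.
rewrite innerC // -flatE //; apply: eq_bigr => i _; by rewrite (innerC G_inner (b a)).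
Qed.

Hypothesis L_two_step : forall x y z, L (L x y) z = 0.
Hypothesis b_adapted : forall i, (i < n)%N ->
  (forall x, L x (b i) = 0) \/ (forall x y, inner G (L x y) (b i) = 0).

(** In the trace of the curvature, the term with the derivatives in directions [b i], then [y],
    vanishes since each [b i] is central or orthogonal to all brackets. Metric compatibility makes
    the second term a sum of products of Koszul expressions, and the third is read off directly
    because brackets are central. *)
Lemma ricciE y z : ricci L G y z =
  - 2^-1 * (\sum_(i < n) \sum_(k < n) inner G (L y (b i)) (b k) * inner G (L z (b i)) (b k))
  + 4^-1 * (\sum_(i < n) \sum_(k < n) inner G (L (b i) (b k)) y * inner G (L (b i) (b k)) z).
Proof.
pose X (i k : 'I_n) := inner G (L z (b i)) (b k).
pose Y (i k : 'I_n) := inner G (L y (b i)) (b k).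
pose Z (i k : 'I_n) := inner G (L (b i) (b k)) z.
pose U (i k : 'I_n) := inner G (L (b i) (b k)) y.
have L_two_step' x u v : L x (L u v) = 0 by rewrite bracketC L_two_step oppr0.
(* This is [[b_i, [y, b_i]] = 0], expanded in the frame and paired with [z]. *)
have ZY0 : \sum_i \sum_k Z i k * Y i k = 0.
  rewrite big1 // => i _.
  have := congr1 (fun x => inner G x z) (L_two_step' (b i) y (b i)).
  rewrite inner0l {1}(frame_sum b_frame (L y (b i))).
  rewrite (big_morph (L (b i)) (fun u v => bracketDr L u v (b i)) (bracket0r L (b i))).
  rewrite inner_suml => h; apply: etrans h; apply: eq_bigr => k _.
  by rewrite bracketZr innerZl mulrC.
have ZY'0 : \sum_i \sum_k Z i k * Y k i = 0.
  transitivity (- \sum_i \sum_k Z i k * Y i k); last by rewrite ZY0 oppr0.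
  rewrite exchange_big /= -sumrN; apply: eq_bigr => i _.
  by rewrite -sumrN; apply: eq_bigr => k _; rewrite /Z bracketC innerNl mulNr.
have kos2 : \sum_(i < n) \sum_(k < n) kos y (b i) (b k) * kos (b i) z (b k) =
    4^-1 * \sum_i \sum_k U i k * Z i k.
  set S := LHS.
  (* The factor [kos y (b i) (b k)] is antisymmetric in [i] and [k], so averaging over the exchange
     keeps only the antisymmetric part [- Z i k / 2] of the other factor. *)
  have SS : S = 2^-1 * \sum_(i < n) \sum_(k < n) (kos y (b i) (b k) * kos (b i) z (b k) +
                                    kos y (b k) (b i) * kos (b k) z (b i)).
    under eq_bigr do rewrite big_split.
    rewrite big_split /= [X in _ + X]exchange_big /= -/S.
    by field.
  rewrite SS.
  transitivity (2^-1 * (\sum_i \sum_k (2^-1 * (U i k * Z i k) + - 2^-1 * (Z i k * Y i k)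
     + 2^-1 * (Z i k * Y k i)))).
    congr (_ * _); apply: eq_bigr => i _; apply: eq_bigr => k _.
    rewrite /koszul (bracketC L (b k) (b i)) (bracketC L (b k) y) (bracketC L (b i) y).
    rewrite (bracketC L (b k) z) (bracketC L (b i) z) !innerNl -/(U i k) -/(Z i k).
    by rewrite -/(X i k) -/(X k i) -/(Y i k) -/(Y k i); field.
  under eq_bigr do rewrite 2!big_split /= -!mulr_sumr.
  by rewrite 2!big_split /= -!mulr_sumr ZY0 ZY'0 !mulr0 !addr0 mulrA; congr (_ * _); field.
rewrite ricci_frame.
transitivity (\sum_(i < n) ((\sum_(k < n) kos y (b i) (b k) * kos (b i) z (b k))
   - 2^-1 * \sum_(k < n) Y i k * X i k)); last first.
  rewrite big_split /= kos2 sumrN -mulr_sumr; ring.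
apply: eq_bigr => i _; rewrite /curvature !innerDl !innerNl.
have -> : inner G (nab (b i) (nab y z)) (b i) = 0.
  rewrite inner_nabla /koszul bracket_alt inner0l addr0 (bracketC L (b i)) innerNl.
  by have [h|h] := b_adapted (ltn_ord i); rewrite h ?inner0l subr0 oppr0 mul0r.
have -> : - inner G (nab y (nab (b i) z)) (b i) =
    \sum_(k < n) kos y (b i) (b k) * kos (b i) z (b k).
  under eq_bigr do rewrite -!inner_nabla.
  rewrite -(frame_parseval G_inner b_frame).
  move: (nab (b i) z) => w; rewrite !inner_nabla /koszul.
  rewrite (bracketC L w y) (bracketC L (b i) w) (bracketC L (b i) y) !innerNl.
  by field.
rewrite add0r; congr (_ + _).
rewrite inner_nabla /koszul L_two_step' L_two_step !inner0l (bracketC L (b i) y) innerNr //.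
by rewrite -(frame_parseval G_inner b_frame) (innerC G_inner (L y _)); field.
Qed.

Lemma ricci_endoE y z : inner G (ricci_endo L G y) z =
  - 2^-1 * (\sum_(i < n) \sum_(k < n) inner G (L y (b i)) (b k) * inner G (L z (b i)) (b k))
  + 4^-1 * (\sum_(i < n) \sum_(k < n) inner G (L (b i) (b k)) y * inner G (L (b i) (b k)) z).
Proof.
rewrite /ricci_endo inner_row_invmx // -ricciE.
have ricci_lin (k : R) u v :
    ricci L G y (k *: u + v) = k * ricci L G y u + ricci L G y v.
  rewrite !ricciE mulrDr addrACA.
    congr (_ + _); rewrite !mulr_sumr -big_split; apply: eq_bigr => i _ /=;
      rewrite !mulr_sumr -big_split; apply: eq_bigr => l _ /=.
    by rewrite bracket_linl innerDl innerZl; ring.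
  by rewrite innerDr // innerZr //; ring.
have r0 : ricci L G y 0 = 0.
  by have := ricci_lin (-1) 0 0; rewrite scaler0 addr0 mulN1r addNr.
have rD u v : ricci L G y (u + v) = ricci L G y u + ricci L G y v.
  by have := ricci_lin 1 u v; rewrite scale1r mul1r.
rewrite [in RHS](row_sum_delta z) (big_morph (ricci L G y) rD r0); apply: eq_bigr => k _.
by have := ricci_lin (z 0 k) (delta_mx 0 k) 0; rewrite r0 !addr0 mulrC => ->.
Qed.

End Ricci.

(** * The normal form of a G2-structure *)

(* If [f] gives the values of [phi] on a frame [b], this is the value on the frame of
   the 7-form (b_i _| phi) /\ (b_j _| phi) /\ phi. *)
Definition G2_cubic (R : comNzRingType) (f : seq nat -> R) (i j : nat) : R :=
  shuffle 4 (shuffle 2 (fun t => sort_eval f (i :: t)) (fun t => sort_eval f (j :: t)))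
    (sort_eval f) (iota 0 7).

Lemma eq_G2_cubic (R : comNzRingType) (F F' : seq nat -> R) (i j : nat) :
    (forall p q r : nat, (p < q)%N -> (q < r)%N -> (r < 7)%N ->
      F [:: p; q; r] = F' [:: p; q; r]) ->
    (i < 7)%N -> (j < 7)%N -> G2_cubic F i j = G2_cubic F' i j.
Proof.
move=> E i7 j7; have triple s : size s = 3 -> all (fun k => k < 7)%N s ->
    sort_eval F s = sort_eval F' s.
  by case: s => [|x [|y [|z []]]] // _ /and4P[x7 y7 z7 _]; apply: sort_eval_triple E _ _ _.
apply: eq_splits_in => s t s4 st.
have [hs ht] : all (fun k => k < 7)%N s /\ all (fun k => k < 7)%N t.
  by apply/andP; rewrite -all_cat (perm_all _ st).
have sz : size t = 3 by have := perm_size st; rewrite size_cat s4 => -[].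
rewrite [sort_eval F t]triple //; congr (_ * _).
apply: eq_splits_in => p q p2 pq.
have [hp hq] : all (fun k => k < 7)%N p /\ all (fun k => k < 7)%N q.
  by apply/andP; rewrite -all_cat (perm_all _ pq).
have sz' : size q = 2 by have := perm_size pq; rewrite size_cat p2 s4 => -[].
by rewrite !triple /= ?p2 ?sz' ?i7 ?j7.
Qed.

(* Write [phi = b^0 /\ omega + rho]. Then [eta5] represents [omega /\ rho], [pf_adj] is the
   quadratic expression in omega with [omega * pf_adj omega = 2 Pf omega], and [hitchin] is
   Hitchin's endomorphism of the 3-form rho in dimension 6, whose square is scalar. *)
Section SquareIdentities.
Variables (R : realFieldType) (f : seq nat -> R).

Local Notation F := (sort_eval f).
Local Notation om := (fun t => F (0%N :: t)).

Definition hitchin (a b : nat) : R :=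
  (-1) ^+ a * shuffle 2 (fun t => F (b :: t)) F (omit a (iota 1 6)).

Definition eta5 (c : nat) : R := (-1) ^+ c * shuffle 2 om F (omit c (iota 1 6)).

Definition pf_adj (g : nat -> nat -> R) (a b : nat) : R :=
  if Nat.eqb a b then 0 else
  (if Nat.leb a b then 1 else -1) * (-1) ^+ a * (-1) ^+ b *
    shuffle 2 (fun s => if s is [:: i; j] then g i j else 0)
      (fun s => if s is [:: i; j] then g i j else 0)
      (omit a (omit b (iota 1 6))).

Let Om : 'M[R]_6 := \matrix_(i, j) F [:: 0; i.+1; j.+1]%N.
Let K : 'M[R]_6 := \matrix_(i, j) hitchin i.+1 j.+1.
Let W : 'M[R]_6 := \matrix_(i, j) pf_adj (fun a b => F [:: 0; a; b]%N) i.+1 j.+1.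

Lemma cubic0a (a : 'I_6) :
  G2_cubic f 0 a.+1 = 3 * \sum_(c < 6) F [:: 0; a.+1; c.+1]%N * eta5 c.+1.
Proof.
rewrite !big_ord_recl big_ord0 /=.
rewrite /G2_cubic /eta5.
by case: a => [[|[|[|[|[|[|//]]]]]]] _ /=; calc; ring.
Qed.

Lemma hitchin_sqr : exists l, K *m K = l%:M.
Proof.
exists ((K *m K) 0 0); apply/matrixP => a b; rewrite !mxE !big_ord_recl !big_ord0 /=.
rewrite !mxE /= /bump /= /hitchin.
case: a => [[|[|[|[|[|[|//]]]]]]] ha; case: b => [[|[|[|[|[|[|//]]]]]]] hb /=;
rewrite -?val_eqE /=; calc.
all: ring.
Qed.

Lemma cubic_ab (a b : 'I_6) :
  G2_cubic f a.+1 b.+1 = 3 * (Om *m K) a b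
    - 3 * \sum_(c < 6) F [:: a.+1; b.+1; c.+1]%N * eta5 c.+1.
Proof.
rewrite !mxE !big_ord_recl !big_ord0 /= !mxE /=.
rewrite /G2_cubic /eta5 /hitchin.
case: a => [[|[|[|[|[|[|//]]]]]]] ha; case: b => [[|[|[|[|[|[|//]]]]]]] hb /=; calc.
all: ring.
Qed.

Lemma mul_pf_adj : 3 *: (Om *m W) = (G2_cubic f 0 0)%:M.
Proof.
apply/matrixP => a b; rewrite !mxE !big_ord_recl !big_ord0 /=.
rewrite !mxE /= /bump /= /pf_adj /G2_cubic.
case: a => [[|[|[|[|[|[|//]]]]]]] ha; case: b => [[|[|[|[|[|[|//]]]]]]] hb /=;
rewrite -?val_eqE /=; calc.
all: ring.
Qed.

(** Used to compare the Pfaffian with [nu]: if [pf_adj] of omega is [c] times omega, then applying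
    the quadratic map [pf_adj] again gives [c ^+ 3] times omega. One row suffices, as a single
    nonzero entry will be used. *)
Lemma pf_adjK (b : 'I_6) :
  3 * pf_adj (pf_adj (fun a b => F [:: 0; a; b]%N)) 1 b.+1
    = - (4 * G2_cubic f 0 0) * F [:: 0; 1; b.+1]%N.
Proof.
rewrite /pf_adj /G2_cubic.
case: b => [[|[|[|[|[|[|//]]]]]]] hb /=; calc; ring.
Qed.

Lemma pf_adjZ (c : R) (g g' : nat -> nat -> R) (a b : nat) :
  (forall i j, (0 < i <= 6)%N -> (0 < j <= 6)%N -> g' i j = c * g i j) ->
  (0 < a <= 6)%N -> (0 < b <= 6)%N -> pf_adj g' a b = c ^+ 2 * pf_adj g a b.
Proof.
move=> h ha hb; rewrite /pf_adj.
have -> : iota 1 6 = [:: 1; 2; 3; 4; 5; 6]%N by [].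
move: a b ha hb => [//|[|[|[|[|[|[|//]]]]]]] [//|[|[|[|[|[|[|//]]]]]]] _ _; calc.
all: rewrite ?h //; ring.
Qed.

(** This is [|b_0 x b_1| = 1]. Since [G2_cubic f 0 0] is nonzero, omega is invertible; the vanishing
    of [G2_cubic f 0 a] then forces [eta5 = 0], and the remaining equations reduce to
    [Om *m K = (2 * v)%:M]. *)
Lemma G2_cubic_norm (v : R) : v ^+ 2 = 1 ->
    (forall i j : nat, (i < 7)%N -> (j < 7)%N ->
       G2_cubic f i j = 6 * v * (i == j)%:R) ->
  \sum_(c < 7) F [:: 0; 1; val c]%N ^+ 2 = 1.
Proof.
move=> v1 hB.
have v0 : v != 0.
  by apply: contra_eq_neq v1 => ->; rewrite expr0n eq_sym oner_neq0.
have WE : Om *m W = (2 * v)%:M.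
  rewrite -[LHS]scale1r -(@mulVf _ 3) ?pnatr_eq0 // -scalerA mul_pf_adj hB //.
  by rewrite scale_scalar_mx eqxx mulr1; congr _%:M; field.
have WT : W^T = - W.
  apply/matrixP => a b; rewrite !mxE /pf_adj.
  by case: a => [[|[|[|[|[|[|//]]]]]]] ha; case: b => [[|[|[|[|[|[|//]]]]]]] hb /=; calc; ring.
have OT : Om^T = - Om.
  apply/matrixP => a b; rewrite !mxE.
  by case: a => [[|[|[|[|[|[|//]]]]]]] ha; case: b => [[|[|[|[|[|[|//]]]]]]] hb /=; calc; ring.
have WO : W *m Om = (2 * v)%:M.
  have := congr1 trmx WE; rewrite trmx_mul tr_scalar_mx WT OT mulNmx mulmxN opprK.
  exact.
have eta0 (c : 'I_6) : eta5 c.+1 = 0.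
  pose e : 'cV[R]_6 := \col_c eta5 c.+1.
  have Oe : Om *m e = 0.
    apply/colP => a; rewrite mxE [RHS]mxE.
    have B0 : G2_cubic f 0 a.+1 = 0 by rewrite hB ?mulr0 //; exact: (ltn_ord a).
    have := cubic0a a; rewrite B0 => /esym/eqP.
    rewrite mulf_eq0 pnatr_eq0 /= => /eqP h; apply: etrans h.
    by apply: eq_bigr => k _; rewrite !mxE.
  have : W *m Om *m e = 0 by rewrite -mulmxA Oe mulmx0.
  rewrite WO mul_scalar_mx => /colP/(_ c); rewrite !mxE => /eqP.
  by rewrite mulf_eq0 mulf_eq0 pnatr_eq0 (negPf v0) /= => /eqP.
have OK : Om *m K = (2 * v)%:M.
  apply/matrixP => a b; have := cubic_ab a b.
  rewrite [X in _ - _ * X]big1 => [|c _]; last by rewrite eta0 mulr0.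
  rewrite mulr0 subr0 hB; [|exact: (ltn_ord a)|exact: (ltn_ord b)]; rewrite eqSS val_eqE => h.
  rewrite [RHS]mxE.
  have -> : (Om *m K) a b = 3^-1 * (3 * (Om *m K) a b) by field.
  by rewrite -h -mulr_natr; field.
have [l Kl] := hitchin_sqr; rewrite -/K in Kl.
(* Since [omega * K = 2 v] and [K ^ 2 = l], the square of omega is a scalar [- nu], where
   [nu] is the sum of squares to be computed; then [nu ^ 3 = v ^ 2] because [v] is the
   Pfaffian of omega. *)
have O2 : l *: (Om *m Om) = 4%:M.
  rewrite -mul_mx_scalar -Kl mulmxA -(mulmxA Om Om) OK mul_mx_scalar -scalemxAl OK.
  by rewrite scale_scalar_mx; congr _%:M; transitivity (4 * v ^+ 2); [ring | rewrite v1 mulr1].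
have l0 : l != 0.
  apply/eqP => l0; move: O2; rewrite l0 scale0r => /matrixP/(_ 0 0)/eqP.
  by rewrite !mxE eq_sym pnatr_eq0.
pose nu := - (4 / l).
have Onu : Om *m Om = (- nu)%:M.
  rewrite -[LHS]scale1r -(mulVf l0) -scalerA O2 scale_scalar_mx /nu opprK.
  by rewrite mulrC.
have nu0 : nu != 0 by rewrite oppr_eq0 mulf_neq0 ?invr_eq0 ?pnatr_eq0.
have sumE : \sum_(c < 7) F [:: 0; 1; val c]%N ^+ 2 = nu.
  have : (Om *m Om) 0 0 = - nu by rewrite Onu mxE.
  move=> h; rewrite -[RHS]opprK -h mxE !big_ord_recl !big_ord0 !mxE /=; calc; ring.
have W_Om : W = (- (2 * v / nu)) *: Om.
  have : - nu *: W = (2 * v) *: Om.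
    by rewrite -!mul_scalar_mx -Onu -mulmxA WE mul_mx_scalar mul_scalar_mx.
  move=> h; have nN0 : - nu != 0 by rewrite oppr_eq0.
  apply: (scalerI nN0); rewrite h scalerA.
  by congr (_ *: _); field.
have [b Fb] : exists b : 'I_6, F [:: 0; 1; b.+1]%N != 0.
  apply/existsP; rewrite -[X in is_true X]negbK negb_exists; apply/negP => /forallP h.
  move/eqP: nu0; apply; rewrite -sumE big1 // => -[[|[|c]] hc] _;
    apply/eqP; rewrite sqrf_eq0.
  - by apply/eqP => /=; calc; ring.
  - by apply/eqP => /=; calc; ring.
  by have /negPn := h (Ordinal (hc : (c.+1 < 6)%N)).
have nu3 : nu ^+ 3 = 1.
  have hb : (0 < b.+1 <= 6)%N := ltn_ord b.
  have := pf_adjK b.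
  rewrite (@pf_adjZ (- (2 * v / nu)) (fun a b => F [:: 0; a; b]%N)) //; last first.
    move=> [//|i] [//|j] /= hi hj; have := congr1 (fun M : 'M_6 => M (inord i) (inord j)) W_Om.
    by rewrite !mxE !inordK.
  have -> : pf_adj (fun a b => F [:: 0; a; b]%N) 1 b.+1 = W 0 b by rewrite mxE.
  rewrite W_Om 2!mxE hB // mulr1 => h.
  have {}h : (nu ^+ 3 - v ^+ 2) * (24 * v * F [:: 0; 1; b.+1]%N) = 0.
    move: h; move: (F [:: _; _; _]) => x h.
    transitivity (- nu ^+ 3 * (- (4 * (6 * v)) * x) - 24 * v ^+ 3 * x); first by ring.
    by rewrite -h; field.
  have : 24 * v * F [:: 0; 1; b.+1]%N != 0 by rewrite !mulf_neq0 ?pnatr_eq0.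
  by move/eqP: h; rewrite mulf_eq0 subr_eq0 v1 => /orP[/eqP-> //|->].
rewrite sumE; apply/eqP; rewrite -(@pexpr_eq1 _ nu 3) ?nu3 //.
by rewrite -sumE sumr_ge0 // => c _; rewrite sqr_ge0.
Qed.

End SquareIdentities.

(** The form [456 + (01 - 23) /\ 4 - (02 + 13) /\ 5 - (03 - 12) /\ 6], whose three 2-forms span one
    duality type on the span of [b_0, ..., b_3]. Only values at increasing triples carry meaning; 0
    is the default elsewhere. *)
Definition phi_std (R : comNzRingType) (s : seq nat) : R :=
  match s with
  | [:: 4; 5; 6] | [:: 0; 1; 4] | [:: 1; 2; 6] => 1%R
  | [:: 0; 2; 5] | [:: 0; 3; 6] | [:: 2; 3; 4] | [:: 1; 3; 5] => (-1)%R
  | _ => 0%R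
  end%N.
Lemma phi_std_intr (R : comNzRingType) s : phi_std R s = (phi_std int s)%:~R.
Proof.
by case: s => [|[|[|[|[|[|i]]]]] [|[|[|[|[|[|[|j]]]]]] [|[|[|[|[|[|[|[|k]]]]]]] [|l s]]]].
Qed.

(** The sign says that the volume form takes the value -1 on a frame in which the form is [phi_std].
    The 49 cases are evaluated over the integers. *)
Lemma G2_cubic_phi_std (R : comNzRingType) (i j : nat) : (i < 7)%N -> (j < 7)%N ->
  G2_cubic (phi_std R) i j = - 6 * (i == j)%:R.
Proof.
move=> i7 j7; have -> : G2_cubic (phi_std R) i j = (G2_cubic (phi_std int) i j)%:~R.
  rewrite /G2_cubic /shuffle rmorph_splits; apply: eq_splits => p q _.
  rewrite rmorphM rmorph_splits rmorph_sort_eval; congr (_ * _).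
    apply: eq_splits => s t _; rewrite rmorphM !rmorph_sort_eval.
    by congr (_ * _); apply: eq_sort_eval => u; apply: phi_std_intr.
  by apply: eq_sort_eval => u; apply: phi_std_intr.
have -> : - 6 * (i == j)%:R = (- 6 * (i == j)%:R : int)%:~R :> R.
  by rewrite rmorphM rmorph_nat rmorphN.
congr _%:~R.
by move: i j i7 j7 => [|[|[|[|[|[|[|?]]]]]]] [|[|[|[|[|[|[|?]]]]]]] // _ _; vm_compute.
Qed.

(** * Values on the lines of the Fano plane *)

Section Fano.
Variable R : realFieldType.

(* The third point of the line through i and j in the Fano plane, for the lines 456, 014,
   025 and 036, and 7 for the pairs on the other lines. *)
Definition third (i j : nat) : nat :=
  match i, j with
  | 5, 6 | 0, 1 => 4 | 4, 6 | 0, 2 => 5 | 4, 5 | 0, 3 => 6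
  | 0, 4 => 1 | 0, 5 => 2 | 0, 6 => 3 | 1, 4 | 2, 5 | 3, 6 => 0
  | _, _ => 7
  end.

Ltac zeros_with zero := repeat match goal with |- context [?F [:: ?a; ?b; ?c]] =>
  rewrite (zero a b c isT isT isT erefl isT) end.

(** Each row is the squared norm of [b_i x b_j], so an entry of square 1 kills the others. The four
    given lines thus kill every triple off the lines except 123. Then the rows of 16, 15 and 24 have
    a single entry left, which gives the missing lines, and the row of 12 kills 123. *)
Lemma fano_squares (F : seq nat -> R) :
    (forall i j : nat, (i < j)%N -> (j < 7)%N ->
       \sum_(c <- iota 0 7) sort_eval F [:: i; j; c] ^+ 2 = 1) ->
    [/\ F [:: 4; 5; 6]%N ^+ 2 = 1, F [:: 0; 1; 4]%N ^+ 2 = 1,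
        F [:: 0; 2; 5]%N ^+ 2 = 1 & F [:: 0; 3; 6]%N ^+ 2 = 1] ->
  forall i j k : nat, (i < j)%N -> (j < k)%N -> (k < 7)%N ->
    F [:: i; j; k] ^+ 2 = phi_std R [:: i; j; k] ^+ 2.
Proof.
move=> row [h1 h2 h3 h4].
have line (i j : nat) : (i < j)%N -> (third i j < 7)%N ->
    sort_eval F [:: i; j; third i j] ^+ 2 = 1.
  move: i j => [|[|[|[|[|[|i]]]]]] [|[|[|[|[|[|[|j]]]]]]] // _ _;
  by rewrite /= ?opprK ?sqrrN.
have off (i j c : nat) : (i < j)%N -> (j < 7)%N -> (third i j < 7)%N -> (c < 7)%N ->
    c != third i j -> sort_eval F [:: i; j; c] = 0.
  move=> ij j7 k7 c7 ck; have := row _ _ ij j7.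
  rewrite (bigD1_seq (third i j)) ?iota_uniq ?mem_iota //= line // -[RHS]addr0.
  have cI : c \in iota 0 7 by rewrite mem_iota.
  move=> /addrI/eqP; rewrite psumr_eq0 => [/allP/(_ c cI)|d _]; last exact: sqr_ge0.
  by rewrite ck /= sqrf_eq0 => /eqP.
have zero (i j k : nat) : (i < j)%N -> (j < k)%N -> (k < 7)%N ->
    phi_std R [:: i; j; k] = 0 -> [:: i; j; k] != [:: 1; 2; 3]%N -> F [:: i; j; k] = 0.
  move: i j k => [|[|[|[|[|i]]]]] [|[|[|[|[|[|j]]]]]] [|[|[|[|[|[|[|k]]]]]]] // _ _ _;
    rewrite /= => z ne;
    first [ by move/eqP: z; rewrite ?oppr_eq0 oner_eq0 | by case/eqP: ne | clear z ne];
    match goal with |- F [:: ?a; ?b; ?c] = 0 =>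
    first [ exact: (off a b c isT isT isT isT isT)
          | by have /eqP := off a c b isT isT isT isT isT; rewrite /= oppr_eq0 => /eqP
          | by have := off b c a isT isT isT isT isT; rewrite /= opprK ] end.
have h126 : F [:: 1; 2; 6]%N ^+ 2 = 1.
  have := row 1 6 isT isT.
  rewrite !(big_cons, big_nil) /= ?opprK ?sqrrN ?expr0n /= ?addr0 ?add0r.
  by zeros_with zero; rewrite ?expr0n /= ?addr0 ?add0r.
have h135 : F [:: 1; 3; 5]%N ^+ 2 = 1.
  have := row 1 5 isT isT.
  rewrite !(big_cons, big_nil) /= ?opprK ?sqrrN ?expr0n /= ?addr0 ?add0r.
  by zeros_with zero; rewrite ?expr0n /= ?addr0 ?add0r.
have h234 : F [:: 2; 3; 4]%N ^+ 2 = 1.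
  have := row 2 4 isT isT.
  rewrite !(big_cons, big_nil) /= ?opprK ?sqrrN ?expr0n /= ?addr0 ?add0r.
  by zeros_with zero; rewrite ?expr0n /= ?addr0 ?add0r.
have h123 : F [:: 1; 2; 3]%N ^+ 2 = 0.
  have := row 1 2 isT isT.
  rewrite !(big_cons, big_nil) /= ?opprK ?sqrrN ?expr0n /= ?addr0 ?add0r.
  zeros_with zero; rewrite h126 ?expr0n /= ?addr0 ?add0r.
  by rewrite -[RHS]add0r => /addIr.
move=> [|[|[|[|[|i]]]]] [|[|[|[|[|[|j]]]]]] [|[|[|[|[|[|[|k]]]]]]] // _ _ _;
  rewrite /= ?sqrrN ?expr1n ?expr0n //=.
all: by zeros_with zero; rewrite expr0n.
Qed.

Lemma fano_signs (F : seq nat -> R) (v : R) :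
    (forall i j k : nat, (i < j)%N -> (j < k)%N -> (k < 7)%N ->
      F [:: i; j; k] ^+ 2 = phi_std R [:: i; j; k] ^+ 2) ->
    [/\ F [:: 4; 5; 6]%N = 1, F [:: 0; 1; 4]%N = 1,
        F [:: 0; 2; 5]%N = -1 & F [:: 0; 3; 6]%N = -1] ->
    (forall i : nat, (i < 7)%N -> G2_cubic F i i = 6 * v) ->
  v = -1 /\ forall i j k : nat, (i < j)%N -> (j < k)%N -> (k < 7)%N ->
    F [:: i; j; k] = phi_std R [:: i; j; k].
Proof.
move=> sq [h456 h014 h025 h036] cub.
have zero (i j k : nat) : (i < j)%N -> (j < k)%N -> (k < 7)%N ->
    phi_std R [:: i; j; k] = 0 -> F [:: i; j; k] = 0.
  move=> ij jk k7 z; apply/eqP; rewrite -sqrf_eq0 sq // z expr0n.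
  by [].
have zero' (i j k : nat) ij jk k7 z (_ : true) := zero i j k ij jk k7 z.
have vE : v = -1.
  have := cub 0%N isT; rewrite /G2_cubic; calc; zeros_with zero'.
  by rewrite h014 h025 h036; lra.
have h234 : F [:: 2; 3; 4]%N = -1.
  have := cub 4%N isT; rewrite /G2_cubic; calc; zeros_with zero'.
  by rewrite h456 h014 vE; lra.
have h135 : F [:: 1; 3; 5]%N = -1.
  have := cub 5%N isT; rewrite /G2_cubic; calc; zeros_with zero'.
  by rewrite h456 h025 vE; lra.
have h126 : F [:: 1; 2; 6]%N = 1.
  have := cub 6%N isT; rewrite /G2_cubic; calc; zeros_with zero'.
  by rewrite h456 h036 vE; lra.
split=> //; move=> [|[|[|[|[|i]]]]] [|[|[|[|[|[|j]]]]]] [|[|[|[|[|[|[|k]]]]]]] // _ _ _.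
all: exact: zero.
Qed.

End Fano.

(** * The cross product and adapted frames *)

Section NormalForm.
Variables (R : realType) (phi : ext R 7) (G : 'M[R]_7) (vol : ext R 7).
Hypotheses (phi3 : is_form 3 phi) (gm : G2_metric_volume phi G vol).
Implicit Types (x y z u : 'rV[R]_7).

Let G_inner : inner_product G. Proof. by case: gm. Qed.

Local Notation T x y z := (ext_eval phi [:: x; y; z]).

Lemma form_wedge (n k l : nat) (a b : ext R n) :
  is_form k a -> is_form l b -> is_form (k + l) (wedge a b).
Proof.
move=> ha hb K hK; rewrite ffunE big1 // => I IK.
have [cI|/ha ->] := eqVneq #|I| k; last by rewrite mulr0 mul0r.
rewrite hb ?mulr0 //; apply: contra hK => /eqP cKI.
by rewrite -cI -cKI cardsD (setIidPr IK) subnKC // subset_leq_card.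
Qed.

Lemma frame_cubic (b : nat -> 'rV[R]_7) (i j : nat) : (i < 7)%N -> (j < 7)%N ->
  (forall i j : nat, (i < 7)%N -> (j < 7)%N -> inner G (b i) (b j) = (i == j)%:R) ->
  G2_cubic (fun s => ext_eval phi (map b s)) i j =
  6 * ext_eval vol (map b (iota 0 7)) * (i == j)%:R.
Proof.
move=> hi hj hb; case: gm => _ _ /(_ (b i) (b j)).
move/(congr1 (fun a => ext_eval a (map b (iota 0 7)))).
rewrite hb // !ext_evalZ => h.
have -> : 6 * ext_eval vol (map b (iota 0 7)) * (i == j)%:R =
  6 * ((i == j)%:R * ext_eval vol (map b (iota 0 7))) by ring.
rewrite h mulrA divff ?pnatr_eq0 // mul1r.
have f2 k : is_form 2 (contract (b k) phi) by apply: contract_form.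
rewrite (ext_eval_wedge _ _ _ (form_wedge (f2 i) (f2 j))).
apply: eq_shuffle => s; last by rewrite ext_eval_sort.
rewrite (ext_eval_wedge _ _ _ (f2 i)); apply: eq_shuffle => t.
  exact/esym/(ext_eval_sort b phi (i :: t)).
exact/esym/(ext_eval_sort b phi (j :: t)).
Qed.

Lemma ext_eval3C12 x y z : T x y z = - T y x z.
Proof.
by rewrite /ext_eval /= (contractC y x) -scaleN1r contractZ ffunE /GRing.scale /= mulN1r.
Qed.

Lemma ext_eval3C23 x y z : T x y z = - T x z y.
Proof. by rewrite /ext_eval /= (contractC z y) ffunE. Qed.

Lemma ext_eval3_diag12 x z : T x x z = 0.
Proof. by rewrite /ext_eval /= contract_contract contract0 ffunE. Qed.

Lemma ext_eval3_diag23 x z : T x z z = 0.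
Proof. by rewrite /ext_eval /= contract_contract ffunE. Qed.

Definition cross x y : 'rV[R]_7 := (\row_k T x y (delta_mx 0 k)) *m invmx G.

Lemma ext_eval3_lin (c : R) x y u z :
  T x y (c *: u + z) = c * T x y u + T x y z.
Proof. by rewrite /ext_eval /= contract_lin !ffunE. Qed.

Lemma inner_cross x y z : inner G (cross x y) z = T x y z.
Proof.
rewrite /cross inner_row_invmx //.
have T0 : T x y 0 = 0.
  by have := ext_eval3_lin (-1) x y 0 0; rewrite scaler0 addr0 mulN1r addNr.
have TD u v : T x y (u + v) = T x y u + T x y v.
  by have := ext_eval3_lin 1 x y u v; rewrite scale1r mul1r.
rewrite [in RHS](row_sum_delta z) (big_morph (fun z => T x y z) TD T0); apply: eq_bigr => k _.
by have := ext_eval3_lin (z 0 k) x y (delta_mx 0 k) 0; rewrite T0 !addr0 mulrC => ->.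
Qed.

(** After completing [x], [y] to an orthonormal frame, Parseval's identity writes the norm as the
    sum computed in [G2_cubic_norm]. *)
Lemma cross_norm x y : orthonormal_seq G [:: x; y] -> inner G (cross x y) (cross x y) = 1.
Proof.
move=> hxy; have [t [st ht]] := orthonormal_extend G_inner hxy isT.
pose b := nth 0 ([:: x; y] ++ t).
have hb i j : (i < 7)%N -> (j < 7)%N -> inner G (b i) (b j) = (i == j)%:R.
  by move=> hi hj; apply: ht; rewrite st.
have hv : is_volume G vol by case: gm.
have := G2_cubic_norm (frame_volume G_inner hb hv) (fun i j hi hj => frame_cubic hi hj hb).
move=> <-; rewrite (frame_parseval G_inner hb); apply: eq_bigr => c _.
by rewrite inner_cross -expr2 -(ext_eval_sort b phi [:: 0; 1; val c]%N).
Qed.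

Lemma orthonormal2 x y : inner G x x = 1 -> inner G y y = 1 -> inner G x y = 0 ->
  orthonormal_seq G [:: x; y].
Proof.
by move=> x1 y1 xy [|[|i]] [|[|j]] //= _ _; rewrite ?x1 ?y1 ?xy // innerC.
Qed.

(** Polarization: apply [cross_norm] to [u] and the unit vector [(x + y) / sqrt 2]. *)
Lemma cross_orthogonal u x y : inner G u u = 1 -> inner G x x = 1 -> inner G y y = 1 ->
    inner G u x = 0 -> inner G u y = 0 -> inner G x y = 0 ->
  inner G (cross u x) (cross u y) = 0.
Proof.
move=> u1 x1 y1 ux uy xy.
pose c : R := Num.sqrt 2^-1.
have c2 : c * c = 2^-1 by rewrite -expr2 sqr_sqrtr // invr_ge0 ler0n.
pose w := c *: (x + y).
have w1 : inner G w w = 1.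
  rewrite innerZl innerZr // mulrA c2 innerDl !innerDr // x1 y1 xy (innerC G_inner y) xy.
  by field.
have uw : inner G u w = 0 by rewrite innerZr // innerDr // ux uy addr0 mulr0.
have cD : cross u w = c *: (cross u x + cross u y).
  apply: (inner_inj G_inner) => z; rewrite innerZl innerDl !inner_cross.
  rewrite ext_eval3C23 [in RHS](ext_eval3C23 u x) [in RHS](ext_eval3C23 u y).
  rewrite /w scalerDr ext_eval3_lin -[c *: y]addr0 ext_eval3_lin.
  have -> : T u z 0 = 0.
    by have := ext_eval3_lin (-1) u z 0 0; rewrite scaler0 addr0 mulN1r addNr.
  by ring.
have := cross_norm (orthonormal2 u1 w1 uw).
rewrite cD innerZl innerZr // mulrA c2 innerDl !innerDr //.
rewrite (cross_norm (orthonormal2 u1 x1 ux)) (cross_norm (orthonormal2 u1 y1 uy)).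
rewrite (innerC G_inner (cross u y)); lra.
Qed.

Lemma unit_eq x y : inner G x x = 1 -> inner G y y = 1 -> inner G x y = 1 -> x = y.
Proof.
move=> x1 y1 xy; apply/eqP; rewrite -subr_eq0; apply/negPn/negP => /(inner_gt0 G_inner).
rewrite innerDl !innerDr // !innerNl !innerNr // x1 y1 xy (innerC G_inner y) xy.
lra.
Qed.

Lemma adapted_frame z1 z2 : inner G z1 z1 = 1 -> inner G z2 z2 = 1 -> inner G z1 z2 = 0 ->
  exists b : nat -> 'rV[R]_7,
  [/\ forall i j : nat, (i < 7)%N -> (j < 7)%N -> inner G (b i) (b j) = (i == j)%:R,
    b 4 = z1, b 5 = z2, ext_eval vol (map b (iota 0 7)) = -1 &
    forall i j k : nat, (i < j)%N -> (j < k)%N -> (k < 7)%N ->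
      ext_eval phi (map b [:: i; j; k]) = phi_std R [:: i; j; k]].
Proof.
move=> z11 z21 z12.
have z21' : inner G z2 z1 = 0 by rewrite innerC.
pose z3 := cross z1 z2.
have z31 : inner G z3 z3 = 1 by apply/cross_norm/orthonormal2.
have z3z1 : inner G z3 z1 = 0 by rewrite inner_cross ext_eval3C23 ext_eval3_diag12 oppr0.
have z3z2 : inner G z3 z2 = 0 by rewrite inner_cross ext_eval3_diag23.
have z1z3 : inner G z1 z3 = 0 by rewrite innerC.
have z2z3 : inner G z2 z3 = 0 by rewrite innerC.
have T123 : T z1 z2 z3 = 1 by rewrite -inner_cross.
(* Both sides are unit vectors, and their scalar product is [phi(z1, z2, z3) = 1]. *)
have c13 : cross z1 z3 = - z2.
  apply: unit_eq; rewrite ?cross_norm ?innerNl ?innerNr ?opprK //; first exact: orthonormal2.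
  by rewrite inner_cross ext_eval3C23 opprK.
have c23 : cross z2 z3 = z1.
  apply: unit_eq; rewrite ?cross_norm //; first exact: orthonormal2.
  by rewrite inner_cross ext_eval3C23 ext_eval3C12 opprK.
have oz : orthonormal_seq G [:: z1; z2; z3].
  move=> [|[|[|i]]] [|[|[|j]]] //= _ _;
  by rewrite ?z11 ?z21 ?z31 ?z12 ?z21' ?z1z3 ?z2z3 ?z3z1 ?z3z2.
have [x0 [x01 hx0]] := unit_orthogonal G_inner (isT : (size [:: z1; z2; z3] < 7)%N).
have x0z1 : inner G x0 z1 = 0 by apply: hx0; rewrite !inE eqxx.
have x0z2 : inner G x0 z2 = 0 by apply: hx0; rewrite !inE eqxx orbT.
have x0z3 : inner G x0 z3 = 0 by apply: hx0; rewrite !inE eqxx !orbT.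
have z1x0 : inner G z1 x0 = 0 by rewrite innerC.
have z2x0 : inner G z2 x0 = 0 by rewrite innerC.
have z3x0 : inner G z3 x0 = 0 by rewrite innerC.
have crossC x y : cross x y = - cross y x.
  by apply: (inner_inj G_inner) => z; rewrite innerNl !inner_cross ext_eval3C12.
pose x1 : 'rV[R]_7 := cross z1 x0.
pose x2 : 'rV[R]_7 := - cross z2 x0.
pose x3 : 'rV[R]_7 := - cross z3 x0.
have x11 : inner G x1 x1 = 1 by apply/cross_norm/orthonormal2.
have x21 : inner G x2 x2 = 1.
  by rewrite innerNl innerNr // opprK; apply/cross_norm/orthonormal2.
have x31 : inner G x3 x3 = 1.
  by rewrite innerNl innerNr // opprK; apply/cross_norm/orthonormal2.
have x1x0 : inner G x1 x0 = 0 by rewrite inner_cross ext_eval3_diag23.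
have x2x0 : inner G x2 x0 = 0 by rewrite innerNl inner_cross ext_eval3_diag23 oppr0.
have x3x0 : inner G x3 x0 = 0 by rewrite innerNl inner_cross ext_eval3_diag23 oppr0.
have T12 : T z1 z2 x0 = 0 by rewrite -inner_cross.
have T13 : T z1 z3 x0 = 0 by rewrite -inner_cross c13 innerNl z2x0 oppr0.
have T23 : T z2 z3 x0 = 0 by rewrite -inner_cross c23.
have x1z : {in [:: z1; z2; z3], forall y, inner G x1 y = 0}.
  move=> y; rewrite !inE inner_cross ext_eval3C23 => /or3P[] /eqP ->.
  - by rewrite ext_eval3_diag12 oppr0.
  - by rewrite T12 oppr0.
  by rewrite T13 oppr0.
have x2z : {in [:: z1; z2; z3], forall y, inner G x2 y = 0}.
  move=> y; rewrite !inE innerNl inner_cross ext_eval3C23 opprK => /or3P[] /eqP -> //.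
  - by rewrite ext_eval3C12 T12 oppr0.
  by rewrite ext_eval3_diag12.
have x3z : {in [:: z1; z2; z3], forall y, inner G x3 y = 0}.
  move=> y; rewrite !inE innerNl inner_cross ext_eval3C23 opprK => /or3P[] /eqP ->.
  - by rewrite ext_eval3C12 T13 oppr0.
  - by rewrite ext_eval3C12 T23 oppr0.
  by rewrite ext_eval3_diag12.
have cc x y : inner G x x = 1 -> inner G y y = 1 -> inner G x0 x = 0 -> inner G x0 y = 0 ->
    inner G x y = 0 -> inner G (cross x x0) (cross y x0) = 0.
  move=> ? ? ? ? ?; rewrite (crossC x) (crossC y) innerNl innerNr // opprK.
  exact: cross_orthogonal.
have x2x1 : inner G x2 x1 = 0 by rewrite innerNl cc ?oppr0.
have x3x1 : inner G x3 x1 = 0 by rewrite innerNl cc ?oppr0.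
have x3x2 : inner G x3 x2 = 0 by rewrite innerNl innerNr // opprK cc.
have h0 := orthonormal_rcons G_inner oz x01 hx0.
have h1 : orthonormal_seq G [:: z1; z2; z3; x0; x1].
  apply: (orthonormal_rcons G_inner h0 x11) => y; rewrite mem_rcons inE.
  by move=> /orP[/eqP->|/x1z].
have h2 : orthonormal_seq G [:: z1; z2; z3; x0; x1; x2].
  apply: (orthonormal_rcons G_inner h1 x21) => y.
  rewrite (_ : [:: z1; z2; z3; x0; x1] = [:: z1; z2; z3] ++ [:: x0; x1]) // mem_cat.
  by move=> /orP[/x2z //|]; rewrite !inE => /orP[] /eqP ->.
have h3 : orthonormal_seq G [:: z1; z2; z3; x0; x1; x2; x3].
  apply: (orthonormal_rcons G_inner h2 x31) => y.
  rewrite (_ : [:: z1; z2; z3; x0; x1; x2] = [:: z1; z2; z3] ++ [:: x0; x1; x2]) // mem_cat.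
  by move=> /orP[/x3z //|]; rewrite !inE => /or3P[] /eqP ->.
(* Orthonormality was built up starting from [z1, z2, z3]; the permutation renumbers the frame as
   [x0, x1, x2, x3, z1, z2, z3]. *)
pose b i := nth 0 [:: z1; z2; z3; x0; x1; x2; x3] (nth 0%N [:: 3; 4; 5; 6; 0; 1; 2]%N i).
have hb (i j : nat) : (i < 7)%N -> (j < 7)%N -> inner G (b i) (b j) = (i == j)%:R.
  move=> hi hj; rewrite /b h3; try by case: i hi => [|[|[|[|[|[|[|]]]]]]].
    by case: i hi => [|[|[|[|[|[|[|]]]]]]] //; case: j hj => [|[|[|[|[|[|[|]]]]]]].
  by case: j hj => [|[|[|[|[|[|[|]]]]]]].
have Tcyc x y z : T x y z = T z x y by rewrite ext_eval3C23 ext_eval3C12 opprK.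
pose F s := ext_eval phi (map b s).
have h456 : F [:: 4; 5; 6]%N = 1 by [].
have h014 : F [:: 0; 1; 4]%N = 1 by rewrite /F /= Tcyc -inner_cross.
have h025 : F [:: 0; 2; 5]%N = -1.
  by rewrite /F /= Tcyc -inner_cross -[cross z2 x0]opprK innerNl x21.
have h036 : F [:: 0; 3; 6]%N = -1.
  by rewrite /F /= Tcyc -inner_cross -[cross z3 x0]opprK innerNl x31.
have rows (i j : nat) : (i < j)%N -> (j < 7)%N ->
    \sum_(c <- iota 0 7) sort_eval F [:: i; j; c] ^+ 2 = 1.
  move=> ij j7; have i7 := ltn_trans ij j7.
  have oij : orthonormal_seq G [:: b i; b j].
    by apply: orthonormal2; rewrite hb // ?eqxx // ltn_eqF.
  rewrite -(cross_norm oij) (frame_parseval G_inner hb) -(big_mkord xpredT (fun c =>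
    inner G (cross (b i) (b j)) (b c) * inner G (cross (b i) (b j)) (b c))).
  apply: eq_bigr => c _.
  by rewrite inner_cross -expr2 -(ext_eval_sort b phi [:: i; j; c]).
have sq := fano_squares rows.
have {sq} := sq _; rewrite h456 h014 h025 h036 !sqrrN !expr1n.
move=> /(_ (And4 erefl erefl erefl erefl)) sq.
have [vE FE] := fano_signs sq (And4 h456 h014 h025 h036)
  (fun i hi => etrans (frame_cubic hi hi hb) (ltac:(by rewrite eqxx mulr1))).
by exists b; split.
Qed.

End NormalForm.

(** * The purely coclosed equations in an adapted frame *)

Section StandardEquations.
Variable R : realFieldType.

(* The values of [*phi] on a frame in which [phi] is [phi_std]. *)
Definition psi_std (s : seq nat) : R :=
  match s with
  | [:: 0; 1; 5; 6] | [:: 0; 2; 4; 6] | [:: 1; 2; 4; 5] | [:: 1; 3; 4; 6] => 1%R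
  | [:: 0; 1; 2; 3] | [:: 0; 3; 4; 5] | [:: 2; 3; 5; 6] => (-1)%R
  | _ => 0%R
  end%N.

(* The differential of an alternating form [F] for the bracket
   [b_i, b_j] = A i j *: b_4 + C i j *: b_5. *)
Definition d_frame (A C : nat -> nat -> R) (F : seq nat -> R) : seq nat -> R :=
  splits 2 (fun p q => if p is [:: x; y] then
    - (A x y * sort_eval F (4 :: q)%N + C x y * sort_eval F (5 :: q)%N) else 0).

Definition central_plane (A : nat -> nat -> R) := forall i,
  [/\ A i 4%N = 0, A i 5%N = 0, A 4%N i = 0 & A 5%N i = 0].

(* The components (01 - 23, 02 + 13, 03 - 12) of [A] and [C], which form one of the two
   duality types, are (p, q, 0) and (-q, p, 0) for some p and q. *)
Definition conformal (A C : nat -> nat -> R) :=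
  [/\ (C 0 3 = C 1 2)%N, (A 0 3 = A 1 2)%N,
      (C 0 1)%N + (A 0 2)%N + (A 1 3)%N = (C 2 3)%N &
      (A 0 1)%N = (A 2 3)%N + (C 0 2)%N + (C 1 3)%N].

Ltac phi_values h := repeat match goal with |- context [?F [:: ?a; ?b; ?c]] =>
  rewrite (h a b c isT isT isT) end.
Ltac psi_values h := repeat match goal with |- context [?F [:: ?a; ?b; ?c; ?d]] =>
  rewrite (h a b c d isT isT isT isT) end.
Ltac zero_products := rewrite ?(mulr0, mul0r, addr0, add0r, oppr0).

Variables (A C : nat -> nat -> R) (F Psi : seq nat -> R).
Hypothesis FE : forall i j k : nat, (i < j)%N -> (j < k)%N -> (k < 7)%N ->
  F [:: i; j; k] = phi_std R [:: i; j; k].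
Hypothesis PsiE : forall i j k l : nat, (i < j)%N -> (j < k)%N -> (k < l)%N -> (l < 7)%N ->
  Psi [:: i; j; k; l] = psi_std [:: i; j; k; l].
Hypotheses (A_central : central_plane A) (C_central : central_plane C).

Let A4 i : A i 4%N = 0. Proof. by case: (A_central i). Qed.
Let A5 i : A i 5%N = 0. Proof. by case: (A_central i). Qed.
Let A4l i : A 4%N i = 0. Proof. by case: (A_central i). Qed.
Let A5l i : A 5%N i = 0. Proof. by case: (A_central i). Qed.
Let C4 i : C i 4%N = 0. Proof. by case: (C_central i). Qed.
Let C5 i : C i 5%N = 0. Proof. by case: (C_central i). Qed.
Let C4l i : C 4%N i = 0. Proof. by case: (C_central i). Qed.
Let C5l i : C 5%N i = 0. Proof. by case: (C_central i). Qed.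

Ltac central := rewrite ?(A4, A5, A4l, A5l, C4, C5, C4l, C5l).

Ltac expand_dpsi := rewrite /d_frame; calc; psi_values PsiE; central; cbv [psi_std].

Lemma d_frame_phi_top : shuffle 4 (d_frame A C F) (sort_eval F) (iota 0 7) =
  2 * ((A 0 1)%N - (C 0 2)%N - (C 1 3)%N - (A 2 3)%N).
Proof.
(* The differential is kept folded while the outer sum is expanded: 28 of the 35 splittings drop
   out, as [phi_std] has only seven nonzero values. *)
set f := d_frame A C F; set g := sort_eval F.
cbv [shuffle splits iota Nat.leb length].
rewrite /g; cbv [sort_eval insert_eval Nat.compare].
phi_values FE; cbv [phi_std]; zero_products.
rewrite /f /d_frame; calc; phi_values FE; central; cbv [phi_std].
ring.
Qed.

(** Each 5-tuple isolates one linear equation. If it contains 5, all terms in [C] vanish, since they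
    would repeat [b_5], and likewise 4 kills the terms in [A]. The tuple 01236 mixes both and gives
    the third conformal equation; the fourth is the purity condition. *)
Lemma coclosed_equations :
    (forall s, d_frame A C Psi s = 0) ->
    shuffle 4 (d_frame A C F) (sort_eval F) (iota 0 7) = 0 ->
  [/\ forall i, (i < 4)%N -> A i 6%N = 0, forall i, (i < 4)%N -> C i 6%N = 0 & conformal A C].
Proof.
move=> dpsi; rewrite d_frame_phi_top => dphi; split.
- move=> [|[|[|[|//]]]] _.
  + by have := dpsi [:: 0; 1; 2; 5; 6]%N; expand_dpsi; lra.
  + by have := dpsi [:: 0; 1; 3; 5; 6]%N; expand_dpsi; lra.
  + by have := dpsi [:: 0; 2; 3; 5; 6]%N; expand_dpsi; lra.
  by have := dpsi [:: 1; 2; 3; 5; 6]%N; expand_dpsi; lra.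
- move=> [|[|[|[|//]]]] _.
  + by have := dpsi [:: 0; 1; 2; 4; 6]%N; expand_dpsi; lra.
  + by have := dpsi [:: 0; 1; 3; 4; 6]%N; expand_dpsi; lra.
  + by have := dpsi [:: 0; 2; 3; 4; 6]%N; expand_dpsi; lra.
  by have := dpsi [:: 1; 2; 3; 4; 6]%N; expand_dpsi; lra.
split.
- by have := dpsi [:: 0; 1; 2; 3; 4]%N; expand_dpsi; lra.
- by have := dpsi [:: 0; 1; 2; 3; 5]%N; expand_dpsi; lra.
- by have := dpsi [:: 0; 1; 2; 3; 6]%N; expand_dpsi; lra.
by move: dphi; lra.
Qed.

Lemma coclosed_of_equations i j k l m :
    (forall i, (i < 4)%N -> A i 6%N = 0) -> (forall i, (i < 4)%N -> C i 6%N = 0) ->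
    conformal A C -> (i < j)%N -> (j < k)%N -> (k < l)%N -> (l < m)%N -> (m < 7)%N ->
  d_frame A C Psi [:: i; j; k; l; m] = 0.
Proof.
move=> A6 C6 [h1 h2 h3 h4].
move: i j k l m => [|[|[|i]]] [|[|[|[|j]]]] [|[|[|[|[|k]]]]] // [|[|[|[|[|[|l]]]]]] //
  [|[|[|[|[|[|[|m]]]]]]] // _ _ _ _ _.
all: rewrite /d_frame; calc; psi_values PsiE; central; rewrite ?(A6, C6) //; cbv [psi_std].
all: lra.
Qed.

End StandardEquations.

(** * Hodge dual and differential in an adapted frame *)

Section Bridge.
Variables (R : realType) (phi : ext R 7) (G : 'M[R]_7) (vol : ext R 7).
Variables (L : lieAlgebra R 7) (b : nat -> 'rV[R]_7).
Hypotheses (phi3 : is_form 3 phi) (G_inner : inner_product G) (vol7 : is_form 7 vol).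
Hypothesis b_frame : forall i j : nat, (i < 7)%N -> (j < 7)%N ->
  inner G (b i) (b j) = (i == j)%:R.
Hypothesis vol_b : ext_eval vol (map b (iota 0 7)) = -1.
Hypothesis phi_b : forall i j k : nat, (i < j)%N -> (j < k)%N -> (k < 7)%N ->
  ext_eval phi (map b [:: i; j; k]) = phi_std R [:: i; j; k].
Hypothesis L_plane : forall x y, L x y =
  inner G (L x y) (b 4) *: b 4 + inner G (L x y) (b 5) *: b 5.

Lemma hodge_frame_eval i j k s :
    all (fun a => a < 7)%N [:: i, j, k & s] -> uniq [:: i, j, k & s] ->
  ext_eval (hodge G vol phi) (map b s) = ext_eval phi (map b [:: i; j; k]) *
    sort_eval (fun s => ext_eval vol (map b s)) [:: i, j, k & s].
Proof.
rewrite -ext_eval_sort /= => /and4P[i7 j7 k7 /allP s7].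
rewrite !inE !negb_or => /and4P[/and3P[ij ik /negP is_] /andP[jk /negP js] /negP ks _].
apply: ext_eval_hodge => //; first by rewrite !b_frame ?eqxx.
- move=> t; rewrite !inE => /or3P[/eqP->|/eqP->|/mapP[l ls ->]].
  + by rewrite b_frame // (negPf ij).
  + by rewrite b_frame // (negPf ik).
  have l7 : (l < 7)%N := s7 l ls.
  by rewrite b_frame // (_ : (i == l) = false) //; apply/eqP => e; apply: is_; rewrite e.
- move=> t; rewrite inE => /orP[/eqP->|/mapP[l ls ->]].
    by rewrite b_frame // (negPf jk).
  have l7 : (l < 7)%N := s7 l ls.
  by rewrite b_frame // (_ : (j == l) = false) //; apply/eqP => e; apply: js; rewrite e.
move=> t /mapP[l ls ->].
have l7 : (l < 7)%N := s7 l ls.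
  by rewrite b_frame // (_ : (k == l) = false) //; apply/eqP => e; apply: ks; rewrite e.
Qed.

Lemma hodge_std i j k l : (i < j)%N -> (j < k)%N -> (k < l)%N -> (l < 7)%N ->
  ext_eval (hodge G vol phi) (map b [:: i; j; k; l]) = psi_std R [:: i; j; k; l].
Proof.
pose V s := ext_eval vol (map b s).
have VE : V [:: 0; 1; 2; 3; 4; 5; 6]%N = -1 := vol_b.
have step p q r s : (p < q)%N -> (q < r)%N -> (r < 7)%N ->
    all (fun a => a < 7)%N [:: p, q, r & s] -> uniq [:: p, q, r & s] ->
    ext_eval (hodge G vol phi) (map b s) =
      phi_std R [:: p; q; r] * sort_eval V [:: p, q, r & s].
  by move=> pq qr r7 h7 hu; rewrite (hodge_frame_eval h7 hu) phi_b.
clearbody V.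
move: i j k l => [|[|[|[|i]]]] [|[|[|[|[|j]]]]] [|[|[|[|[|[|k]]]]]] //
  [|[|[|[|[|[|[|l]]]]]]] //
  _ _ _ _.
(* The Hodge dual on a 4-tuple is up to sign [phi] on the complementary triple, which is computed
   here from the goal. *)
all: match goal with |- ext_eval _ (map _ ?s) = _ =>
  let c := eval compute in [seq a <- iota 0 7 | a \notin s] in
  match c with [:: ?p; ?q; ?r] => rewrite (step p q r s) // end end.
all: rewrite /phi_std /psi_std /= VE; ring.
Qed.

Definition coeff4 i j := inner G (L (b i) (b j)) (b 4).
Definition coeff5 i j := inner G (L (b i) (b j)) (b 5).

Lemma ce_diff_frame a s : ext_eval (ce_diff L a) (map b s) =
  d_frame coeff4 coeff5 (fun s => ext_eval a (map b s)) s.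
Proof.
rewrite ext_eval_ce_diff; apply: eq_splits => -[|x [|y [|]]] // q _; congr (- _).
rewrite -!(ext_eval_sort b a) L_plane /ext_eval /= contractDl !contractZl.
by rewrite -!/(ext_eval _ _) ext_evalD !ext_evalZ.
Qed.

Lemma form_ce_diff (k : nat) a : is_form k.+1 a -> is_form k.+2 (ce_diff L a).
Proof.
move=> ha; rewrite ce_diffE; apply: big_ind => [||i _]; [exact: form_0|exact: form_D|].
by apply: (form_wedge (form_dcov L i)); exact: contract_form.
Qed.

Lemma wedge_ce_diff_frame :
  ext_eval (wedge (ce_diff L phi) phi) (map b (iota 0 7)) =
  shuffle 4 (d_frame coeff4 coeff5 (fun s => ext_eval phi (map b s)))
    (sort_eval (fun s => ext_eval phi (map b s))) (iota 0 7).
Proof.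
rewrite (ext_eval_wedge _ _ _ (form_ce_diff phi3)); apply: eq_shuffle => s.
  exact: ce_diff_frame.
by rewrite -ext_eval_sort.
Qed.

Hypotheses (b4_central : forall x, L x (b 4) = 0) (b5_central : forall x, L x (b 5) = 0).

Lemma coeff4_central : central_plane coeff4.
Proof.
move=> i; rewrite /coeff4 !(bracketC L (b 4)) !(bracketC L (b 5)).
by rewrite !b4_central !b5_central !oppr0 !inner0l.
Qed.

Lemma coeff5_central : central_plane coeff5.
Proof.
move=> i; rewrite /coeff5 !(bracketC L (b 4)) !(bracketC L (b 5)).
by rewrite !b4_central !b5_central !oppr0 !inner0l.
Qed.

Lemma coclosed_frame_equations :
    ce_diff L (hodge G vol phi) = 0 -> wedge (ce_diff L phi) phi = 0 ->
  [/\ forall i, (i < 4)%N -> coeff4 i 6%N = 0, forall i, (i < 4)%N -> coeff5 i 6%N = 0 &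
      conformal coeff4 coeff5].
Proof.
move=> dpsi dphi.
apply: (@coclosed_equations _ coeff4 coeff5 (fun s => ext_eval phi (map b s))
  (fun s => ext_eval (hodge G vol phi) (map b s)) phi_b hodge_std
  coeff4_central coeff5_central) => [s|].
  by rewrite -ce_diff_frame dpsi ext_eval0.
by rewrite -wedge_ce_diff_frame dphi ext_eval0.
Qed.

End Bridge.

(** * Existence *)

Section StandardStructure.
Variable R : realType.

Lemma ext_eval_delta n (a : ext R n) (s : seq 'I_n) :
  pairwise (fun i j : 'I_n => (i < j)%N) s ->
  ext_eval a [seq delta_mx 0 i | i <- s] = a [set i in s].
Proof.
elim: s a => [|i s IH] a /=.
  by move=> _; rewrite /ext_eval /=; congr (a _); apply/setP => j; rewrite !inE.
move=> /andP[/allP is_ ps].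
have -> : ext_eval a (delta_mx 0 i :: [seq delta_mx 0 j | j <- s]) =
  ext_eval (contract (delta_mx 0 i) a) [seq delta_mx 0 j | j <- s] by [].
rewrite IH // contract_delta; last first.
  by rewrite inE; apply/negP => /is_; rewrite ltnn.
rewrite wsign1 big1 ?mul1r ?set_cons // => j; rewrite inE => /is_ ij.
by rewrite ltnNge (ltnW ij).
Qed.

Definition std_basis (k : nat) : 'rV[R]_7 := delta_mx 0 (inord k).
Local Notation e := std_basis.

Lemma ext_eval_std (a : ext R 7) (I : {set 'I_7}) :
  ext_eval a (map e (map val (enum I))) = a I.
Proof.
rewrite -map_comp (eq_map (_ : _ =1 fun i : 'I_7 => delta_mx 0 i)) => [|i]; last first.
  by rewrite /= /e inord_val.
rewrite ext_eval_delta ?pairwise_enum //; congr (a _).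
by apply/setP => i; rewrite inE mem_enum.
Qed.

Lemma std_frame (i j : nat) : (i < 7)%N -> (j < 7)%N ->
  inner 1%:M (e i) (e j) = (i == j)%:R :> R.
Proof.
move=> i7 j7; rewrite /inner mulmx1 trmx_delta -colE !mxE eqxx /=.
by rewrite -val_eqE /= !inordK // eq_sym.
Qed.

Lemma inner_product1 n : inner_product (1%:M : 'M[R]_n).
Proof.
split=> [|x x0]; first by rewrite trmx1.
rewrite mulmx1 mxE lt_def.
have sq i : x 0 i * x^T i 0 = x 0 i ^+ 2 by rewrite mxE expr2.
under eq_bigr do rewrite sq.
rewrite sumr_ge0 ?andbT => [|i _]; last exact: sqr_ge0.
apply: contraNneq x0 => /eqP; rewrite psumr_eq0 => [/allP h|i _]; last exact: sqr_ge0.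
apply/eqP/rowP => i; rewrite mxE; apply/eqP.
by have := h i (mem_index_enum i); rewrite /= sqrf_eq0.
Qed.

Lemma sharps1 n (I : {set 'I_n}) :
  sharps (1%:M : 'M[R]_n) I = [seq delta_mx 0 i | i <- enum I].
Proof. by rewrite /sharps invmx1; apply: eq_map => i; rewrite row1. Qed.

Definition phi0 : ext R 7 := [ffun I : {set 'I_7} => phi_std R (map val (enum I))].
(** The sign is forced by the value -6 in [G2_cubic_phi_std]. *)
Definition vol0 : ext R 7 := - basis_form R setT.

Lemma form_phi0 : is_form 3 phi0.
Proof.
move=> I hI; rewrite ffunE.
have : size (map val (enum I)) != 3%N by rewrite size_map -cardE.
case: (map _ _) => [//|i [|j [|k [//|l s]]]] _;
  first [ by move: i => [|[|[|[|[|i]]]]]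
        | by move: i j => [|[|[|[|[|i]]]]] [|[|[|[|[|[|j]]]]]]
        | by move: i j k => [|[|[|[|[|i]]]]] [|[|[|[|[|[|j]]]]]] // [|[|[|[|[|[|[|k]]]]]]] ].
Qed.

Lemma form_vol0 : is_form 7 vol0.
Proof.
move=> I hI; rewrite !ffunE; have [IT|_] := eqVneq I setT; last by rewrite oppr0.
by rewrite IT cardsT card_ord in hI.
Qed.

Lemma iota7 : iota 0 7 = map val (enum [set: 'I_7]).
Proof. by rewrite enum_setT -enumT val_enum_ord. Qed.

Lemma vol0_std : ext_eval vol0 (map e (iota 0 7)) = -1.
Proof. by rewrite iota7 ext_eval_std !ffunE eqxx. Qed.

Lemma volume0 : is_volume 1%:M vol0.
Proof.
split; first exact: form_vol0.
rewrite /ext_inner (bigD1 setT) //= big1 => [|I IT]; last first.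
  by rewrite !ffunE (negPf IT) oppr0 mul0r.
rewrite sharps1 ext_eval_delta ?pairwise_enum // (_ : [set i in _] = setT); last first.
  by apply/setP => i; rewrite !inE mem_enum inE.
by rewrite !ffunE eqxx addr0 mulrNN mulr1.
Qed.

Lemma sorted_enum_std (s : seq nat) : sorted ltn s -> all (fun i => i < 7)%N s ->
  exists I : {set 'I_7}, map val (enum I) = s.
Proof.
move=> ss /allP s7; exists [set i : 'I_7 | val i \in s].
apply: (irr_sorted_eq ltn_trans ltnn) => // [|i].
  rewrite sorted_map -(@sorted_map _ _ val ltn) sorted_pairwise; last exact: ltn_trans.
  by rewrite pairwise_map pairwise_enum.
apply/mapP/idP => [[j]|si]; first by rewrite mem_enum inE => js ->.
by exists (Ordinal (s7 i si : (i < 7)%N)); rewrite ?mem_enum ?inE.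
Qed.

Lemma phi0_std (i j k : nat) : (i < j)%N -> (j < k)%N -> (k < 7)%N ->
  ext_eval phi0 (map e [:: i; j; k]) = phi_std R [:: i; j; k].
Proof.
move=> ij jk k7.
have [||I <-] := @sorted_enum_std [:: i; j; k].
- by rewrite /= ij jk.
- by rewrite /= k7 (ltn_trans jk k7) (ltn_trans ij (ltn_trans jk k7)).
by rewrite ext_eval_std ffunE.
Qed.

Lemma top_form0 (a : ext R 7) : is_form 7 a -> ext_eval a (map e (iota 0 7)) = 0 -> a = 0.
Proof.
rewrite iota7 ext_eval_std => ha a0; apply/ffunP => K; rewrite [RHS]ffunE.
have [->//|KT] := eqVneq K setT.
apply: ha; apply: contra KT => /eqP cK.
by rewrite eqEcard subsetT /= cardsT card_ord cK.
Qed.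

Lemma cubic_phi0 (i j : nat) : (i < 7)%N -> (j < 7)%N ->
  G2_cubic (fun s => ext_eval phi0 (map e s)) i j = - 6 * (i == j)%:R.
Proof. by move=> i7 j7; rewrite (eq_G2_cubic phi0_std) // G2_cubic_phi_std. Qed.

End StandardStructure.

Section StandardCoclosed.
Variable R : realType.
Local Notation phi0 := (phi0 R).
Local Notation vol0 := (vol0 R).
Local Notation e := (std_basis R).

Lemma form_cubic v w : is_form 7 (wedge (wedge (contract v phi0) (contract w phi0)) phi0).
Proof.
have f2 u : is_form 2 (contract u phi0) := contract_form u (form_phi0 R).
exact: (form_wedge (form_wedge (f2 v) (f2 w)) (form_phi0 R)).
Qed.

Lemma metric_phi0 : G2_metric_volume phi0 1%:M vol0.
Proof.
split; [exact: inner_product1|exact: volume0|move=> v w].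
pose B v w := wedge (wedge (contract v phi0) (contract w phi0)) phi0.
have basis (i j : 'I_7) : B (delta_mx 0 i) (delta_mx 0 j) = (6 * (i == j)%:R) *: vol0.
  apply/eqP; rewrite -subr_eq0; apply/eqP; apply: top_form0.
    apply: form_D; first exact: form_cubic.
    by apply: form_N => I hI; rewrite ffunE form_vol0 // scaler0.
  rewrite ext_evalD ext_evalN ext_evalZ vol0_std.
  have f2 u : is_form 2 (contract u phi0) := contract_form u (form_phi0 R).
  rewrite (ext_eval_wedge _ _ _ (form_wedge (f2 _) (f2 _))).
  rewrite [X in X - _](_ : _ = G2_cubic (fun s => ext_eval phi0 (map e s)) i j).
    rewrite cubic_phi0 //; ring.
  apply: eq_shuffle => s; last by rewrite ext_eval_sort.
  rewrite (ext_eval_wedge _ _ _ (f2 _)); apply: eq_shuffle => t.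
    by rewrite -(ext_eval_sort e phi0 (val i :: t)) /= /std_basis inord_val.
  by rewrite -(ext_eval_sort e phi0 (val j :: t)) /= /std_basis inord_val.
rewrite -/(B v w).
have -> : B v w = \sum_i \sum_j (v 0 i * w 0 j) *: B (delta_mx 0 i) (delta_mx 0 j).
  rewrite /B {1}(row_sum_delta v) contract_suml !wedge_suml; apply: eq_bigr => i _.
  rewrite {1}(row_sum_delta w) contract_suml wedge_sumr wedge_suml; apply: eq_bigr => j _.
  by rewrite !contractZl wedgeZl wedgeZr !wedgeZl scalerA.
under eq_bigr do under eq_bigr do rewrite basis scalerA.
under eq_bigr do rewrite -scaler_suml.
rewrite -scaler_suml scalerA; congr (_ *: _).
rewrite /inner mulmx1 mxE mulr_sumr; apply: eq_bigr => i _.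
rewrite (bigD1 i) //= eqxx big1 ?addr0 => [|j ji]; last by rewrite eq_sym (negPf ji) !mulr0.
by rewrite mxE /= (_ : true%:R = 1) // mulr1; field.
Qed.

Lemma is_G2_phi0 : is_G2 phi0.
Proof.
split=> [|v v0]; first exact: form_phi0.
have [ip _ /(_ v v)] := metric_phi0; apply: contra_eqN => /eqP ->.
rewrite scaler0 scaler_eq0 negb_or; have [_ pos] := inner_product1 R 7.
rewrite gt_eqF ?pos //=; apply/eqP => /ffunP/(_ setT)/eqP.
by rewrite !ffunE eqxx oppr_eq0 oner_eq0.
Qed.

Lemma form_hodge_phi0 : is_form 4 (hodge 1%:M vol0 phi0).
Proof.
move=> I hI; rewrite ffunE (ext_eval_degree (form_phi0 R)) ?mulr0 ?mul0r //.
rewrite size_map -cardE; apply: contra hI => /eqP cI.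
by have := cardsC I; rewrite cI card_ord -[7%N]/(4 + 3)%N => /addIn ->.
Qed.

Variable L : lieAlgebra R 7.
Hypothesis L_plane : forall x y,
  L x y = L x y 0 (inord 4) *: e 4 + L x y 0 (inord 5) *: e 5.
Hypotheses (e4_central : forall x, L x (e 4) = 0) (e5_central : forall x, L x (e 5) = 0).

Lemma purely_coclosed_phi0 :
    (forall i : nat, (i < 4)%N -> coeff4 1%:M L e i 6%N = 0) ->
    (forall i : nat, (i < 4)%N -> coeff5 1%:M L e i 6%N = 0) ->
    conformal (coeff4 1%:M L e) (coeff5 1%:M L e) ->
  purely_coclosed L phi0.
Proof.
move=> A6 C6 hAC.
have plane x y : L x y = inner 1%:M (L x y) (e 4) *: e 4 + inner 1%:M (L x y) (e 5) *: e 5.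
  rewrite {1}L_plane; congr (_ *: _ + _ *: _);
  by rewrite /inner mulmx1 trmx_delta -colE mxE.
have cA := coeff4_central 1%:M e4_central e5_central.
have cC := coeff5_central 1%:M e4_central e5_central.
split; first exact: is_G2_phi0.
  exists 1%:M, vol0; split; first exact: metric_phi0.
  apply/ffunP => I; rewrite [RHS]ffunE.
  have [cI|cI] := eqVneq #|I| 5; last by rewrite (form_ce_diff L form_hodge_phi0).
  rewrite -ext_eval_std (ce_diff_frame plane).
  have sI : sorted ltn (map val (enum I)).
    by rewrite sorted_pairwise ?pairwise_map ?pairwise_enum //; exact: ltn_trans.
  have s7 : all (fun i => i < 7)%N (map val (enum I)).
    by apply/allP => _ /mapP[i _ ->]; exact: (ltn_ord i).
  have : size (map val (enum I)) = 5 by rewrite size_map -cardE.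
  case: (map _ _) sI s7 => [|i [|j [|k [|l [|m [|]]]]]] //= /and5P[ij jk kl lm _] h7 _.
  pose psi s := ext_eval (hodge 1%:M vol0 phi0) (map e s).
  apply: (@coclosed_of_equations _ _ _ psi) => //.
    apply: hodge_std; [exact: form_phi0|exact: inner_product1|exact: form_vol0|
      exact: std_frame|exact: vol0_std|exact: phi0_std].
  by case/and5P: h7 => _ _ _ _ /andP[].
apply: top_form0.
  exact: (form_wedge (form_ce_diff L (form_phi0 R)) (form_phi0 R)).
rewrite (wedge_ce_diff_frame (form_phi0 R) plane).
rewrite (d_frame_phi_top (phi0_std R) cA cC).
by case: hAC => _ _ _ ->; ring.
Qed.

End StandardCoclosed.

(** * Ricci curvature when the brackets lie in a central plane *)

Section RicciPlane.
Variables (R : realType) (L : lieAlgebra R 7) (G : 'M[R]_7) (b : nat -> 'rV[R]_7).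
Hypothesis G_inner : inner_product G.
Hypothesis b_frame : forall i j : nat, (i < 7)%N -> (j < 7)%N ->
  inner G (b i) (b j) = (i == j)%:R.
Hypothesis L_plane : forall x y, L x y =
  inner G (L x y) (b 4) *: b 4 + inner G (L x y) (b 5) *: b 5.
Hypotheses (b4_central : forall x, L x (b 4) = 0) (b5_central : forall x, L x (b 5) = 0).
Implicit Types (x y z : 'rV[R]_7).

Lemma inner_plane x y z : inner G (L x y) z =
  inner G (L x y) (b 4) * inner G z (b 4) + inner G (L x y) (b 5) * inner G z (b 5).
Proof. by rewrite {1}L_plane innerDl !innerZl ![inner G (b _) z](innerC G_inner). Qed.

Lemma ricci_plane y z : inner G (ricci_endo L G y) z =
  - 2^-1 * (\sum_(i < 7) (inner G (L y (b i)) (b 4) * inner G (L z (b i)) (b 4)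
                        + inner G (L y (b i)) (b 5) * inner G (L z (b i)) (b 5)))
  + 4^-1 * (\sum_(i < 7) \sum_(k < 7)
     (coeff4 G L b i k * inner G y (b 4) + coeff5 G L b i k * inner G y (b 5)) *
     (coeff4 G L b i k * inner G z (b 4) + coeff5 G L b i k * inner G z (b 5))).
Proof.
rewrite (ricci_endoE G_inner b_frame).
- congr (_ * _ + _ * _); apply: eq_bigr => i _.
    by rewrite -(frame_parseval G_inner b_frame) inner_plane.
  by apply: eq_bigr => k _; rewrite (inner_plane _ _ y) (inner_plane _ _ z).
- move=> u v w; rewrite bracketC (L_plane u v) bracketDr !bracketZr b4_central b5_central.
  by rewrite !scaler0 addr0 oppr0.
move=> i i7; have [->|i4] := eqVneq i 4; first by left.
have [->|i5] := eqVneq i 5; first by left.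
by right=> u v; rewrite inner_plane !b_frame // (negPf i4) (negPf i5) !mulr0 addr0.
Qed.

End RicciPlane.

(** * The standard structure on the two algebras *)

Section Existence.
Variable R : realType.
Local Notation e := (std_basis R).
Implicit Types (x y z : 'rV[R]_7).

Lemma inner_std x (k : nat) : inner 1%:M x (e k) = x 0 (inord k).
Proof. by rewrite /inner mulmx1 trmx_delta -colE mxE. Qed.

Lemma std_basisE (i k : nat) : (i < 7)%N -> (k < 7)%N -> e i 0 (inord k) = (k == i)%:R.
Proof. by move=> i7 k7; rewrite mxE eqxx -val_eqE /= !inordK. Qed.

Lemma rowP7 x y : (forall k : nat, (k < 7)%N -> x 0 (inord k) = y 0 (inord k)) -> x = y.
Proof. by move=> h; apply/rowP => k; rewrite -(inord_val k) h. Qed.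

Lemma h3C_bracketE x y (k : nat) : (k < 7)%N -> h3C_R R x y 0 (inord k) =
  let c (z : 'rV[R]_7) (i : nat) := z 0 (inord i) in
  match k with
  | 4%N => (c x 1%N * c y 3%N - c x 3%N * c y 1%N) - (c x 0%N * c y 2%N - c x 2%N * c y 0%N)
  | 5%N => (c x 3%N * c y 0%N - c x 0%N * c y 3%N) - (c x 1%N * c y 2%N - c x 2%N * c y 1%N)
  | _ => 0
  end.
Proof.
move=> k7; rewrite mxE inordK //.
case: k k7 => [|[|[|[|[|[|[|//]]]]]]] _ /=;
rewrite ?(ext_eval2D, ext_eval2N, f2_eval, ext_eval0) /= ?oppr0 //; ring.
Qed.

Lemma n52_bracketE x y (k : nat) : (k < 7)%N -> n52_R2 R x y 0 (inord k) =
  let c (z : 'rV[R]_7) (i : nat) := z 0 (inord i) in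
  match k with
  | 4%N => c x 1%N * c y 0%N - c x 0%N * c y 1%N
  | 5%N => c x 2%N * c y 0%N - c x 0%N * c y 2%N
  | _ => 0
  end.
Proof.
move=> k7; rewrite mxE inordK //.
case: k k7 => [|[|[|[|[|[|[|//]]]]]]] _ /=;
rewrite ?(ext_eval2D, ext_eval2N, f2_eval, ext_eval0) /= ?oppr0 //; ring.
Qed.

Definition std_plane (L : lieAlgebra R 7) :=
  forall x y (k : nat), (k < 7)%N -> k != 4 -> k != 5 -> L x y 0 (inord k) = 0.

Section StandardPlane.
Variable L : lieAlgebra R 7.
Hypothesis L_std : std_plane L.
Hypotheses (e4_central : forall x, L x (e 4) = 0) (e5_central : forall x, L x (e 5) = 0).

Lemma std_planeE x y :
  L x y = L x y 0 (inord 4) *: e 4 + L x y 0 (inord 5) *: e 5.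
Proof.
apply: rowP7 => k k7; rewrite [RHS]mxE [X in _ = X + _]mxE [X in _ = _ + X]mxE !std_basisE //.
have [->|k4] := eqVneq k 4; first by rewrite mulr1 mulr0 addr0.
have [->|k5] := eqVneq k 5; first by rewrite mulr1 mulr0 add0r.
by rewrite L_std // !mulr0 addr0.
Qed.

Lemma std_plane_inner x y :
  L x y = inner 1%:M (L x y) (e 4) *: e 4 + inner 1%:M (L x y) (e 5) *: e 5.
Proof. by rewrite !inner_std -std_planeE. Qed.

(** The candidate derivation is diagonal with entries [d]. Its rule is required in coordinates 4 and
    5 only, because brackets have no others. *)
Lemma nilsoliton_std (lambda : R) (d : nat -> R) :
    (forall y (k : nat), (k < 7)%N ->
      - 2^-1 * (\sum_(i < 7) (L y (e i) 0 (inord 4) * L (e k) (e i) 0 (inord 4)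
                            + L y (e i) 0 (inord 5) * L (e k) (e i) 0 (inord 5)))
      + 4^-1 * (\sum_(i < 7) \sum_(j < 7)
         (L (e i) (e j) 0 (inord 4) * y 0 (inord 4) + L (e i) (e j) 0 (inord 5) * y 0 (inord 5)) *
         (L (e i) (e j) 0 (inord 4) * (k == 4)%:R + L (e i) (e j) 0 (inord 5) * (k == 5)%:R))
      = (lambda + d k) * y 0 (inord k)) ->
    (forall (D : 'rV[R]_7 -> 'rV[R]_7),
      (forall x (k : nat), (k < 7)%N -> D x 0 (inord k) = d k * x 0 (inord k)) ->
      forall x y, d 4 * L x y 0 (inord 4) = L (D x) y 0 (inord 4) + L x (D y) 0 (inord 4) /\
                  d 5 * L x y 0 (inord 5) = L (D x) y 0 (inord 5) + L x (D y) 0 (inord 5)) ->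
  is_nilsoliton L 1%:M.
Proof.
move=> ricE derE; split; first exact: inner_product1.
pose D : {linear 'rV[R]_7 -> 'rV[R]_7} := mulmxr (diag_mx (\row_k d k)).
have DE x (k : nat) : (k < 7)%N -> D x 0 (inord k) = d k * x 0 (inord k).
  by move=> k7; rewrite /D /= mul_mx_diag !mxE inordK // mulrC.
exists lambda, D; split=> [x y|x].
  have [h4 h5] := derE D DE x y.
  apply: rowP7 => k k7; rewrite DE // [RHS]mxE.
  have [->//|k4] := eqVneq k 4; have [->//|k5] := eqVneq k 5.
  by rewrite !L_std // mulr0 addr0.
apply: rowP7 => k k7; rewrite [RHS]mxE [X in X + _]mxE DE // -mulrDl -ricE //.
rewrite -inner_std (ricci_plane (inner_product1 R 7) (std_frame R)
  std_plane_inner e4_central e5_central).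
rewrite /coeff4 /coeff5; congr (_ * _ + _ * _); apply: eq_bigr => i _.
  by rewrite !inner_std.
by apply: eq_bigr => j _; rewrite !inner_std !std_basisE // ![_ == k]eq_sym.
Qed.

End StandardPlane.

Lemma h3C_std : std_plane (h3C_R R).
Proof. by move=> x y [|[|[|[|[|[|[|//]]]]]]] // _ _ _; rewrite h3C_bracketE. Qed.

Lemma n52_std : std_plane (n52_R2 R).
Proof. by move=> x y [|[|[|[|[|[|[|//]]]]]]] // _ _ _; rewrite n52_bracketE. Qed.

Lemma h3C_central (i : nat) x : (i == 4) || (i == 5) -> h3C_R R x (e i) = 0.
Proof.
move=> /orP[]/eqP -> ; apply: rowP7 => k k7; rewrite h3C_bracketE // [RHS]mxE;
case: k k7 => [|[|[|[|[|[|[|//]]]]]]] _ //=; rewrite !std_basisE //=; ring.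
Qed.

Lemma n52_central (i : nat) x : (i == 4) || (i == 5) -> n52_R2 R x (e i) = 0.
Proof.
move=> /orP[]/eqP -> ; apply: rowP7 => k k7; rewrite n52_bracketE // [RHS]mxE;
case: k k7 => [|[|[|[|[|[|[|//]]]]]]] _ //=; rewrite !std_basisE //=; ring.
Qed.

Lemma h3C_nilsoliton : is_nilsoliton (h3C_R R) 1%:M.
Proof.
(* Here Ric is diagonal with entries -1 (four times), 1, 1, 0. The derivation rule
   [2 * (-1 - lambda) = 1 - lambda] gives [lambda = -3]. *)
apply: (nilsoliton_std h3C_std _ _ (lambda := -3)
  (d := fun k => if (k < 4)%N then 2 else if (k < 6)%N then 4 else 3)).
- by move=> x; apply: h3C_central.
- by move=> x; apply: h3C_central.
- move=> y k k7.
  under eq_bigr => i _ do rewrite !h3C_bracketE //= !std_basisE //.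
  under [X in _ + _ * X]eq_bigr => i _ do
    under eq_bigr => j _ do rewrite !h3C_bracketE //= !std_basisE //.
  rewrite !big_ord_recl !big_ord0 /= /bump /= ?add1n.
  by case: k k7 => [|[|[|[|[|[|[|//]]]]]]] _ /=; field.
by move=> D DE x y; rewrite !h3C_bracketE //= !DE //; split=> /=; field.
Qed.

Lemma n52_nilsoliton : is_nilsoliton (n52_R2 R) 1%:M.
Proof.
(* Here Ric is diagonal with entries -1, -1/2, -1/2, 0, 1/2, 1/2, 0. The derivation rule [(-1 -
   lambda) + (-1/2 - lambda) = 1/2 - lambda] gives [lambda = -2]. *)
apply: (nilsoliton_std n52_std _ _ (lambda := -2)
  (d := fun k => nth 0 [:: 1; 3 / 2; 3 / 2; 2; 5 / 2; 5 / 2; 2] k)).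
- by move=> x; apply: n52_central.
- by move=> x; apply: n52_central.
- move=> y k k7.
  under eq_bigr => i _ do rewrite !n52_bracketE //= !std_basisE //.
  under [X in _ + _ * X]eq_bigr => i _ do
    under eq_bigr => j _ do rewrite !n52_bracketE //= !std_basisE //.
  rewrite !big_ord_recl !big_ord0 /= /bump /= ?add1n.
  by case: k k7 => [|[|[|[|[|[|[|//]]]]]]] _ /=; field.
by move=> D DE x y; rewrite !n52_bracketE //= !DE //; split=> /=; field.
Qed.

(** Both 2-forms have zero components [01 - 23], [02 + 13] and [03 - 12], which is the case
    [p = q = 0] of the equations. *)
Lemma h3C_purely_coclosed : purely_coclosed (h3C_R R) (phi0 R).
Proof.
apply: purely_coclosed_phi0.
- exact: (std_planeE h3C_std).
- by move=> x; apply: h3C_central.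
- by move=> x; apply: h3C_central.
- move=> i i4; rewrite /coeff4 inner_std h3C_bracketE //= !std_basisE // ?(ltn_trans i4) //=.
  by case: i i4 => [|[|[|[|//]]]] _ /=; ring.
- move=> i i4; rewrite /coeff5 inner_std h3C_bracketE //= !std_basisE // ?(ltn_trans i4) //=.
  by case: i i4 => [|[|[|[|//]]]] _ /=; ring.
by split; rewrite /coeff4 /coeff5 !inner_std !h3C_bracketE //= !std_basisE //=; ring.
Qed.

(** The only nonzero entries in increasing order are [A 0 1 = -1] and [C 0 2 = -1], which is the
    case [p = -1], [q = 0] of the equations. *)
Lemma n52_purely_coclosed : purely_coclosed (n52_R2 R) (phi0 R).
Proof.
apply: purely_coclosed_phi0.
- exact: (std_planeE n52_std).
- by move=> x; apply: n52_central.
- by move=> x; apply: n52_central.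
- move=> i i4; rewrite /coeff4 inner_std n52_bracketE //= !std_basisE // ?(ltn_trans i4) //=.
  by case: i i4 => [|[|[|[|//]]]] _ /=; ring.
- move=> i i4; rewrite /coeff5 inner_std n52_bracketE //= !std_basisE // ?(ltn_trans i4) //=.
  by case: i i4 => [|[|[|[|//]]]] _ /=; ring.
by split; rewrite /coeff4 /coeff5 !inner_std !n52_bracketE //= !std_basisE //=; ring.
Qed.

End Existence.

(** * Non-existence *)

Section SolitonAlgebra.
Variables (R : realFieldType) (A C : nat -> nat -> R).

(* The polarized Pfaffian of the upper left 4 x 4 blocks, normalized by pf2 A A = 2 Pf A. *)
Definition pf2 (A C : nat -> nat -> R) : R :=
  A 0%N 1%N * C 2%N 3%N + A 2%N 3%N * C 0%N 1%N - A 0%N 2%N * C 1%N 3%N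
  - A 1%N 3%N * C 0%N 2%N + A 0%N 3%N * C 1%N 2%N + A 1%N 2%N * C 0%N 3%N.

Definition dot2 (A C : nat -> nat -> R) : R := 2^-1 * \sum_(i < 4) \sum_(j < 4) A i j * C i j.

Hypotheses (A_anti : forall i j, A j i = - A i j) (C_anti : forall i j, C j i = - C i j).
Hypothesis AC_conformal : conformal A C.

Let diag0 (B : nat -> nat -> R) (h : forall i j, B j i = - B i j) i : B i i = 0.
Proof. by have := h i i; lra. Qed.

Let sum4 (f : 'I_4 -> R) : \sum_k f k =
  f (@Ordinal 4 0 isT) + f (@Ordinal 4 1 isT) + f (@Ordinal 4 2 isT) + f (@Ordinal 4 3 isT).
Proof.
rewrite !big_ord_recr big_ord0 /= add0r.
by congr (f _ + f _ + f _ + f _); apply: val_inj.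
Qed.

Let antiE (B : nat -> nat -> R) (h : forall i j, B j i = - B i j) :
  [/\ forall i, B i i = 0,
      [/\ (B 1 0 = - B 0 1)%N, (B 2 0 = - B 0 2)%N & (B 3 0 = - B 0 3)%N] &
      [/\ (B 2 1 = - B 1 2)%N, (B 3 1 = - B 1 3)%N & (B 3 2 = - B 2 3)%N]].
Proof. by split=> //; apply: diag0. Qed.

(** The difference of the two sides is the scalar product of the components of one duality type,
    here [(p, q, 0)] and [(-q, p, 0)], which are orthogonal. *)
Lemma conformal_dot2 : dot2 A C = pf2 A C.
Proof.
case: AC_conformal => h1 h2 h3 h4; rewrite /dot2 /pf2 !sum4 /=.
have [A_diag [-> -> ->] [-> -> ->]] := antiE A_anti; rewrite !A_diag.
have [C_diag [-> -> ->] [-> -> ->]] := antiE C_anti; rewrite !C_diag.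
by rewrite -h1 -h2 -h3 h4; field.
Qed.

Variable lambda : R.
Let Ric i k := - 2^-1 * \sum_(l < 4) (A i l * A k l + C i l * C k l).
Hypothesis A_deriv : forall i j : nat, (i < 4)%N -> (j < 4)%N ->
  (2^-1 * dot2 A A + lambda) * A i j = \sum_(k < 4) (Ric i k * A k j + Ric j k * A i k).
Hypothesis C_deriv : forall i j : nat, (i < 4)%N -> (j < 4)%N ->
  (2^-1 * dot2 C C + lambda) * C i j = \sum_(k < 4) (Ric i k * C k j + Ric j k * C i k).

(** In the notation of the proof, with [s = p ^+ 2 + q ^+ 2] and [m = |d|^2], the Pfaffian
    hypotheses say [|c|^2 = s], [c . d = 0] and [m != s]. Modulo these, the derivation equations
    become scalar factors times [p], [q] or [d]. If [s] were nonzero, the factors of [p] and [q]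
    would vanish; comparison with the factor of [d] gives [(s - m) * m = 0], so [m = 0], and then
    the factors for [A] and [C] differ by [3 * s / 4]. With [s = 0] also [c = 0]. *)
Lemma soliton_conformal_pf2 : pf2 A A = 0 -> pf2 A C = 0 -> pf2 C C != 0 ->
  forall i j : nat, (i < 4)%N -> (j < 4)%N -> A i j = 0.
Proof.
move=> pAA pAC pCC.
(* Components of one duality are (p, q, 0) for [A] and (-q, p, 0) for [C]; those of the other
   one are c and d. Then [pf2] is half the difference of the products of the components. *)
pose p := A 0%N 1%N - A 2%N 3%N; pose q := A 0%N 2%N + A 1%N 3%N.
pose c1 := A 0%N 1%N + A 2%N 3%N; pose c2 := A 0%N 2%N - A 1%N 3%N.
pose c3 := A 0%N 3%N + A 1%N 2%N.
pose d1 := C 0%N 1%N + C 2%N 3%N; pose d2 := C 0%N 2%N - C 1%N 3%N.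
pose d3 := C 0%N 3%N + C 1%N 2%N.
case: AC_conformal => h1 h2 h3 h4.
have [A_diag [A10 A20 A30] [A21 A31 A32]] := antiE A_anti.
have [C_diag [C10 C20 C30] [C21 C31 C32]] := antiE C_anti.
have A01 : A 0%N 1%N = (p + c1) / 2 by rewrite /p /c1; field.
have A23 : A 2%N 3%N = (c1 - p) / 2 by rewrite /p /c1; field.
have A02 : A 0%N 2%N = (q + c2) / 2 by rewrite /q /c2; field.
have A13 : A 1%N 3%N = (q - c2) / 2 by rewrite /q /c2; field.
have A03 : A 0%N 3%N = c3 / 2 by rewrite /c3 h2; field.
have A12 : A 1%N 2%N = c3 / 2 by rewrite /c3 h2; field.
have C01 : C 0%N 1%N = (d1 - q) / 2 by rewrite /q /d1 -h3; field.
have C23 : C 2%N 3%N = (d1 + q) / 2 by rewrite /q /d1 -h3; field.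
have C02 : C 0%N 2%N = (d2 + p) / 2 by rewrite /p /d2 h4; field.
have C13 : C 1%N 3%N = (p - d2) / 2 by rewrite /p /d2 h4; field.
have C03 : C 0%N 3%N = d3 / 2 by rewrite /d3 h1; field.
have C12 : C 1%N 2%N = d3 / 2 by rewrite /d3 h1; field.
move: p q c1 c2 c3 d1 d2 d3 A01 A23 A02 A13 A03 A12 C01 C23 C02 C13 C03 C12
  => p q c1 c2 c3 d1 d2 d3 A01 A23 A02 A13 A03 A12 C01 C23 C02 C13 C03 C12.
pose s := p ^+ 2 + q ^+ 2; pose m := d1 ^+ 2 + d2 ^+ 2 + d3 ^+ 2.
have cc : c1 ^+ 2 + c2 ^+ 2 + c3 ^+ 2 = s.
  by move: pAA; rewrite /pf2 A01 A23 A02 A13 A03 A12 /s; lra.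
have cd : c1 * d1 + c2 * d2 + c3 * d3 = 0.
  by move: pAC; rewrite /pf2 A01 A23 A02 A13 A03 A12 C01 C23 C02 C13 C03 C12; lra.
have ms : m != s.
  apply: contra_neq pCC; rewrite /pf2 C01 C23 C02 C13 C03 C12 /m /s => ms; lra.
have dAA : dot2 A A = s.
  rewrite /dot2 !sum4 /= !A_diag A10 A20 A30 A21 A31 A32 A01 A23 A02 A13 A03 A12.
  by move: cc; rewrite /s; lra.
have dCC : dot2 C C = (s + m) / 2.
  rewrite /dot2 !sum4 /= !C_diag C10 C20 C30 C21 C31 C32 C01 C23 C02 C13 C03 C12.
  by rewrite /s /m; field.
have DA := A_deriv; have DC := C_deriv; rewrite dAA in DA; rewrite dCC in DC.
have RicE i k : Ric i k = - 2^-1 *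
    (A i 0%N * A k 0%N + C i 0%N * C k 0%N + (A i 1%N * A k 1%N + C i 1%N * C k 1%N)
    + (A i 2%N * A k 2%N + C i 2%N * C k 2%N) + (A i 3%N * A k 3%N + C i 3%N * C k 3%N)).
  by rewrite /Ric sum4.
have entries := (A_diag, (A10, A20, A30, A21, A31, A32),
  C_diag, (C10, C20, C30, C21, C31, C32),
  (A01, A23, A02, A13, A03, A12), (C01, C23, C02, C13, C03, C12)).
pose X := 2^-1 * s + lambda; pose Y := 2^-1 * ((s + m) / 2) + lambda.
(* [lra] is linear in monomials, so the quadratic relations are supplied already multiplied by the
   factor with which they enter the cubic equations. *)
have cc_ (u : R) : (c1 ^+ 2 + c2 ^+ 2 + c3 ^+ 2) * u = s * u by rewrite cc.
have cd_ (u : R) : (c1 * d1 + c2 * d2 + c3 * d3) * u = 0 by rewrite cd mul0r.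
have Ep : (X + (5 * s + m) / 4) * p = 0.
  have E01 := DA 0%N 1%N isT isT; have E23 := DA 2%N 3%N isT isT.
  rewrite !sum4 /= !RicE !entries in E01 E23.
  by move: (cc_ p) (cd_ q) (cd_ p) E01 E23; rewrite /X /s /m; lra.
have Eq : (X + (5 * s + m) / 4) * q = 0.
  have E02 := DA 0%N 2%N isT isT; have E13 := DA 1%N 3%N isT isT.
  rewrite !sum4 /= !RicE !entries in E02 E13.
  by move: (cc_ q) (cd_ q) (cd_ p) E02 E13; rewrite /X /s /m; lra.
have Fp : (Y + 3 * (s + m) / 4) * p = 0.
  have F02 := DC 0%N 2%N isT isT; have F13 := DC 1%N 3%N isT isT.
  rewrite !sum4 /= !RicE !entries in F02 F13.
  by move: (cc_ p) (cd_ q) (cd_ p) F02 F13; rewrite /Y /s /m; lra.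
have Fq : (Y + 3 * (s + m) / 4) * q = 0.
  have F01 := DC 0%N 1%N isT isT; have F23 := DC 2%N 3%N isT isT.
  rewrite !sum4 /= !RicE !entries in F01 F23.
  by move: (cc_ q) (cd_ q) (cd_ p) F01 F23; rewrite /Y /s /m; lra.
have Fd1 : (Y + (5 * s + m) / 4) * d1 = 0.
  have F01 := DC 0%N 1%N isT isT; have F23 := DC 2%N 3%N isT isT.
  rewrite !sum4 /= !RicE !entries in F01 F23.
  by move: (cc_ d1) (cd_ c1) F01 F23; rewrite /Y /s /m; lra.
have Fd2 : (Y + (5 * s + m) / 4) * d2 = 0.
  have F02 := DC 0%N 2%N isT isT; have F13 := DC 1%N 3%N isT isT.
  rewrite !sum4 /= !RicE !entries in F02 F13.
  by move: (cc_ d2) (cd_ c2) F02 F13; rewrite /Y /s /m; lra.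
have Fd3 : (Y + (5 * s + m) / 4) * d3 = 0.
  have F03 := DC 0%N 3%N isT isT; have F12 := DC 1%N 2%N isT isT.
  rewrite !sum4 /= !RicE !entries in F03 F12.
  by move: (cc_ d3) (cd_ c3) F03 F12; rewrite /Y /s /m; lra.
have s0 : s = 0.
  apply/eqP/negPn/negP => s0.
  have Xs : X + (5 * s + m) / 4 = 0.
    apply: (mulIf s0); rewrite mul0r.
    transitivity ((X + (5 * s + m) / 4) * p * p + (X + (5 * s + m) / 4) * q * q).
      by move: (X + _) => z; rewrite /s; ring.
    by rewrite Ep Eq; ring.
  have Ys : Y + 3 * (s + m) / 4 = 0.
    apply: (mulIf s0); rewrite mul0r.
    transitivity ((Y + 3 * (s + m) / 4) * p * p + (Y + 3 * (s + m) / 4) * q * q).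
      by move: (Y + _) => z; rewrite /s; ring.
    by rewrite Fp Fq; ring.
  have Ym : (Y + (5 * s + m) / 4) * m = 0.
    transitivity ((Y + (5 * s + m) / 4) * d1 * d1 + (Y + (5 * s + m) / 4) * d2 * d2
      + (Y + (5 * s + m) / 4) * d3 * d3); last by rewrite Fd1 Fd2 Fd3; ring.
    by move: (Y + _) => z; rewrite /m; ring.
  have : (s - m) * m = 0.
    have YE : Y + (5 * s + m) / 4 = (s - m) / 2 by move: Ys; lra.
    by rewrite -[RHS](mulr0 2) -Ym YE; field.
  move/eqP; rewrite mulf_eq0 subr_eq0 eq_sym (negPf ms) /= => /eqP m0.
  (* The difference of the two vanishing factors is [3 / 4 * (s - m)]. *)
  have sE : s = 4 / 3 * ((X + (5 * s + m) / 4) - (Y + 3 * (s + m) / 4)) + m.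
    by rewrite /X /Y; field.
  by move: s0; rewrite sE Xs Ys m0 subrr mulr0 addr0 eqxx.
have [p0 q0] : p = 0 /\ q = 0.
  move/eqP: s0; rewrite /s paddr_eq0 ?sqr_ge0 // !sqrf_eq0 => /andP[/eqP-> /eqP->].
  by [].
have [c10 c20 c30] : [/\ c1 = 0, c2 = 0 & c3 = 0].
  move/eqP: cc; rewrite s0 !paddr_eq0 ?addr_ge0 ?sqr_ge0 // !sqrf_eq0.
  by move=> /andP[/andP[/eqP-> /eqP->] /eqP->].
have A0 : [/\ A 0%N 1%N = 0, A 2%N 3%N = 0 & A 0%N 2%N = 0] /\
    [/\ A 1%N 3%N = 0, A 0%N 3%N = 0 & A 1%N 2%N = 0].
  rewrite A01 A23 A02 A13 A03 A12 p0 q0 c10 c20 c30; split; split; ring.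
case: A0 => -[a01 a23 a02] [a13 a03 a12].
move=> [|[|[|[|//]]]] [|[|[|[|//]]]] _ _; rewrite ?A_diag //.
all: by rewrite A_anti ?a01 ?a23 ?a02 ?a13 ?a03 ?a12 oppr0.
Qed.

End SolitonAlgebra.

(** * The soliton equation in an adapted frame *)

Section FrameSoliton.
Variables (R : realType) (L : lieAlgebra R 7) (G : 'M[R]_7) (b : nat -> 'rV[R]_7).
Hypothesis G_inner : inner_product G.
Hypothesis b_frame : forall i j : nat, (i < 7)%N -> (j < 7)%N ->
  inner G (b i) (b j) = (i == j)%:R.
Hypothesis L_plane : forall x y, L x y =
  inner G (L x y) (b 4) *: b 4 + inner G (L x y) (b 5) *: b 5.
Hypotheses (b4_central : forall x, L x (b 4) = 0) (b5_central : forall x, L x (b 5) = 0).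
Local Notation A := (coeff4 G L b).
Local Notation C := (coeff5 G L b).
Hypotheses (A6 : forall i, (i < 4)%N -> A i 6%N = 0) (C6 : forall i, (i < 4)%N -> C i 6%N = 0).
Implicit Types (x y z : 'rV[R]_7).

Lemma sum7_4 (f : nat -> R) : f 4%N = 0 -> f 5%N = 0 -> f 6%N = 0 ->
  \sum_(i < 7) f i = \sum_(i < 4) f i.
Proof. by move=> h4 h5 h6; rewrite 3!big_ord_recr /= h4 h5 h6 !addr0. Qed.

Lemma coeff4C i j : A j i = - A i j.
Proof. by rewrite /coeff4 bracketC innerNl. Qed.

Lemma coeff5C i j : C j i = - C i j.
Proof. by rewrite /coeff5 bracketC innerNl. Qed.

Lemma coeff4_high i k : (i < 7)%N -> k \in [:: 4; 5; 6]%N -> A i k = 0.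
Proof.
rewrite !inE => i7 /or3P[] /eqP ->; first by rewrite /coeff4 b4_central inner0l.
  by rewrite /coeff4 b5_central inner0l.
case: i i7 => [|[|[|[|[|[|[|//]]]]]]] _; try exact: A6; rewrite coeff4C /coeff4.
- by rewrite b4_central inner0l oppr0.
- by rewrite b5_central inner0l oppr0.
by rewrite bracket_alt inner0l oppr0.
Qed.

Lemma coeff5_high i k : (i < 7)%N -> k \in [:: 4; 5; 6]%N -> C i k = 0.
Proof.
rewrite !inE => i7 /or3P[] /eqP ->; first by rewrite /coeff5 b4_central inner0l.
  by rewrite /coeff5 b5_central inner0l.
case: i i7 => [|[|[|[|[|[|[|//]]]]]]] _; try exact: C6; rewrite coeff5C /coeff5.
- by rewrite b4_central inner0l oppr0.
- by rewrite b5_central inner0l oppr0.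
by rewrite bracket_alt inner0l oppr0.
Qed.

Let high4l i k : (i < 7)%N -> k \in [:: 4; 5; 6]%N -> A k i = 0.
Proof. by move=> i7 hk; rewrite coeff4C coeff4_high ?oppr0. Qed.

Let high5l i k : (i < 7)%N -> k \in [:: 4; 5; 6]%N -> C k i = 0.
Proof. by move=> i7 hk; rewrite coeff5C coeff5_high ?oppr0. Qed.

Lemma b6_central x : L x (b 6) = 0.
Proof.
rewrite (frame_sum b_frame x).
rewrite (big_morph (L^~ (b 6)) (fun x y => bracketDl L x y (b 6)) (bracket0l L (b 6))).
rewrite big1 // => i _; rewrite bracketZl L_plane -/(A i 6) -/(C i 6).
by rewrite coeff4_high // coeff5_high // !scale0r addr0 scaler0.
Qed.

(** Convertible to [coeff4] and [coeff5] at [c = 4] and [c = 5], so that [soliton_deriv] covers both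
    components. *)
Definition coeff (c : nat) i j := inner G (L (b i) (b j)) (b c).

Let plane_sum (u u' v v' : R) :
  \sum_(i < 7) \sum_(k < 7) (A i k * u + C i k * v) * (A i k * u' + C i k * v') =
  2 * (u * u' * dot2 A A + (u * v' + v * u') * dot2 A C + v * v' * dot2 C C).
Proof.
pose f (i k : nat) := (A i k * u + C i k * v) * (A i k * u' + C i k * v').
have inner_sum (i : nat) : (i < 7)%N -> \sum_(k < 7) f i k = \sum_(k < 4) f i k.
  move=> i7; rewrite (@sum7_4 (f i)) //;
    by rewrite /f coeff4_high // coeff5_high // !mul0r addr0 mul0r.
under eq_bigr do rewrite -/(f _ _) inner_sum //.
have row0 i : i \in [:: 4; 5; 6]%N -> \sum_(k < 4) f i k = 0.
  move=> hi; rewrite big1 // => k _.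
  by rewrite /f high4l ?high5l ?(ltn_trans (ltn_ord k)) // !mul0r addr0 mul0r.
rewrite (@sum7_4 (fun i => \sum_(k < 4) f i k)) ?row0 //.
by rewrite /f /dot2 !big_ord_recl !big_ord0 /=; field.
Qed.

Lemma ricci_center p q : p \in [:: 4; 5]%N -> inner G (ricci_endo L G (b p)) (b q) =
  2^-1 * ((p == 4)%:R * inner G (b q) (b 4) * dot2 A A
   + ((p == 4)%:R * inner G (b q) (b 5) + (p == 5)%:R * inner G (b q) (b 4)) * dot2 A C
   + (p == 5)%:R * inner G (b q) (b 5) * dot2 C C).
Proof.
move=> hp; have p7 : (p < 7)%N by move: hp; rewrite !inE => /orP[] /eqP ->.
have cp x : L (b p) x = 0.
  by rewrite bracketC; move: hp; rewrite !inE => /orP[] /eqP ->;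
    rewrite ?b4_central ?b5_central oppr0.
rewrite (ricci_plane G_inner b_frame L_plane b4_central b5_central).
rewrite big1 => [|i _]; last by rewrite cp !inner0l !mul0r addr0.
by rewrite plane_sum (b_frame p7 (isT : 4 < 7)%N) (b_frame p7 (isT : 5 < 7)%N); field.
Qed.

Lemma ricci_horizontal i k : (i < 4)%N -> (k < 4)%N ->
  inner G (ricci_endo L G (b i)) (b k) =
  - 2^-1 * \sum_(l < 4) (A i l * A k l + C i l * C k l).
Proof.
move=> i4 k4; have i7 := ltn_trans i4 (isT : 4 < 7)%N; have k7 := ltn_trans k4 (isT : 4 < 7)%N.
rewrite (ricci_plane G_inner b_frame L_plane b4_central b5_central) plane_sum.
have ne p : (p < 4)%N -> (p == 4)%N = false /\ (p == 5)%N = false.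
  by case: p => [|[|[|[|]]]].
have [i4F i5F] := ne _ i4; have [k4F k5F] := ne _ k4.
rewrite !(b_frame i7) // !(b_frame k7) // i4F i5F k4F k5F.
rewrite -(@sum7_4 (fun l => A i l * A k l + C i l * C k l)); first last.
- by rewrite !coeff4_high ?coeff5_high // !mul0r addr0.
- by rewrite !coeff4_high ?coeff5_high // !mul0r addr0.
- by rewrite !coeff4_high ?coeff5_high // !mul0r addr0.
by rewrite /coeff4 /coeff5 /= !(mul0r, mulr0, addr0).
Qed.

Variables (lambda : R) (D : {linear 'rV[R]_7 -> 'rV[R]_7}).
Hypothesis D_derivation : is_derivation L D.
Hypothesis D_ricci : forall x, ricci_endo L G x = lambda *: x + D x.

(** This is the [b c] component of the derivation rule for [D = Ric - lambda]. As [dot2 A C = 0],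
    Ric does not mix [b 4] and [b 5], so only one component occurs on the left. The value of [D] on
    the bracket contributes [- lambda] and its two arguments [2 * lambda], whence [+ lambda]. *)
Lemma soliton_deriv c : c \in [:: 4; 5]%N -> dot2 A C = 0 ->
  forall i j : nat, (i < 4)%N -> (j < 4)%N ->
  (2^-1 * dot2 (coeff c) (coeff c) + lambda) * coeff c i j =
  \sum_(k < 4) ((- 2^-1 * \sum_(l < 4) (A i l * A k l + C i l * C k l)) * coeff c k j +
                (- 2^-1 * \sum_(l < 4) (A j l * A k l + C j l * C k l)) * coeff c i k).
Proof.
move=> hc dAC i j i4 j4.
have c7 : (c < 7)%N by move: hc; rewrite !inE => /orP[] /eqP ->.
have i7 := ltn_trans i4 (isT : 4 < 7)%N; have j7 := ltn_trans j4 (isT : 4 < 7)%N.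
have DE x z : inner G (D x) z = inner G (ricci_endo L G x) z - lambda * inner G x z.
  by rewrite D_ricci innerDl innerZl; ring.
have high p q : (p < 7)%N -> q \in [:: 4; 5; 6]%N -> coeff c q p = 0.
  by move=> p7 hq; move: hc; rewrite !inE => /orP[] /eqP ->; [apply: high4l|apply: high5l].
have coeffN p q : coeff c p q = - coeff c q p by rewrite /coeff bracketC innerNl.
have lhs : inner G (D (L (b i) (b j))) (b c) =
    (2^-1 * dot2 (coeff c) (coeff c) - lambda) * coeff c i j.
  rewrite {1}L_plane linearD !linearZ innerDl !innerZl !DE !ricci_center // dAC.
  move: hc; rewrite !inE => /orP[] /eqP E; rewrite /coeff E !b_frame //=; ring.
have half p q : (p < 4)%N -> (q < 7)%N -> inner G (L (D (b p)) (b q)) (b c) =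
    \sum_(k < 4) (- 2^-1 * \sum_(l < 4) (A p l * A k l + C p l * C k l)) * coeff c k q
      - lambda * coeff c p q.
  move=> p4 q7; have p7 := ltn_trans p4 (isT : 4 < 7)%N.
  rewrite (frame_sum b_frame (D (b p))).
  rewrite (big_morph (L^~ (b q)) (fun x y => bracketDl L x y (b q)) (bracket0l L (b q))).
  rewrite inner_suml.
  under eq_bigr do rewrite bracketZl innerZl -/(coeff c _ q).
  rewrite (@sum7_4 (fun k => inner G (D (b p)) (b k) * coeff c k q));
    try by rewrite high // mulr0.
  transitivity (\sum_(k < 4)
    ((- 2^-1 * \sum_(l < 4) (A p l * A k l + C p l * C k l)) * coeff c k q
      - lambda * ((p == k)%:R * coeff c k q))).
    apply: eq_bigr => k _; rewrite DE ricci_horizontal // b_frame ?(ltn_trans (ltn_ord k)) //.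
    by ring.
  rewrite sumrB; congr (_ - _).
  rewrite (bigD1 (Ordinal p4)) //= eqxx mul1r big1 ?addr0 // => k kp.
  by rewrite eq_sym -[p]/(val (Ordinal p4)) val_eqE (negPf kp) mul0r mulr0.
have := congr1 (fun x => inner G x (b c)) (D_derivation (b i) (b j)).
rewrite /= lhs innerDl half // (bracketC L (b i)) innerNl half // => h.
rewrite big_split /=.
have -> : \sum_(k < 4) (- 2^-1 * \sum_(l < 4) (A j l * A k l + C j l * C k l)) * coeff c i k =
    - \sum_(k < 4) (- 2^-1 * \sum_(l < 4) (A j l * A k l + C j l * C k l)) * coeff c k i.
  by rewrite -sumrN; apply: eq_bigr => k _; rewrite (coeffN i k) mulrN.
move: h; rewrite (coeffN j i); lra.
Qed.

End FrameSoliton.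

Lemma det_nat_fun (R : comNzRingType) (n : nat) (m : nat -> nat -> R) :
  \det (\matrix_(i < n.+1, j < n.+1) m i j) =
  \sum_(j < n.+1) (-1) ^+ j * m 0%N j * \det (\matrix_(i < n, k < n) m i.+1 (bump j k)).
Proof.
rewrite (expand_det_row _ ord0); apply: eq_bigr => j _; rewrite mxE /cofactor add0n.
by rewrite mulrCA mulrA; congr (_ * \det _); apply/matrixP => i k; rewrite !mxE.
Qed.

(** Laplace expansion along the first two columns. [F] and [H] are then 2-forms evaluated on rows,
    so the polarized Pfaffians of brackets turn into determinants. *)
Lemma det4 (R : comNzRingType) (m : nat -> nat -> R) :
  \det (\matrix_(i < 4, j < 4) m i j) =
    let F i j := m i 0%N * m j 1%N - m i 1%N * m j 0%N in
    let H i j := m i 2%N * m j 3%N - m i 3%N * m j 2%N in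
    F 0%N 1%N * H 2%N 3%N - F 0%N 2%N * H 1%N 3%N + F 0%N 3%N * H 1%N 2%N
    + F 1%N 2%N * H 0%N 3%N - F 1%N 3%N * H 0%N 2%N + F 2%N 3%N * H 0%N 1%N.
Proof.
rewrite det_nat_fun !big_ord_recl big_ord0 /=.
rewrite !(@det_nat_fun R 2 (fun i j => m i.+1 (bump _ j))).
rewrite !big_ord_recl !big_ord0 /=.
rewrite !(@det_nat_fun R 1 (fun i j => m i.+2 (bump _ (bump _ j)))).
rewrite !big_ord_recl !big_ord0 /= !det_mx11 !mxE /= /bump /=; ring.
Qed.

(** * Frames adapted to the plane of [e 4] and [e 5] *)

Section Obstruction.
Variables (R : realType) (L : lieAlgebra R 7) (G : 'M[R]_7).
Local Notation e := (std_basis R).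
Local Notation c x i := (x 0 (inord i)).
Implicit Types (x y z : 'rV[R]_7).
Hypothesis G_inner : inner_product G.

Lemma plane_frame : exists (z1 z2 : 'rV[R]_7) (x y s : R),
  [/\ inner G z1 z1 = 1, inner G z2 z2 = 1 & inner G z1 z2 = 0] /\
  [/\ e 4 = x *: z1 + y *: z2, e 5 = s *: z2, x != 0 & s != 0].
Proof.
have normalize (v : 'rV[R]_7) : v != 0 ->
    exists (k : R) u, [/\ inner G u u = 1, v = k *: u & k != 0].
  move=> v0; have q0 := inner_gt0 G_inner v0.
  have k0 : Num.sqrt (inner G v v) != 0 by rewrite gt_eqF // sqrtr_gt0.
  exists (Num.sqrt (inner G v v)), ((Num.sqrt (inner G v v))^-1 *: v); split=> //.
    rewrite innerZl innerZr // mulrA -invfM -expr2 sqr_sqrtr ?ltW //.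
    by rewrite mulVf // gt_eqF.
  by rewrite scalerA divff // scale1r.
have e0 (i : nat) : (i < 7)%N -> e i != 0.
  move=> i7; apply/eqP => /(congr1 (fun v : 'rV[R]_7 => v 0 (inord i))).
  by rewrite std_basisE // eqxx mxE => /eqP; rewrite oner_eq0.
have [s [z2 [z2n e5 s0]]] := normalize _ (e0 5%N isT).
pose w := e 4 - inner G (e 4) z2 *: z2.
have w0 : w != 0.
  apply/eqP => /(congr1 (fun v : 'rV[R]_7 => v 0 (inord 4))).
  have z24 : z2 0 (inord 4) = 0.
    have := congr1 (fun v : 'rV[R]_7 => v 0 (inord 4)) e5.
    by rewrite std_basisE // mxE => /esym/eqP; rewrite mulf_eq0 (negPf s0) => /eqP.
  rewrite !mxE z24 mulr0 subr0 => /eqP.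
  by rewrite !eqxx oner_eq0.
have [x [z1 [z1n wE x0]]] := normalize _ w0.
have wz2 : inner G w z2 = 0 by rewrite innerDl innerNl innerZl z2n mulr1 subrr.
exists z1, z2, x, (inner G (e 4) z2), s; split; split=> //.
  by move/eqP: wz2; rewrite wE innerZl mulf_eq0 (negPf x0) => /eqP.
by rewrite -wE subrK.
Qed.

(** Both obstructed algebras have [df^4 = f^01], written [F] below; they differ only in [H], which
    is [df^5]. *)
Variable H : 'rV[R]_7 -> 'rV[R]_7 -> R.
Local Notation F x y := (c x 0 * c y 1 - c x 1 * c y 0).
Hypothesis LE : forall x y, L x y = - F x y *: e 4 - H x y *: e 5.

Variables (b : nat -> 'rV[R]_7) (x0 y0 s0 : R).
Hypothesis b_frame : forall i j : nat, (i < 7)%N -> (j < 7)%N ->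
  inner G (b i) (b j) = (i == j)%:R.
Hypotheses (e4E : e 4 = x0 *: b 4 + y0 *: b 5) (e5E : e 5 = s0 *: b 5).
Hypotheses (x0_neq0 : x0 != 0) (s0_neq0 : s0 != 0).

Lemma bracket_b4 x y : inner G (L x y) (b 4) = - x0 * F x y.
Proof.
rewrite LE e4E e5E innerDl innerNl !innerZl innerDl !innerZl !b_frame //=; ring.
Qed.

Lemma bracket_b5 x y : inner G (L x y) (b 5) = - (y0 * F x y + s0 * H x y).
Proof.
rewrite LE e4E e5E innerDl innerNl !innerZl innerDl !innerZl !b_frame //=; ring.
Qed.

Lemma bracket_plane x y : L x y =
  inner G (L x y) (b 4) *: b 4 + inner G (L x y) (b 5) *: b 5.
Proof.
rewrite bracket_b4 bracket_b5 LE e4E e5E scalerDr !scalerA -addrA -scaleNr -scalerDl.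
by congr (_ *: _ + _ *: _); ring.
Qed.

Lemma b5E : b 5 = s0^-1 *: e 5.
Proof. by rewrite e5E scalerA mulVf // scale1r. Qed.

Lemma b4E : b 4 = x0^-1 *: e 4 - (x0^-1 * y0 * s0^-1) *: e 5.
Proof.
rewrite e4E e5E scalerDr !scalerA mulVf // scale1r.
by rewrite -(mulrA _ _ s0) mulVf // mulr1 addrK.
Qed.

Hypothesis b6_low : forall j : nat, (j < 4)%N -> c (b 6) j = 0.

(** The first four coordinates of [b 4], [b 5] and [b 6] vanish, so the invertible matrix of the
    frame is block triangular and this determinant is one of its two factors. *)
Lemma frame_det4 : \det (\matrix_(i < 4, j < 4) c (b i) j) != 0.
Proof.
pose P : 'M[R]_(4 + 3) := \matrix_(i < 7) b i.
have dP : \det P != 0.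
  have := congr1 determinant (frame_mx b_frame); rewrite !det_mulmx det1 => h.
  by apply/eqP => p0; move: h; rewrite -/P p0 !mul0r => /eqP; rewrite eq_sym oner_eq0.
have low (i j : nat) : (3 < i < 7)%N -> (j < 4)%N -> c (b i) j = 0.
  move=> hi j4; have j7 := ltn_trans j4 (isT : 4 < 7)%N.
  have [j4F j5F] : (j == 4)%N = false /\ (j == 5)%N = false.
    by move: j j4 {j7} => [|[|[|[|]]]].
  move: i hi => [|[|[|[|[|[|[|//]]]]]]] // _; last exact: b6_low.
  - rewrite b4E mxE [X in X + _]mxE [X in _ + X]mxE [X in _ - X]mxE !std_basisE //.
    by rewrite j4F j5F !mulr0 subr0.
  - by rewrite b5E mxE std_basisE // j5F mulr0.
have := dP; rewrite -(submxK P) (_ : dlsubmx P = 0).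
  rewrite det_ublock mulf_eq0 negb_or => /andP[+ _].
  rewrite (_ : ulsubmx P = \matrix_(i < 4, j < 4) c (b i) j) //.
  apply/matrixP => i j; rewrite !mxE /=; congr (b _ _ _).
  by apply: val_inj; rewrite /= inordK // (ltn_trans (ltn_ord j)).
apply/matrixP => i j; rewrite !mxE /=.
rewrite -[RHS](@low (4 + i)%N j) ?ltn_ord //; last by rewrite (ltn_add2l 4 i 3) ltn_ord.
by congr (b _ _ _); apply: val_inj; rewrite /= inordK // (ltn_trans (ltn_ord j)).
Qed.

End Obstruction.

(** * The two obstructed algebras *)

Section Nonexistence.
Variable R : realType.
Local Notation e := (std_basis R).
Local Notation c x i := (x 0 (inord i)).
Local Notation F x y := (c x 0 * c y 1 - c x 1 * c y 0).

(** The last hypothesis on the bracket says that the centre has no components along [e 0, ..., e 3].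
    Coclosedness makes [b 6] central, and [frame_det4] then applies. *)
Lemma obstruction_frame (L : lieAlgebra R 7) (H : 'rV[R]_7 -> 'rV[R]_7 -> R)
    (phi : ext R 7) (G : 'M[R]_7) :
    (forall x y, L x y = - F x y *: e 4 - H x y *: e 5) ->
    (forall x, L x (e 4) = 0) -> (forall x, L x (e 5) = 0) ->
    (forall x, (forall y, L y x = 0) -> forall j : nat, (j < 4)%N -> c x j = 0) ->
    purely_coclosed L phi -> G2_induces phi G -> inner_product G ->
  exists (b : nat -> 'rV[R]_7) (x0 y0 s0 : R),
  [/\ forall i j : nat, (i < 7)%N -> (j < 7)%N -> inner G (b i) (b j) = (i == j)%:R,
      e 4 = x0 *: b 4 + y0 *: b 5 & e 5 = s0 *: b 5] /\
  [/\ forall x y, L x y = inner G (L x y) (b 4) *: b 4 + inner G (L x y) (b 5) *: b 5,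
      forall x, L x (b 4) = 0 & forall x, L x (b 5) = 0] /\
  [/\ x0 != 0, s0 != 0, \det (\matrix_(i < 4, j < 4) c (b i) j) != 0 &
      [/\ forall i, (i < 4)%N -> coeff4 G L b i 6%N = 0,
          forall i, (i < 4)%N -> coeff5 G L b i 6%N = 0 &
          conformal (coeff4 G L b) (coeff5 G L b)]].
Proof.
move=> LE e4c e5c Llow [[phi3 _] [G' [vol [gm dpsi]]] dphi] [vol' gm'] G_inner.
have [GG _] := G2_metric_volume_unique gm gm'; rewrite {}GG {vol' gm' G'} in gm dpsi.
have [_ [vol7 _] _] := gm.
have [z1 [z2 [x0 [y0 [s0 [[z11 z21 z12] [e4E e5E x00 s00]]]]]]] := plane_frame G_inner.
have [b [hb b4 b5 volb phib]] := adapted_frame phi3 gm z11 z21 z12.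
rewrite -b4 -b5 in e4E; rewrite -b5 in e5E.
have plane := bracket_plane LE hb e4E e5E.
have b5c x : L x (b 5) = 0 by rewrite (b5E e5E s00) bracketZr e5c scaler0.
have b4c x : L x (b 4) = 0.
  by rewrite (b4E e4E e5E x00 s00) bracketDr -scaleNr !bracketZr e4c e5c !scaler0 addr0.
have [A6 C6 AC] :=
  coclosed_frame_equations phi3 G_inner vol7 hb volb phib plane b4c b5c dpsi dphi.
exists b, x0, y0, s0; split; [by split|split; first by split]; split=> //.
apply: (frame_det4 hb e4E e5E x00 s00).
by apply: Llow => x; apply: (b6_central hb plane b4c b5c A6 C6).
Qed.

Lemma h3h3_bracketE x y : h3_h3_R R x y =
  - F x y *: e 4 - (c x 2 * c y 3 - c x 3 * c y 2) *: e 5.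
Proof.
apply: rowP7 => k k7; rewrite [LHS]mxE inordK //.
rewrite [RHS]mxE [X in _ = X + _]mxE [X in _ = _ + X]mxE [X in _ = _ - X]mxE !std_basisE //.
case: k k7 => [|[|[|[|[|[|[|//]]]]]]] _ /=;
rewrite ?(ext_eval2D, ext_eval2N, f2_eval, ext_eval0) /=; ring.
Qed.

Lemma n62_bracketE x y : n62_R R x y =
  - F x y *: e 4 - (c x 0 * c y 3 - c x 3 * c y 0 + (c x 1 * c y 2 - c x 2 * c y 1)) *: e 5.
Proof.
apply: rowP7 => k k7; rewrite [LHS]mxE inordK //.
rewrite [RHS]mxE [X in _ = X + _]mxE [X in _ = _ + X]mxE [X in _ = _ - X]mxE !std_basisE //.
case: k k7 => [|[|[|[|[|[|[|//]]]]]]] _ /=;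
rewrite ?(ext_eval2D, ext_eval2N, f2_eval, ext_eval0) /=; ring.
Qed.

Lemma bracket_coords (f g : R) (k : nat) : (k < 7)%N ->
  c (- f *: e 4 - g *: e 5) k = - f * (k == 4)%:R - g * (k == 5)%:R.
Proof.
by move=> k7; rewrite mxE [X in X + _]mxE [X in _ + X]mxE [X in _ - X]mxE !std_basisE.
Qed.

Lemma h3h3_no_structure : ~ (exists (phi : ext R 7) (G : 'M[R]_7),
  [/\ purely_coclosed (h3_h3_R R) phi, G2_induces phi G & is_nilsoliton (h3_h3_R R) G]).
Proof.
move=> [phi [G [hphi hG [G_inner [lambda [D [der ric]]]]]]].
have e4c x : h3_h3_R R x (e 4) = 0.
  by rewrite h3h3_bracketE !std_basisE //= !mulr0 !subr0 oppr0 !scale0r subr0.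
have e5c x : h3_h3_R R x (e 5) = 0.
  by rewrite h3h3_bracketE !std_basisE //= !mulr0 !subr0 oppr0 !scale0r subr0.
have [|b [x0 [y0 [s0 [[hb e4E e5E] [[plane b4c b5c] [x00 s00 dt [A6 C6 AC]]]]]]]] :=
    obstruction_frame h3h3_bracketE e4c e5c _ hphi hG G_inner.
  move=> x hx j j4.
  have h (i k : nat) : (k < 7)%N -> c (h3_h3_R R (e i) x) k = 0 by rewrite hx mxE.
  (* The brackets of [e 0, ..., e 3] with [x] return, up to sign, its coordinates 1, 0, 3 and 2. *)
  move: (h 0%N 4%N isT) (h 1%N 4%N isT) (h 2%N 5%N isT) (h 3%N 5%N isT).
  rewrite !h3h3_bracketE !bracket_coords // !std_basisE //=.
  by case: j j4 => [|[|[|[|//]]]] _; lra.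
have e3_2 : h3_h3_R R (e 3) (e 2) = e 5.
  by apply: rowP7 => k k7; rewrite h3h3_bracketE bracket_coords // !std_basisE //=; ring.
(* [D e_5 = [D e_3, e_2] + [e_3, D e_2]] is a multiple of [e_5], so that Ric, and with it
   the product [dot2 A C], has no mixed component on the centre. *)
have D5 : inner G (D (e 5)) (b 4) = 0.
  rewrite -e3_2 der innerDl !(bracket_b4 h3h3_bracketE hb e4E e5E) !std_basisE //=.
  by ring.
have D5' : inner G (D (b 5)) (b 4) = 0.
  by rewrite (b5E e5E s00) linearZ innerZl D5 mulr0.
have dAC : dot2 (coeff4 G (h3_h3_R R) b) (coeff5 G (h3_h3_R R) b) = 0.
  have := ricci_center G_inner hb plane b4c b5c A6 C6 4 (isT : 5 \in [:: 4; 5])%N.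
  rewrite ric innerDl innerZl D5' !hb //=; lra.
have := conformal_dot2 (coeff4C (h3_h3_R R) G b) (coeff5C (h3_h3_R R) G b) AC.
rewrite dAC => /esym.
(* The [y0] part of the [b 5] component drops out because [f^01] is decomposable, and [f^01 /\ f^23]
   evaluates to the determinant. *)
have -> : pf2 (coeff4 G (h3_h3_R R) b) (coeff5 G (h3_h3_R R) b) =
    x0 * s0 * \det (\matrix_(i < 4, j < 4) c (b i) j).
  rewrite (det4 (fun i j => c (b i) j)) /pf2 /coeff4 /coeff5.
  rewrite !(bracket_b4 h3h3_bracketE hb e4E e5E) !(bracket_b5 h3h3_bracketE hb e4E e5E).
  ring.
by move/eqP; rewrite !mulf_eq0 (negPf x00) (negPf s00) (negPf dt).
Qed.

Lemma n62_no_structure : ~ (exists (phi : ext R 7) (G : 'M[R]_7),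
  [/\ purely_coclosed (n62_R R) phi, G2_induces phi G & is_nilsoliton (n62_R R) G]).
Proof.
move=> [phi [G [hphi hG [G_inner [lambda [D [der ric]]]]]]].
have e4c x : n62_R R x (e 4) = 0.
  by rewrite n62_bracketE !std_basisE //= !mulr0 !subr0 addr0 oppr0 !scale0r subr0.
have e5c x : n62_R R x (e 5) = 0.
  by rewrite n62_bracketE !std_basisE //= !mulr0 !subr0 addr0 oppr0 !scale0r subr0.
have [|b [x0 [y0 [s0 [[hb e4E e5E] [[plane b4c b5c] [x00 s00 dt [A6 C6 AC]]]]]]]] :=
    obstruction_frame n62_bracketE e4c e5c _ hphi hG G_inner.
  move=> x hx j j4.
  have h (i k : nat) : (k < 7)%N -> c (n62_R R (e i) x) k = 0 by rewrite hx mxE.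
  move: (h 0%N 4%N isT) (h 1%N 4%N isT) (h 0%N 5%N isT) (h 1%N 5%N isT).
  rewrite !n62_bracketE !bracket_coords // !std_basisE //=.
  by case: j j4 => [|[|[|[|//]]]] _; lra.
have b4E := bracket_b4 n62_bracketE hb e4E e5E.
have b5E := bracket_b5 n62_bracketE hb e4E e5E.
pose A := coeff4 G (n62_R R) b; pose C := coeff5 G (n62_R R) b.
(* With [F = f^01] and [H = f^03 + f^12], both [F /\ F] and [F /\ H] vanish, while
   [H /\ H = 2 f^0123]. *)
have pAA : pf2 A A = 0 by rewrite /pf2 /A /coeff4 !b4E; ring.
have pAC : pf2 A C = 0 by rewrite /pf2 /A /C /coeff4 /coeff5 !b4E !b5E; ring.
have pCC : pf2 C C = 2 * s0 ^+ 2 * \det (\matrix_(i < 4, j < 4) c (b i) j).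
  by rewrite (det4 (fun i j => c (b i) j)) /pf2 /C /coeff5 !b5E; ring.
have pCC0 : pf2 C C != 0.
  by rewrite pCC !mulf_neq0 ?pnatr_eq0 // expf_neq0.
have dAC : dot2 A C = 0.
  by rewrite (conformal_dot2 (coeff4C (n62_R R) G b) (coeff5C (n62_R R) G b) AC).
have deriv k := soliton_deriv G_inner hb plane b4c b5c A6 C6 der ric (c := k) ^~ dAC.
have A0 := soliton_conformal_pf2 (coeff4C (n62_R R) G b) (coeff5C (n62_R R) G b) AC
  (deriv 4%N isT) (deriv 5%N isT) pAA pAC pCC0.
have F0 (i j : nat) : (i < 4)%N -> (j < 4)%N -> F (b i) (b j) = 0.
  move=> i4 j4; have := A0 i j i4 j4; rewrite /A /coeff4 b4E => /eqP.
  by rewrite mulf_eq0 oppr_eq0 (negPf x00) => /eqP.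
(* The expansion [det4] is linear in the minors [F], all of which vanish once [A] does. *)
move/eqP: dt; apply; rewrite (det4 (fun i j => c (b i) j)).
move: (F0 0%N 1%N isT isT) (F0 0%N 2%N isT isT) (F0 0%N 3%N isT isT).
move: (F0 1%N 2%N isT isT) (F0 1%N 3%N isT isT) (F0 2%N 3%N isT isT).
by move=> /= -> -> -> -> -> ->; ring.
Qed.

End Nonexistence.

Theorem corollary5p9 (R : realType) :
  [/\ exists (phi : ext R 7) (G : 'M[R]_7),
        [/\ purely_coclosed (h3C_R R) phi, G2_induces phi G
          & is_nilsoliton (h3C_R R) G],
      exists (phi : ext R 7) (G : 'M[R]_7),
        [/\ purely_coclosed (n52_R2 R) phi, G2_induces phi G
          & is_nilsoliton (n52_R2 R) G],
      ~ (exists (phi : ext R 7) (G : 'M[R]_7),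
        [/\ purely_coclosed (h3_h3_R R) phi, G2_induces phi G
          & is_nilsoliton (h3_h3_R R) G])
    & ~ (exists (phi : ext R 7) (G : 'M[R]_7),
        [/\ purely_coclosed (n62_R R) phi, G2_induces phi G
          & is_nilsoliton (n62_R R) G])].
Proof.
have induced : G2_induces (phi0 R) 1%:M by exists (vol0 R); exact: metric_phi0.
split; [| |exact: h3h3_no_structure|exact: n62_no_structure]; exists (phi0 R), 1%:M.
  by split; [exact: h3C_purely_coclosed|exact: induced|exact: h3C_nilsoliton].
by split; [exact: n52_purely_coclosed|exact: induced|exact: n52_nilsoliton].
Qed.
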